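(* Let $k$ be an algebraically closed field of characteristic zero, let $p$ be a prime number, and let $H$ be a semisimple Hopf algebra over $k$ of type $(1,p;p,1)$ as an algebra. Then $G(H^* )\subseteq Z(H^* )$ and $H^*$ is nilpotent.
   Context: $H$ being of type $(1,p;p,1)$ as an algebra means $H\simeq k^{(p)}\oplus M_p(k)$ as algebras. $G(H^* )$ is the group of group-like elements of $H^*$, and $Z(H^* )$ is the center of the algebra $H^*$. A semisimple Hopf algebra $A$ is nilpotent if the fusion category $\operatorname{Rep}A$ of its finite-dimensional representations is nilpotent: there are fusion categories $\mathcal C_0=\mathrm{Vec}_k,\mathcal C_1,\dots,\mathcal C_n=\operatorname{Rep}A$ and finite groups $G_1,\dots,G_n$ such that each $\mathcal C_i$ is faithfully graded by $G_i$ (i.e. $\mathcal C_i=\oplus_{g\in G_i}(\mathcal C_i)_g$ with nonzero full abelian subcategories $(\mathcal C_i)_g$, where $(\mathcal C_i)_g\otimes(\mathcal C_i)_h\subseteq(\mathcal C_i)_{gh}$ and $(\mathcal C_i)_g^*=(\mathcal C_i)_{g^{-1}}$) with trivial component $\mathcal C_{i-1}$. *)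

(* Defs.v *)
From HB Require Import structures.
From mathcomp Require Import all_boot all_fingroup all_algebra all_field.
From mathcomp Require Import mxtens.

Set Implicit Arguments.
Unset Strict Implicit.
Unset Printing Implicit Defensive.

Import GRing.Theory.
Local Open Scope ring_scope.

(* U (x) V is the space of matrices indexed by the coordinates of U and V;    *)
(* tens u v is the pure tensor, and tsum F t is the value at t of the linear  *)
(* map U (x) V -> W induced by a bilinear F (Lemma tsum_tens).  In particular *)
(* tsum (fun x y => F x y) (comul a) is Sweedler's sum of the F(a_1, a_2).    *)
Section Tensor.
Variable k : fieldType.
Import VectorInternalTheory.

Definition tensor (U V : vectType k) : Type := 'M[k]_(dim U, dim V).
HB.instance Definition _ U V := Vector.on (tensor U V).

Definition tens (U V : vectType k) (u : U) (v : V) : tensor U V :=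
  (v2r u)^T *m v2r v.

Definition cvec (U : vectType k) (i : 'I_(dim U)) : U := r2v (delta_mx 0 i).

Definition tsum (U V : vectType k) (W : lmodType k) (F : U -> V -> W)
    (t : tensor U V) : W :=
  \sum_i \sum_j t i j *: F (cvec i) (cvec j).

Definition bilin (U V W : lmodType k) (F : U -> V -> W) : Prop :=
  (forall v, linear (F^~ v)) /\ (forall u, linear (F u)).

Lemma tsum_is_linear (U V : vectType k) (W : lmodType k) (F : U -> V -> W) :
  linear (tsum F).
Proof.
move=> a s t; rewrite /tsum scaler_sumr -big_split; apply: eq_bigr => i _ /=.
rewrite scaler_sumr -big_split; apply: eq_bigr => j _ /=.
by rewrite !mxE scalerDl scalerA.
Qed.
HB.instance Definition _ (U V : vectType k) (W : lmodType k) (F : U -> V -> W) :=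
  GRing.isLinear.Build k (tensor U V) W _ (tsum F) (tsum_is_linear F).

Lemma eq_tsum (U V : vectType k) (W : lmodType k) (F G : U -> V -> W) t :
  (forall x y, F x y = G x y) -> tsum F t = tsum G t.
Proof.
by move=> e; apply: eq_bigr => i _; apply: eq_bigr => j _; rewrite e.
Qed.

Lemma linear_tsum (U V : vectType k) (W W' : lmodType k) (G : W -> W')
    (F : U -> V -> W) t :
  linear G -> G (tsum F t) = tsum (fun x y => G (F x y)) t.
Proof.
move=> lG; pose Gl : {linear W -> W'} := HB.pack G (GRing.isLinear.Build _ _ _ _ G lG).
rewrite -[G]/(Gl : W -> W') /tsum linear_sum; apply: eq_bigr => i _.
by rewrite linear_sum; apply: eq_bigr => j _; rewrite linearZ.
Qed.

Lemma exchange_tsum (U V U' V' : vectType k) (W : lmodType k)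
    (F : U -> V -> U' -> V' -> W) s t :
  tsum (fun x y => tsum (F x y) s) t =
  tsum (fun x' y' => tsum (fun x y => F x y x' y') t) s.
Proof.
pose T i j i' j' : W :=
  (t i j * s i' j') *: F (cvec i) (cvec j) (cvec i') (cvec j').
have -> : tsum (fun x y => tsum (F x y) s) t =
    \sum_i \sum_j \sum_i' \sum_j' T i j i' j'.
  apply: eq_bigr => i _; apply: eq_bigr => j _; rewrite scaler_sumr.
  apply: eq_bigr => i' _; rewrite scaler_sumr; apply: eq_bigr => j' _.
  by rewrite scalerA.
have -> : tsum (fun x' y' => tsum (fun x y => F x y x' y') t) s =
    \sum_i' \sum_j' \sum_i \sum_j T i j i' j'.
  apply: eq_bigr => i _; apply: eq_bigr => j _; rewrite scaler_sumr.
  apply: eq_bigr => i' _; rewrite scaler_sumr; apply: eq_bigr => j' _.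
  by rewrite scalerA [s _ _ * _]mulrC.
rewrite pair_bigA [RHS]pair_bigA /=; under eq_bigr => p _ do rewrite pair_bigA.
under [RHS]eq_bigr => p _ do rewrite pair_bigA.
by rewrite exchange_big.
Qed.

Lemma tensE (U V : vectType k) (u : U) (v : V) i j :
  tens u v i j = v2r u 0 i * v2r v 0 j.
Proof. by rewrite !mxE big_ord1 !mxE. Qed.

Lemma cvec_sum (U : vectType k) (u : U) : u = \sum_i v2r u 0 i *: cvec i.
Proof.
rewrite -{1}[u]v2rK {1}[v2r u]row_sum_delta linear_sum.
by apply: eq_bigr => i _; rewrite linearZ.
Qed.

Lemma tens_bilin (U V : vectType k) : bilin (@tens U V).
Proof.
split=> [v|u] a x y; apply/matrixP=> i j; rewrite !mxE !big_ord1 !mxE.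
  by rewrite linearP !mxE mulrDl mulrA.
by rewrite linearP !mxE mulrDr mulrCA.
Qed.

Lemma tsum_tens (U V : vectType k) (W : lmodType k) (F : U -> V -> W) u v :
  bilin F -> tsum F (tens u v) = F u v.
Proof.
move=> [lF rF].
have sl (Z : vectType k) (G : Z -> W) (n : nat) (c : 'I_n -> k) (e : 'I_n -> Z) :
    linear G -> G (\sum_i c i *: e i) = \sum_i c i *: G (e i).
  move=> lG; pose Gl : {linear Z -> W} := HB.pack G (GRing.isLinear.Build _ _ _ _ G lG).
  rewrite -[G]/(Gl : Z -> W) linear_sum; apply: eq_bigr => i _.
  by rewrite linearZ.
rewrite {2}[u]cvec_sum (sl _ (F^~ v)) //; apply: eq_bigr => i _ /=.
rewrite {2}[v]cvec_sum (sl _ (F _)) // scaler_sumr; apply: eq_bigr => j _.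
by rewrite scalerA tensE.
Qed.

End Tensor.

Arguments tens {k U V} u v.
Arguments tsum {k U V W} F t.
Arguments cvec {k U} i.

(* Hopf algebras of finite dimension; semisimple ones are all of this kind *)
HB.mixin Record isHopfAlgebra (k : fieldType) A of Falgebra k A := {
  comul : {linear A -> tensor A A};
  counit : {linear A -> k^o};
  antipode : {linear A -> A};
  coassoc : forall a : A,
    tsum (fun x z => tsum (fun x' y => tens x' (tens y z)) (comul x)) (comul a)
    = tsum (fun x y => tens x (comul y)) (comul a);
  counitl : forall a : A, tsum (fun x y => counit x *: y) (comul a) = a;
  counitr : forall a : A, tsum (fun x y => counit y *: x) (comul a) = a;
  comul1 : comul 1 = tens 1 1;
  comulM : forall a b : A, comul (a * b) =
    tsum (fun a1 a2 =>
      tsum (fun b1 b2 => tens (a1 * b1) (a2 * b2)) (comul b)) (comul a);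
  counit1 : counit 1 = 1;
  counitM : forall a b : A, counit (a * b) = counit a * counit b;
  antipodel : forall a : A,
    tsum (fun x y => antipode x * y) (comul a) = counit a *: 1;
  antipoder : forall a : A,
    tsum (fun x y => x * antipode y) (comul a) = counit a *: 1
}.

#[short(type="hopfAlgType")]
HB.structure Definition HopfAlgebra (k : fieldType) :=
  { A of Falgebra k A & isHopfAlgebra k A }.

Section BilinearTools.
Variable k : fieldType.

Lemma linear_eq (U W : lmodType k) (f g : U -> W) :
  (forall x, f x = g x) -> linear f -> linear g.
Proof. by move=> e lf a x y; rewrite -!e lf. Qed.

Lemma linear_scale (U W : lmodType k) (f : U -> W) c x :
  linear f -> f (c *: x) = c *: f x.
Proof.
move=> lf; pose fl : {linear U -> W} := HB.pack f (GRing.isLinear.Build _ _ _ _ f lf).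
by rewrite -[f]/(fl : U -> W) linearZ.
Qed.

Lemma tsum_linear_param (Z : lmodType k) (U V : vectType k) (W : lmodType k)
    (F : Z -> U -> V -> W) t :
  (forall u v, linear (fun z => F z u v)) -> linear (fun z => tsum (F z) t).
Proof.
move=> lF a x y; rewrite /tsum scaler_sumr -big_split; apply: eq_bigr => i _ /=.
rewrite scaler_sumr -big_split; apply: eq_bigr => j _ /=.
by rewrite lF scalerDr !scalerA mulrC.
Qed.

Lemma tsum_linear_arg (Z : lmodType k) (U V : vectType k) (W : lmodType k)
    (F : U -> V -> W) (t : Z -> tensor U V) :
  linear t -> linear (fun z => tsum F (t z)).
Proof. by move=> lt a x y; rewrite lt linearP. Qed.

End BilinearTools.

Section HopfTheory.
Variables (k : fieldType) (H : hopfAlgType k).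
Implicit Types a b : H.
Local Notation Δ := (@comul k H).
Local Notation ε := (@counit k H).
Local Notation S := (@antipode k H).

Lemma sweedler_assoc (W : lmodType k) (T : H -> H -> H -> W) a :
  (forall y z, linear (fun x => T x y z)) ->
  (forall x z, linear (fun y => T x y z)) ->
  (forall x y, linear (fun z => T x y z)) ->
  tsum (fun x z => tsum (fun x' y => T x' y z) (Δ x)) (Δ a)
  = tsum (fun x y => tsum (T x) (Δ y)) (Δ a).
Proof.
move=> l1 l2 l3.
pose G := tsum (fun x => tsum (T x)) : tensor H (tensor H H) -> W.
have lG : linear G by move=> c s t; rewrite /G linearP.
have GE x s : G (tens x s) = tsum (T x) s.
  apply: tsum_tens; split=> [s'|x'] c u v; last by rewrite linearP.
  by apply: (tsum_linear_param (F := T)) => y z; apply: l1.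
have lT x : bilin (T x) by split=> [z|y]; [apply: l2 | apply: l3].
have := congr1 G (coassoc a); rewrite !(linear_tsum _ _ lG).
under [RHS]eq_tsum => x y do rewrite GE.
move=> <-; apply: eq_tsum => x z; rewrite (linear_tsum _ _ lG).
by apply: eq_tsum => x' y; rewrite GE tsum_tens.
Qed.


Lemma antipode1 : S 1 = 1.
Proof.
have := antipodel (1 : H); rewrite comul1 tsum_tens ?mulr1 ?counit1 ?scale1r //.
split=> [v|u] c x y /=; first by rewrite linearP mulrDl scalerAl.
by rewrite mulrDr scalerAr.
Qed.

(* convolution of maps H (x) H -> H, used to compare S(ab) with S(b)S(a) *)
Let conv (F G : H -> H -> H) a b : H :=
  tsum (fun a1 a2 => tsum (fun b1 b2 => F a1 b1 * G a2 b2) (Δ b)) (Δ a).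

Let linearl (U : lmodType k) (A : lalgType k) (f : U -> A) (c : A) :
  linear f -> linear (fun x => f x * c).
Proof. by move=> lf a x y; rewrite lf mulrDl scalerAl. Qed.

Let linearr (U : lmodType k) (A : algType k) (f : U -> A) (c : A) :
  linear f -> linear (fun x => c * f x).
Proof. by move=> lf a x y; rewrite lf mulrDr scalerAr. Qed.

Let convA F G K : bilin F -> bilin G -> bilin K ->
  forall a b, conv (conv F G) K a b = conv F (conv G K) a b.
Proof.
move=> [F1 F2] [G1 G2] [K1 K2] a b; rewrite /conv.
transitivity (tsum (fun a' a3 => tsum (fun a1 a2 =>
    tsum (fun b' b3 => tsum (fun b1 b2 => F a1 b1 * G a2 b2 * K a3 b3)
      (Δ b')) (Δ b)) (Δ a')) (Δ a)).
  apply: eq_tsum => a' a3; rewrite exchange_tsum; apply: eq_tsum => b' b3.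
  rewrite (linear_tsum (G := fun x => x * K a3 b3)); last first.
    exact: (@linearl _ _ id).
  apply: eq_tsum => a1 a2.
  by rewrite (linear_tsum (G := fun x => x * K a3 b3)) //; apply: (@linearl _ _ id).
rewrite (@sweedler_assoc _ (fun a1 a2 a3 =>  tsum (fun b' b3 =>
    tsum (fun b1 b2 => F a1 b1 * G a2 b2 * K a3 b3) (Δ b')) (Δ b))).
- apply: eq_tsum => a1 a'.
  transitivity (tsum (fun a2 a3 => tsum (fun b1 b' => tsum (fun b2 b3 =>
      F a1 b1 * G a2 b2 * K a3 b3) (Δ b')) (Δ b)) (Δ a')).
    apply: eq_tsum => a2 a3.
    rewrite (@sweedler_assoc _ (fun b1 b2 b3 => F a1 b1 * G a2 b2 * K a3 b3)) //.
    + by move=> y z; apply: linearl; apply: linearl; apply: F2.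
    + by move=> y z; apply: linearl; apply: linearr; apply: G2.
    + by move=> y z; apply: linearr; apply: K2.
  rewrite exchange_tsum; apply: eq_tsum => b1 b'.
  rewrite (linear_tsum (G := fun x => F a1 b1 * x)); last first.
    exact: (@linearr _ _ id).
  apply: eq_tsum => a2 a3.
  rewrite (linear_tsum (G := fun x => F a1 b1 * x)); last first.
    exact: (@linearr _ _ id).
  by apply: eq_tsum => b2 b3; rewrite mulrA.
- move=> y z; apply: tsum_linear_param => u v; apply: tsum_linear_param => u' v'.
  by apply: linearl; apply: linearl; apply: F1.
- move=> y z; apply: tsum_linear_param => u v; apply: tsum_linear_param => u' v'.
  by apply: linearl; apply: linearr; apply: G1.
- move=> y z; apply: tsum_linear_param => u v; apply: tsum_linear_param => u' v'.
  by apply: linearr; apply: K1.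
Qed.

Lemma antipodeM a b : S (a * b) = S b * S a.
Proof.
pose L a b : H := S (a * b); pose M a b : H := a * b; pose R a b : H := S b * S a.
pose e a b : H := (ε a * ε b : k) *: (1 : H).
have bL : bilin L.
  split=> [v|u] c x y; rewrite /L.
    by rewrite mulrDl -scalerAl linearP.
  by rewrite mulrDr -scalerAr linearP.
have bM : bilin M by split=> [v|u]; [exact: (@linearl _ _ id)|exact: (@linearr _ _ id)].
have bR : bilin R.
  split=> [v|u]; [apply: linearr|apply: linearl] => c x y; exact: linearP.
have Fe F : bilin F -> conv F e a b = F a b.
  move=> [F1 F2]; rewrite -{2}[a]counitr.
  have lF x : linear (F x) by exact: F2.
  rewrite (linear_tsum (G := F^~ b)) //; apply: eq_tsum => a1 a2.
  rewrite -{2}[b]counitr (linear_tsum _ _ (lF _)); apply: eq_tsum => b1 b2.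
  by rewrite /e -scalerAr mulr1 -scalerA (linear_scale _ _ (lF _)) (linear_scale _ _ (F1 b1)) !scalerA mulrC.
have eF F : bilin F -> conv e F a b = F a b.
  move=> [F1 F2]; rewrite -{2}[a]counitl.
  have lF x : linear (F x) by exact: F2.
  rewrite (linear_tsum (G := F^~ b)) //; apply: eq_tsum => a1 a2.
  rewrite -{2}[b]counitl (linear_tsum _ _ (lF _)); apply: eq_tsum => b1 b2.
  by rewrite /e -scalerAl mul1r -scalerA (linear_scale _ _ (lF _)) (linear_scale _ _ (F1 b2)) !scalerA mulrC.
have LM a' b' : conv L M a' b' = e a' b'.
  have h := antipodel (a' * b'); rewrite counitM in h; apply: (etrans _ h).
  rewrite comulM; apply/esym.
  rewrite (linear_tsum (G := tsum (fun x y => S x * y))); last exact: linearP.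
  apply: eq_tsum => a1 a2.
  rewrite (linear_tsum (G := tsum (fun x y => S x * y))); last exact: linearP.
  apply: eq_tsum => b1 b2; rewrite tsum_tens //.
  by split=> [v|u]; [apply: linearl => c x y; exact: linearP|exact: (@linearr _ _ id)].
have MR a' b' : conv M R a' b' = e a' b'.
  transitivity (tsum (fun a1 a2 => a1 * ((ε b' : k) *: (1 : H)) * S a2) (Δ a')).
    apply: eq_tsum => a1 a2; rewrite -antipoder.
    rewrite (linear_tsum (G := fun x => a1 * x)); last exact: (@linearr _ _ id).
    rewrite (linear_tsum (G := fun x => x * S a2)); last exact: (@linearl _ _ id).
    by apply: eq_tsum => b1 b2; rewrite /M /R !mulrA.
  transitivity ((ε b' : k) *: tsum (fun x y => x * S y) (Δ a')).
    rewrite (linear_tsum (G := fun x => (ε b' : k) *: x)); last first.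
      by move=> c x y; rewrite scalerDr !scalerA mulrC.
    by apply: eq_tsum => a1 a2; rewrite -scalerAr mulr1 -scalerAl.
  by rewrite antipoder scalerA mulrC.
have be : bilin e.
  have lε c x y : (ε (c *: x + y) : k) = c * ε x + ε y by rewrite linearP.
  split=> [v|u] c x y; rewrite /e lε.
    by rewrite mulrDl scalerDl -mulrA scalerA.
  by rewrite mulrDr scalerDl mulrCA scalerA.
have eqc F F' G G' : (forall x y, F x y = F' x y) ->
    (forall x y, G x y = G' x y) -> conv F G a b = conv F' G' a b.
  by move=> eF' eG; do 2!apply: eq_tsum => ? ?; rewrite eF' eG.
rewrite -[LHS](Fe L bL) (eqc _ L _ (conv M R)) //.
by rewrite -convA // (eqc _ e _ R) // eF.
Qed.

End HopfTheory.

Section Dual.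
Variables (k : fieldType) (H : hopfAlgType k).
Local Notation Δ := (@comul k H).
Local Notation ε := (@counit k H).
Local Notation S := (@antipode k H).
Import VectorInternalTheory.

(* H^* has the convolution product (hdualME), unit ε, counit f |-> f 1,        *)
(* antipode f |-> f \o S, and the coproduct determined by                      *)
(* f_1(a) f_2(b) = f(a b) (sweedler_dual, contract2_inj).                       *)
Definition hdual : Type := 'Hom(H, k^o).
HB.instance Definition _ := Vector.on hdual.
Implicit Types (f g : hdual) (a b c : H).

Lemma hdualP f g : (forall a, f a = g a) -> f = g.
Proof. by move=> e; apply/lfunP. Qed.

Lemma hdual_linear f : linear f.
Proof. by move=> c x y; rewrite linearP. Qed.

Lemma hdual_eval_linear a : linear (fun f : hdual => f a).
Proof. by move=> c x y; rewrite add_lfunE scale_lfunE. Qed.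

Definition hdual_of (f : H -> k^o) : hdual := linfun f.

Lemma hdual_ofE (f : H -> k^o) a : linear f -> hdual_of f a = f a.
Proof.
move=> lf; pose fl : {linear H -> k^o} := HB.pack f (GRing.isLinear.Build _ _ _ _ f lf).
by rewrite /hdual_of -[f]/(fl : H -> k^o) lfunE.
Qed.

Definition dual_mul f g : hdual :=
  hdual_of (fun a => tsum (fun x y => f x * g y) (Δ a)).
Definition dual_one : hdual := hdual_of ε.

Lemma dual_mulE f g a : dual_mul f g a = tsum (fun x y => f x * g y) (Δ a).
Proof.
by apply: hdual_ofE; apply: tsum_linear_arg => c x y; rewrite linearP.
Qed.

Lemma dual_oneE a : dual_one a = ε a.
Proof. by apply: hdual_ofE => c x y; rewrite linearP. Qed.

Let linl f (z : k^o) : linear (fun x => (f x : k^o) * z).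
Proof. by move=> c x y; rewrite hdual_linear mulrDl scalerAl. Qed.
Let linr f (z : k^o) : linear (fun x => z * (f x : k^o)).
Proof. by move=> c x y; rewrite hdual_linear mulrDr scalerAr. Qed.

Lemma dual_mulA : associative dual_mul.
Proof.
move=> f g h; apply: hdualP => a; rewrite !dual_mulE.
have lm (z : k^o) : linear (fun x : k^o => x * z).
  by move=> c x y; rewrite mulrDl scalerAl.
have lm' (z : k^o) : linear (fun x : k^o => z * x).
  by move=> c x y; rewrite mulrDr scalerAr.
transitivity (tsum (fun x y => tsum (fun y1 y2 => f x * g y1 * h y2 : k^o) (Δ y)) (Δ a)).
  apply: eq_tsum => x y; rewrite dual_mulE (linear_tsum _ _ (lm' _)).
  by apply: eq_tsum => y1 y2; rewrite mulrA.
rewrite -(@sweedler_assoc _ _ _ (fun x y z => f x * g y * h z : k^o)).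
- apply: eq_tsum => x y; rewrite dual_mulE (linear_tsum _ _ (lm _)).
  by apply: eq_tsum.
- by move=> y z c u v; rewrite hdual_linear !mulrDl !scalerAl.
- by move=> y z c u v; rewrite hdual_linear mulrDr mulrDl -scalerAr -scalerAl.
- by move=> y z; apply: linr.
Qed.

Lemma dual_mul1l : left_id dual_one dual_mul.
Proof.
move=> f; apply: hdualP => a; rewrite dual_mulE -{2}[a]counitl.
rewrite (linear_tsum _ _ (hdual_linear f)); apply: eq_tsum => x y.
by rewrite dual_oneE (linear_scale _ _ (hdual_linear f)).
Qed.

Lemma dual_mul1r : right_id dual_one dual_mul.
Proof.
move=> f; apply: hdualP => a; rewrite dual_mulE -{2}[a]counitr.
rewrite (linear_tsum _ _ (hdual_linear f)); apply: eq_tsum => x y.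
by rewrite dual_oneE (linear_scale _ _ (hdual_linear f)) mulrC.
Qed.

Lemma dual_mulDl : left_distributive dual_mul +%R.
Proof.
move=> f g h; apply: hdualP => a; rewrite -[RHS]/((_ : 'Hom(H, k^o)) a).
rewrite add_lfunE !dual_mulE /tsum -big_split.
apply: eq_bigr => i _; rewrite -big_split; apply: eq_bigr => j _ /=.
by rewrite -scalerDr -mulrDl; congr (_ *: (_ * _)); exact: add_lfunE.
Qed.

Lemma dual_mulDr : right_distributive dual_mul +%R.
Proof.
move=> f g h; apply: hdualP => a; rewrite -[RHS]/((_ : 'Hom(H, k^o)) a).
rewrite add_lfunE !dual_mulE /tsum -big_split.
apply: eq_bigr => i _; rewrite -big_split; apply: eq_bigr => j _ /=.
by rewrite -scalerDr -mulrDr; congr (_ *: (_ * _)); exact: add_lfunE.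
Qed.

Lemma dual_one_neq0 : dual_one != 0.
Proof.
apply/eqP => /(congr1 (fun f : hdual => f 1)); rewrite dual_oneE counit1.
by rewrite zero_lfunE => /eqP; rewrite oner_eq0.
Qed.

HB.instance Definition _ := GRing.Zmodule_isNzRing.Build hdual
  dual_mulA dual_mul1l dual_mul1r dual_mulDl dual_mulDr dual_one_neq0.

Lemma dual_scaleAl (c : k) f g : c *: (f * g) = c *: f * g.
Proof.
apply: hdualP => a; rewrite [LHS](linear_scale _ _ (hdual_eval_linear a)).
rewrite [in LHS]dual_mulE [RHS]dual_mulE.
rewrite (linear_tsum (G := fun x : k^o => c *: x)); last first.
  by move=> d x y; rewrite scalerDr !scalerA mulrC.
apply: eq_tsum => x y.
by rewrite (linear_scale _ _ (hdual_eval_linear _)) scalerAl.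
Qed.

Lemma dual_scaleAr (c : k) f g : c *: (f * g) = f * (c *: g).
Proof.
apply: hdualP => a; rewrite [LHS](linear_scale _ _ (hdual_eval_linear a)).
rewrite [in LHS]dual_mulE [RHS]dual_mulE.
rewrite (linear_tsum (G := fun x : k^o => c *: x)); last first.
  by move=> d x y; rewrite scalerDr !scalerA mulrC.
apply: eq_tsum => x y.
by rewrite (linear_scale _ _ (hdual_eval_linear _)) scalerAr.
Qed.

HB.instance Definition _ := GRing.Lmodule_isLalgebra.Build k hdual dual_scaleAl.
HB.instance Definition _ := GRing.Lalgebra_isAlgebra.Build k hdual dual_scaleAr.
HB.instance Definition _ := Algebra_isFalgebra.Build k hdual.

Lemma hdual1E a : (1 : hdual) a = ε a. Proof. exact: dual_oneE. Qed.

Lemma hdualME f g a : (f * g) a = tsum (fun x y => f x * g y) (Δ a).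
Proof. exact: dual_mulE. Qed.

(* contraction of H^* (x) V at a : H, in the first variable *)
Definition contract (V : vectType k) a (t : tensor hdual V) : V :=
  tsum (fun (f : hdual) v => (f a : k) *: v) t.

Lemma contract_linear (V : vectType k) a : linear (@contract V a).
Proof. by move=> c s t; rewrite /contract linearP. Qed.

Lemma contract_tens (V : vectType k) a f (v : V) :
  contract a (tens f v) = (f a : k) *: v.
Proof.
apply: tsum_tens; split=> [u|u] c x y.
  by rewrite hdual_eval_linear scalerDl scalerA.
by rewrite scalerDr !scalerA mulrC.
Qed.

Lemma contract_inj (V : vectType k) (s t : tensor hdual V) :
  (forall a, contract a s = contract a t) -> s = t.
Proof.
move=> e; apply/eqP; rewrite -subr_eq0; apply/eqP; set d := s - t.
have d0 a : contract a d = 0.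
  rewrite /d -scaleN1r addrC (contract_linear a) e scaleN1r.
  by rewrite addNr.
clearbody d; apply/matrixP=> i j; rewrite [RHS]mxE.
pose h : hdual := \sum_l d l j *: cvec l.
have h0 : h = 0.
  apply: hdualP => a.
  have sumE n (F : 'I_n -> hdual) : (\sum_l F l) a = \sum_l (F l) a.
    by rewrite sum_lfunE.
  have := congr1 (fun v => v2r v 0 j) (d0 a).
  have -> : (0 : hdual) a = 0 by rewrite zero_lfunE.
  rewrite linear0 mxE => <-; rewrite /contract /tsum linear_sum summxE.
  apply: etrans (sumE _ _) _.
  apply: eq_bigr => l _; rewrite linear_sum summxE (bigD1 j) //= big1 => [|m mj].
    rewrite addr0 !linearZ_LR !mxE /cvec /= r2vK !mxE !eqxx mulr1.
    exact: (linear_scale _ _ (hdual_eval_linear a)).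
  by rewrite !linearZ_LR !mxE /cvec /= r2vK !mxE eq_sym (negPf mj) !mulr0.
have := congr1 (fun v => v2r v 0 i) h0; rewrite linear0 mxE => <-.
rewrite linear_sum summxE (bigD1 i) //= big1 => [|m mj].
  by rewrite addr0 linearZ_LR mxE /cvec /= r2vK !mxE !eqxx mulr1.
by rewrite linearZ_LR mxE /cvec /= r2vK !mxE eq_sym (negPf mj) !mulr0.
Qed.

Definition dual_basis (i : 'I_(dim H)) : hdual :=
  hdual_of (fun a => v2r a 0 i : k^o).

(* the element of H^* (x) H^* corresponding to (a, b) |-> f (a * b) *)
Definition dual_comul f : tensor hdual hdual :=
  \sum_i \sum_j (f (cvec i * cvec j) : k) *: tens (dual_basis i) (dual_basis j).
Definition dual_counit f : k^o := f 1.
Definition dual_antipode f : hdual := hdual_of (fun a => f (S a)).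

Lemma dual_comul_linear : linear dual_comul.
Proof.
move=> c f g; rewrite /dual_comul scaler_sumr -big_split; apply: eq_bigr => i _.
rewrite scaler_sumr -big_split; apply: eq_bigr => j _.
by rewrite hdual_eval_linear scalerDl scalerA.
Qed.
HB.instance Definition _ :=
  GRing.isLinear.Build k hdual (tensor hdual hdual) _ dual_comul dual_comul_linear.

Lemma dual_counit_linear : linear dual_counit.
Proof. exact: hdual_eval_linear. Qed.
HB.instance Definition _ :=
  GRing.isLinear.Build k hdual k^o _ dual_counit dual_counit_linear.

Lemma dual_antipodeE f a : dual_antipode f a = f (S a).
Proof. by apply: hdual_ofE => c x y; rewrite linearP hdual_linear. Qed.

Lemma dual_antipode_linear : linear dual_antipode.
Proof.
move=> c f g; apply: hdualP => a.
by rewrite hdual_eval_linear !dual_antipodeE hdual_eval_linear.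
Qed.
HB.instance Definition _ :=
  GRing.isLinear.Build k hdual hdual _ dual_antipode dual_antipode_linear.

Lemma dual_comulE f a b : (contract a (dual_comul f) : hdual) b = f (a * b).
Proof.
rewrite {2}[a]cvec_sum {2}[b]cvec_sum.
have lc : linear (fun t : tensor hdual hdual => (contract a t : hdual) b).
  by move=> c s t; rewrite contract_linear hdual_eval_linear.
pose G : {linear tensor hdual hdual -> k^o} :=
  HB.pack (fun t : tensor hdual hdual => (contract a t : hdual) b)
    (GRing.isLinear.Build _ _ _ _ _ lc).
pose F : {linear H -> k^o} :=
  HB.pack (fun_of_lfun f) (GRing.isLinear.Build _ _ _ _ _ (hdual_linear f)).
rewrite -[LHS]/(G _) -[RHS]/(F _) linear_sum mulr_suml linear_sum.
apply: eq_bigr => i _; rewrite mulr_sumr !linear_sum; apply: eq_bigr => j _.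
rewrite linearZ -scalerAl -scalerAr !linearZ /= contract_tens.
rewrite (linear_scale _ _ (hdual_eval_linear b)).
rewrite !hdual_ofE; last 2 first.
- by move=> c x y; rewrite linearP !mxE.
- by move=> c x y; rewrite linearP !mxE.
by rewrite scalerA /= /GRing.scale /= mulrC.
Qed.

Definition contract2 a b (t : tensor hdual hdual) : k^o :=
  (contract a t : hdual) b.

Lemma contract2_linear a b : linear (contract2 a b).
Proof. by move=> c s t; rewrite /contract2 contract_linear hdual_eval_linear. Qed.

Lemma contract2_tens a b f g : contract2 a b (tens f g) = f a * g b.
Proof.
by rewrite /contract2 contract_tens (linear_scale _ _ (hdual_eval_linear b)).
Qed.

Lemma contract2_inj s t : (forall a b, contract2 a b s = contract2 a b t) -> s = t.
Proof. by move=> e; apply: contract_inj => a; apply: hdualP => b; apply: e. Qed.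

Lemma contract2E a b t :
  contract2 a b t = tsum (fun f g : hdual => f a * g b : k^o) t.
Proof.
rewrite /contract2 /contract (linear_tsum _ _ (hdual_eval_linear b)).
by apply: eq_tsum => f g; rewrite (linear_scale _ _ (hdual_eval_linear b)).
Qed.

Let lmul (z : k^o) : linear (fun x : k^o => z * x).
Proof. by move=> c x y; rewrite mulrDr scalerAr. Qed.
Let rmul (z : k^o) : linear (fun x : k^o => x * z).
Proof. by move=> c x y; rewrite mulrDl scalerAl. Qed.

Lemma sweedler_dual f a b :
  tsum (fun x y : hdual => x a * y b : k^o) (dual_comul f) = f (a * b).
Proof. by rewrite -contract2E [LHS]dual_comulE. Qed.

Lemma dual_coassoc f :
  tsum (fun x z => tsum (fun x' y => tens x' (tens y z)) (dual_comul x))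
    (dual_comul f)
  = tsum (fun x y => tens x (dual_comul y)) (dual_comul f).
Proof.
apply: contract_inj => a; apply: contract2_inj => b c.
have lE : linear (fun t : tensor hdual (tensor hdual hdual) =>
    contract2 b c (contract a t)).
  by move=> d s t; rewrite contract_linear contract2_linear.
rewrite (linear_tsum _ _ lE) [RHS](linear_tsum _ _ lE).
transitivity (f (a * b * c)); last rewrite -mulrA.
  rewrite -sweedler_dual; apply: eq_tsum => x z.
  rewrite (linear_tsum _ _ lE) -sweedler_dual (linear_tsum _ _ (rmul _)).
  apply: eq_tsum => x' y.
  rewrite contract_tens (linear_scale _ _ (contract2_linear b c)).
  by rewrite contract2_tens; apply: mulrA.
rewrite -sweedler_dual; apply: eq_tsum => x y.
rewrite contract_tens (linear_scale _ _ (contract2_linear b c)).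
by rewrite contract2E sweedler_dual.
Qed.

Lemma dual_counitl f :
  tsum (fun x y => dual_counit x *: y) (dual_comul f) = f.
Proof.
apply: hdualP => b; rewrite (linear_tsum _ _ (hdual_eval_linear b)).
rewrite -[in RHS](mul1r b) -sweedler_dual; apply: eq_tsum => x y.
exact: (linear_scale _ _ (hdual_eval_linear b)).
Qed.

Lemma dual_counitr f :
  tsum (fun x y => dual_counit y *: x) (dual_comul f) = f.
Proof.
apply: hdualP => b; rewrite (linear_tsum _ _ (hdual_eval_linear b)).
rewrite -[in RHS](mulr1 b) -sweedler_dual; apply: eq_tsum => x y.
by rewrite mulrC; exact: (linear_scale _ _ (hdual_eval_linear b)).
Qed.

Lemma dual_comul1 : dual_comul 1 = tens 1 1.
Proof.
apply: contract2_inj => a b; rewrite contract2_tens [LHS]dual_comulE.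
by rewrite !hdual1E counitM.
Qed.

Lemma dual_comulM f g : dual_comul (f * g) =
  tsum (fun f1 f2 => tsum (fun g1 g2 => tens (f1 * g1) (f2 * g2))
    (dual_comul g)) (dual_comul f).
Proof.
apply: contract2_inj => a b; rewrite [LHS]dual_comulE hdualME comulM.
pose P (x y : H) : k^o := f x * g y.
have lP : linear (tsum P) by exact: linearP.
rewrite -/P (linear_tsum _ _ lP) (linear_tsum _ _ (contract2_linear a b)).
pose T a1 a2 b1 b2 (f1 f2 g1 g2 : hdual) : k^o :=
  f1 a1 * f2 b1 * (g1 a2 * g2 b2).
transitivity (tsum (fun a1 a2 => tsum (fun b1 b2 => tsum (fun f1 f2 =>
    tsum (fun g1 g2 => T a1 a2 b1 b2 f1 f2 g1 g2) (dual_comul g))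
    (dual_comul f)) (Δ b)) (Δ a)).
  apply: eq_tsum => a1 a2; rewrite (linear_tsum _ _ lP); apply: eq_tsum => b1 b2.
  rewrite tsum_tens; last by split=> [v|u]; [apply: linl|apply: linr].
  rewrite /P -!sweedler_dual (linear_tsum _ _ (rmul _)); apply: eq_tsum => f1 f2.
  by rewrite (linear_tsum _ _ (lmul _)).
transitivity (tsum (fun a1 a2 => tsum (fun f1 f2 => tsum (fun g1 g2 =>
    tsum (fun b1 b2 => T a1 a2 b1 b2 f1 f2 g1 g2) (Δ b)) (dual_comul g))
    (dual_comul f)) (Δ a)).
  apply: eq_tsum => a1 a2; rewrite exchange_tsum; apply: eq_tsum => f1 f2.
  by rewrite exchange_tsum.
rewrite exchange_tsum; apply: eq_tsum => f1 f2; rewrite exchange_tsum.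
rewrite (linear_tsum _ _ (contract2_linear a b)); apply: eq_tsum => g1 g2.
rewrite contract2_tens !hdualME (linear_tsum _ _ (rmul _)).
apply: eq_tsum => a1 a2; rewrite (linear_tsum _ _ (lmul _)).
by apply: eq_tsum => b1 b2; rewrite /T mulrACA.
Qed.

Lemma dual_counit1 : dual_counit 1 = 1.
Proof. by rewrite /dual_counit hdual1E counit1. Qed.

Lemma dual_counitM f g : dual_counit (f * g) = dual_counit f * dual_counit g.
Proof.
by rewrite /dual_counit hdualME comul1 tsum_tens.
Qed.

Lemma dual_antipodel f :
  tsum (fun x y => dual_antipode x * y) (dual_comul f) = dual_counit f *: 1.
Proof.
apply: hdualP => a; rewrite (linear_tsum _ _ (hdual_eval_linear a)).
transitivity (tsum (fun x y : hdual => tsum (fun a1 a2 => x (S a1) * y a2 : k^o) (Δ a))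
    (dual_comul f)).
  apply: eq_tsum => x y; rewrite hdualME.
  by apply: eq_tsum => a1 a2; rewrite dual_antipodeE.
rewrite exchange_tsum (linear_scale _ _ (hdual_eval_linear a)) hdual1E.
transitivity (f (tsum (fun x y => S x * y) (Δ a))).
  rewrite (linear_tsum _ _ (hdual_linear f)).
  by apply: eq_tsum => a1 a2; rewrite sweedler_dual.
by rewrite antipodel (linear_scale _ _ (hdual_linear f)); apply: mulrC.
Qed.

Lemma dual_antipoder f :
  tsum (fun x y => x * dual_antipode y) (dual_comul f) = dual_counit f *: 1.
Proof.
apply: hdualP => a; rewrite (linear_tsum _ _ (hdual_eval_linear a)).
transitivity (tsum (fun x y : hdual => tsum (fun a1 a2 => x a1 * y (S a2) : k^o) (Δ a))
    (dual_comul f)).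
  apply: eq_tsum => x y; rewrite hdualME.
  by apply: eq_tsum => a1 a2; rewrite dual_antipodeE.
rewrite exchange_tsum (linear_scale _ _ (hdual_eval_linear a)) hdual1E.
transitivity (f (tsum (fun x y => x * S y) (Δ a))).
  rewrite (linear_tsum _ _ (hdual_linear f)).
  by apply: eq_tsum => a1 a2; rewrite sweedler_dual.
by rewrite antipoder (linear_scale _ _ (hdual_linear f)); apply: mulrC.
Qed.

HB.instance Definition _ := isHopfAlgebra.Build k hdual
  dual_coassoc dual_counitl dual_counitr dual_comul1 dual_comulM
  dual_counit1 dual_counitM dual_antipodel dual_antipoder.
End Dual.

Definition left_ideal (k : fieldType) (A : falgType k) (U : {vspace A}) : bool :=
  ({:A} * U <= U)%VS.

(* A is semisimple as a left module over itself *)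
Definition semisimple (k : fieldType) (A : falgType k) : Prop :=
  forall U : {vspace A}, left_ideal U ->
  exists W : {vspace A},
    [/\ left_ideal W, (U + W)%VS = fullv & (U :&: W)%VS = 0%VS].

(* A is isomorphic, as a k-algebra, to the product of k^p and M_p(k) *)
Definition type_1p_p1 (k : fieldType) (p : nat) (A : falgType k) : Prop :=
  exists phi : {linear A -> ({ffun 'I_p -> k^o} * 'M[k]_p)%type},
    [/\ bijective phi,
        phi 1 = ([ffun _ => 1], 1%:M)
      & forall x y, phi (x * y) =
          ([ffun i => (phi x).1 i * (phi y).1 i], (phi x).2 *m (phi y).2)].

Definition grouplike (k : fieldType) (H : hopfAlgType k) (g : H) : Prop :=
  comul g = tens g g /\ counit g = 1.

(* Finite-dimensional representations are taken in matrix form, a matrix      *)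
(* acting on column vectors.                                                  *)
Section Representations.
Variables (k : fieldType) (A : hopfAlgType k).

Record rep := Rep {
  deg : nat;
  act :> {linear A -> 'M[k]_deg};
  act1 : act 1 = 1%:M;
  actM : forall a b, act (a * b) = act a *m act b
}.
Implicit Types U V W : rep.

Definition rep_hom V W (f : 'M[k]_(deg W, deg V)) : Prop :=
  forall a, f *m V a = W a *m f.

Definition rep_iso V W : Prop :=
  exists (f : 'M_(deg W, deg V)) (g : 'M_(deg V, deg W)),
    [/\ rep_hom f, rep_hom g, g *m f = 1%:M & f *m g = 1%:M].

(* V is a direct sum of the W x, by the equations of a biproduct; for I empty *)
(* this says that V is zero, and for I a point that V is isomorphic to W x    *)
Definition is_dsum (I : finType) V (W : I -> rep) : Prop :=
  exists (i : forall x, 'M_(deg V, deg (W x)))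
         (p : forall x, 'M_(deg (W x), deg V)),
    [/\ forall x, rep_hom (i x) /\ rep_hom (p x),
        forall x, p x *m i x = 1%:M,
        forall x y, x != y -> p x *m i y = 0
      & \sum_x i x *m p x = 1%:M].

Definition is_kernel V W (f : 'M_(deg W, deg V))
    (K : rep) (i : 'M_(deg V, deg K)) : Prop :=
  [/\ rep_hom i, f *m i = 0
    & forall U (u : 'M_(deg V, deg U)), rep_hom u -> f *m u = 0 ->
        exists! v : 'M_(deg K, deg U), rep_hom v /\ i *m v = u].

Definition is_cokernel V W (f : 'M_(deg W, deg V))
    (Q : rep) (p : 'M_(deg Q, deg W)) : Prop :=
  [/\ rep_hom p, p *m f = 0
    & forall U (u : 'M_(deg U, deg W)), rep_hom u -> u *m f = 0 ->
        exists! v : 'M_(deg U, deg Q), rep_hom v /\ v *m p = u].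

Definition unit_act (a : A) : 'M[k]_1 := (counit a : k)%:M.
Lemma unit_act_linear : linear unit_act.
Proof.
move=> c x y; apply/matrixP=> i j; rewrite !mxE.
by rewrite linearP mulrnDl; congr (_ + _); apply/esym/mulrnAr.
Qed.
HB.instance Definition _ :=
  GRing.isLinear.Build k A 'M[k]_1 _ unit_act unit_act_linear.
Lemma unit_act1 : unit_act 1 = 1%:M.
Proof. by rewrite /unit_act counit1. Qed.
Lemma unit_actM a b : unit_act (a * b) = unit_act a *m unit_act b.
Proof. by rewrite /unit_act counitM -scalar_mxM. Qed.
Definition unit_rep : rep := Rep unit_act1 unit_actM.

Definition tensor_act V W (a : A) : 'M[k]_(deg V * deg W) :=
  tsum (fun x y => V x *t W y) (comul a).
Lemma tensor_act_linear V W : linear (tensor_act V W).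
Proof. by move=> c x y; rewrite /tensor_act !linearP. Qed.
HB.instance Definition _ V W :=
  GRing.isLinear.Build k A 'M[k]_(deg V * deg W) _ (tensor_act V W)
    (tensor_act_linear V W).

Let tensmx_bilin m n : bilin (fun (x : 'M[k]_m) (y : 'M[k]_n) => x *t y).
Proof.
split=> [v|u] c x y; apply/matrixP=> i j; rewrite !mxE.
  by rewrite mulrDl mulrA.
by rewrite mulrDr mulrCA.
Qed.

Let tens_act_bilin V W : bilin (fun x y => V x *t W y).
Proof.
have [l r] := tensmx_bilin (deg V) (deg W).
by split=> [v|u] c x y; rewrite linearP ?(l (W v)) ?(r (V u)).
Qed.

Lemma tensor_act1 V W : tensor_act V W 1 = 1%:M.
Proof.
rewrite /tensor_act comul1 tsum_tens // !act1.
apply/matrixP=> i j; case: (mxtens_indexP i) => i1 i2.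
case: (mxtens_indexP j) => j1 j2; rewrite tensmxE !mxE.
rewrite (can_eq (@mxtens_indexK _ _)) xpair_eqE.
by rewrite -natrM mulnb.
Qed.

Lemma tensor_actM V W a b :
  tensor_act V W (a * b) = tensor_act V W a *m tensor_act V W b.
Proof.
pose F x y : 'M[k]_(deg V * deg W) := V x *t W y.
have lF : linear (tsum F) by exact: linearP.
rewrite /tensor_act comulM -/F (linear_tsum _ _ lF).
have lr (M : 'M[k]_(deg V * deg W)) : linear (fun x : 'M[k]_(deg V * deg W) => x *m M).
  by move=> c x y; rewrite mulmxDl scalemxAl.
have ll (M : 'M[k]_(deg V * deg W)) : linear (fun x : 'M[k]_(deg V * deg W) => M *m x).
  by move=> c x y; rewrite mulmxDr scalemxAr.
rewrite (linear_tsum _ _ (lr _)); apply: eq_tsum => a1 a2.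
rewrite (linear_tsum _ _ lF) (linear_tsum _ _ (ll _)); apply: eq_tsum => b1 b2.
by rewrite tsum_tens // /F !actM tensmx_mul.
Qed.
Definition tensor_rep V W : rep := Rep (tensor_act1 V W) (tensor_actM V W).

Definition dual_act V (a : A) : 'M[k]_(deg V) := (V (antipode a))^T.
Lemma dual_act_linear V : linear (dual_act V).
Proof. by move=> c x y; rewrite /dual_act !linearP. Qed.
HB.instance Definition _ V :=
  GRing.isLinear.Build k A 'M[k]_(deg V) _ (dual_act V) (dual_act_linear V).
Lemma dual_act1 V : dual_act V 1 = 1%:M.
Proof. by rewrite /dual_act antipode1 act1 trmx1. Qed.
Lemma dual_actM V a b : dual_act V (a * b) = dual_act V a *m dual_act V b.
Proof. by rewrite /dual_act antipodeM actM trmx_mul. Qed.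
Definition dual_rep V : rep := Rep (dual_act1 V) (dual_actM V).

(* full subcategories of Rep A, given by their objects *)
Definition subcat := rep -> Prop.
Implicit Types C D : subcat.

(* by the remark on is_dsum, C is also closed under isomorphism and contains 0 *)
Definition full_abelian C : Prop :=
  [/\ forall (I : finType) V (W : I -> rep),
        is_dsum V W -> (forall x, C (W x)) -> C V,
      forall V W (f : 'M_(deg W, deg V)) K (i : 'M_(deg V, deg K)),
        C V -> C W -> rep_hom f -> is_kernel f i -> C K
    & forall V W (f : 'M_(deg W, deg V)) Q (p : 'M_(deg Q, deg W)),
        C V -> C W -> rep_hom f -> is_cokernel f p -> C Q].

(* Semisimplicity of C is not required here: it is inherited from Rep A       *)
(* whenever A is semisimple.                                                  *)
Definition fusion_subcat C : Prop :=
  [/\ full_abelian C,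
      C unit_rep,
      forall V W, C V -> C W -> C (tensor_rep V W)
    & forall V, C V -> C (dual_rep V)].

Definition faithful_grading (gT : finGroupType) C (Cg : gT -> subcat) : Prop :=
  [/\ forall g, full_abelian (Cg g)
        /\ (forall V, Cg g V -> C V)
        /\ (exists2 V, Cg g V & (0 < deg V)%N),
      (* C is the direct sum of the Cg g *)
      (forall V, C V ->
         exists W : gT -> rep, (forall g, Cg g (W g)) /\ is_dsum V W)
        /\ (forall g h V W (f : 'M_(deg W, deg V)),
              g != h -> Cg g V -> Cg h W -> rep_hom f -> f = 0),
      forall g h V W, Cg g V -> Cg h W -> Cg (g * h)%g (tensor_rep V W)
    & forall g V, Cg g^-1%g V <-> exists2 W, Cg g W & rep_iso V (dual_rep W)].

(* The successive trivial components of Rep A are full subcategories of       *)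
(* Rep A; Vec sits in Rep A as the sums of copies of the unit object.         *)
Definition nilpotent_hopf : Prop :=
  semisimple A /\
  exists (n : nat) (C : nat -> subcat),
    [/\ forall i, (i <= n)%N -> fusion_subcat (C i),
        forall V, C 0 V <-> exists m, is_dsum V (fun _ : 'I_m => unit_rep),
        forall V, C n V
      & forall i, (i < n)%N ->
          exists (gT : finGroupType) (Cg : gT -> subcat),
            faithful_grading (C i.+1) Cg /\ (forall V, Cg 1%g V <-> C i V)].

End Representations.

(* Main.v *)
(* Write A = H^*.  The grouplikes of A are the p characters of H; let g be one *)
(* of order p, and let x_ij be the matrix coefficients of the irreducible      *)
(* representation rho of degree p.  Left and right multiplication by g act on  *)
(* the x_ij as conjugation by matrices u and v (Skolem-Noether), and           *)
(* uv = w vu with w^p = 1.  The regular character of H gives                   *)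
(* chi^2 = sum of the characters + (p-1) chi for chi = tr rho, so that         *)
(* Hom(rho, rho (x) rho), on which the translations by g on the left and on    *)
(* the right commute up to w, has dimension p-1; hence w^(p-1) = 1 and w = 1.  *)
(* In a basis of common eigenvectors, g x_ij = (l_i/l_j) x_ij and              *)
(* x_ij g = (m_i/m_j) x_ij.  Let e_a be the idempotent of k[g] of eigenvalue   *)
(* a.  From sum_l x_il S(x_li) = 1 = sum_l S(x_il) x_li one gets that the l_i  *)
(* are all the p-th roots of unity, as are the m_i, and that                   *)
(* x_il S(x_li) = e_a, S(x_li) x_il = e_b with a = l_i/l_l, b = m_i/m_l.  So   *)
(* e_a A and e_b A are isomorphic right k[g]-modules; the determinant of g on  *)
(* e_a A is a, whence a = b: g is central.                                     *)
(* The quotient of A by g - 1 has the grouplike basis 1, x_11, ..., x_pp, a    *)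
(* group permuted transitively off 1 by automorphisms; it is abelian, of       *)
(* exponent 2 (p odd) or 3 (p = 2).  Splitting representations by the          *)
(* eigenvalues of g, then of x_11, x_22, ..., yields the central series.       *)

(* Everything takes place in A = [hdual H]. Its simple subcoalgebras are the lines of the p
   characters of H and the span of the coefficients [xm i j]. A grouplike permutes simple
   subcoalgebras by multiplication, so for reasons of dimension it preserves the large one, and it
   acts there through an inner automorphism of M_p(k) ([comatrix_conj], [mx_endo_inner]).

   Left and right multiplication commute, so their conjugating matrices commute up to a scalar c
   with c^p = 1. The same scalar governs two operators on a multiplicity space whose dimension p-1
   comes from the character identity [xtr_sqr], so also c^(p-1) = 1 ([lr_commute1]). A common
   eigenbasis then gives every [xm i j] a left and a right weight ([grouplike_weights]).

   Centrality of g means that the two weights agree. The antipode equations exhibit an idempotent of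
   k[g] of left weight as x y and one of right weight as y x ([xm_antipode], [antipode_xm]). By
   cyclicity of the trace they cut out right ideals with the same right weights ([wcount_eq]), and
   the product of these weights recovers the idempotent ([prod_weights]).

   For nilpotency, the quotient of A by g - 1 is the group algebra of a group of order p+1 with
   elements [GA t] ([GA_mul]), which is abelian of prime exponent ([xm_group]). The sum of its
   elements is an integral ([integral_GA]), so A is semisimple. Each of g, x_11, ..., x_pp acts as a
   central grouplike on the representations where the earlier ones are trivial, and its eigenvalues
   give a grading ([prime_grading]); at the end only sums of the unit object remain
   ([tower_last]). *)
From HB Require Import structures.
From Stdlib Require Import Classical_Prop.
Require Import Defs.
From mathcomp Require Import all_boot all_fingroup all_solvable all_algebra all_field.
From mathcomp Require Import mxtens.
Set Implicit Arguments.
Unset Strict Implicit.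
Unset Printing Implicit Defensive.
Import GRing.Theory.
Local Open Scope ring_scope.

(** * Linear algebra *)

Section LinearMaps.
Variables (k : fieldType) (U W : lmodType k).

Lemma linear_bigsum (f : U -> W) (lf : linear f) (I : finType) (c : I -> k)
    (e : I -> U) :
  f (\sum_i c i *: e i) = \sum_i c i *: f (e i).
Proof.
pose fl : {linear U -> W} := HB.pack f (GRing.isLinear.Build _ _ _ _ f lf).
rewrite -[f]/(fl : U -> W) linear_sum; apply: eq_bigr => i _.
by rewrite linearZ.
Qed.

End LinearMaps.

(** Ranks and multiplicities are computed as traces, with values in k; this brings them back to
    natural numbers. *)
Lemma pcharf0_natr_inj (k : fieldType) : [pchar k] =i pred0 ->
  injective (fun n : nat => n%:R : k).
Proof.
move=> char0 m n /= e; wlog mn : m n e / (m <= n)%N.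
  by move=> h; case/orP: (leq_total m n) => [|nm]; [exact: h | rewrite (h n m)].
apply/eqP; rewrite eqn_leq mn -subn_eq0 /=.
have /pcharf0P <- := char0.
by rewrite natrB // e subrr.
Qed.

(** The family c lists the values of a unital character of k^T on the minimal idempotents, and such
    a character is a coordinate. *)
Lemma orthogonal_idem_delta (k : fieldType) (T : finType) (c : T -> k) :
  (forall s t, c s * c t = (s == t)%:R * c s) -> \sum_t c t = 1 ->
  exists t, forall s, c s = (s == t)%:R.
Proof.
move=> cM c1; have [t ct|c0] := pickP (fun t => c t != 0); last first.
  move: c1; rewrite big1 => [/eqP|t _]; first by rewrite eq_sym oner_eq0.
  by apply/eqP; rewrite -[_ == _]negbK c0.
exists t => s; have := cM s t; have [->|_] := eqVneq s t.
  by rewrite mul1r -[RHS]mul1r => /(mulIf ct).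
by rewrite mul0r => /eqP; rewrite mulf_eq0 (negPf ct) orbF => /eqP.
Qed.

(** The involution exchanges the points that it raises with those that it lowers. *)
Lemma involution_even n (f : 'I_n -> 'I_n) :
  involutive f -> (forall i, f i != i) -> ~~ odd n.
Proof.
move=> fK f0; pose B := [set i : 'I_n | i < f i]%N.
have cB : #|~: B| = #|B|.
  rewrite -(card_imset (mem B) (inv_inj fK)); apply: eq_card => i.
  rewrite !inE -leqNgt; apply/idP/imsetP => [h|[j]].
    exists (f i); last by rewrite fK.
    by rewrite inE fK ltn_neqAle h andbT -[_ == _]/(f i == i) f0.
  by rewrite inE => h ->; rewrite fK ltnW.
by have := cardsC B; rewrite cB card_ord addnn => <-; rewrite odd_double.
Qed.

Section BasisTrace.
Variables (k : fieldType) (V : lmodType k) (T : finType).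
Variables (B : T -> V) (co : T -> V -> k^o).
Hypothesis co_lin : forall t, linear (co t).
Hypothesis co_dec : forall v, v = \sum_t (co t v : k) *: B t.

Definition basis_trace (F : V -> V) : k := \sum_t co t (F (B t)).

(** Cyclicity serves twice: for the regular character of H, and to compare the right weights of
    equivalent idempotents of A. *)
Lemma basis_traceC (F G : V -> V) : linear F -> linear G ->
  basis_trace (fun v => F (G v)) = basis_trace (fun v => G (F v)).
Proof.
move=> lF lG; rewrite /basis_trace.
have E (F' G' : V -> V) t : linear F' -> linear G' ->
    co t (F' (G' (B t))) = \sum_s co s (G' (B t)) * co t (F' (B s)).
  move=> lF' lG'; rewrite {1}(co_dec (G' (B t))) (linear_bigsum lF').
  by rewrite (linear_bigsum (co_lin t)).
under eq_bigr => t _ do rewrite (E F G) //.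
under [RHS]eq_bigr => t _ do rewrite (E G F) //.
rewrite exchange_big; apply: eq_bigr => s _; apply: eq_bigr => t _.
by rewrite mulrC.
Qed.

End BasisTrace.

Section Matrices.
Variable k : fieldType.

Lemma delta_mulmxE m n q (a : 'I_m) (b : 'I_n) (M : 'M[k]_(n, q)) i j :
  (delta_mx a b *m M) i j = (i == a)%:R * M b j.
Proof.
rewrite mxE (bigD1 b) //= big1 => [|l lb]; first by rewrite mxE eqxx andbT addr0.
by rewrite mxE (negPf lb) andbF mul0r.
Qed.

Lemma mulmx_deltaE m n q (a : 'I_n) (b : 'I_q) (M : 'M[k]_(m, n)) i j :
  (M *m delta_mx a b) i j = M i a * (j == b)%:R.
Proof.
rewrite mxE (bigD1 a) //= big1 => [|l la]; first by rewrite mxE eqxx addr0.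
by rewrite mxE (negPf la) mulr0.
Qed.

Lemma mx_commutant n (u : 'M[k]_n) (i0 : 'I_n) :
  (forall N, N *m u = u *m N) -> u = (u i0 i0)%:M.
Proof.
move=> uC; apply/matrixP => i j; rewrite mxE.
have := congr1 (fun M : 'M_n => M i0 j) (uC (delta_mx i0 i)).
rewrite delta_mulmxE mulmx_deltaE eqxx mul1r => ->.
by rewrite eq_sym mulr_natr.
Qed.

(** If u v = 0 then u N v = f(N) u v = 0 for every N, and for v nonzero the vectors N v fill the
    space; so a singular u is zero. *)
Lemma intertwiner_unitmx n (f : 'M[k]_n -> 'M[k]_n) (u : 'M[k]_n) :
  (forall N, f N *m u = u *m N) -> u != 0 -> u \in unitmx.
Proof.
move=> fu; apply: contraR; rewrite unitmxE unitfE negbK -det_tr.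
case/det0P => v v0 vu; have {}vu : u *m v^T = 0.
  by apply: trmx_inj; rewrite trmx_mul trmxK vu trmx0.
have [i vi0] : exists i, v 0 i != 0.
  apply/existsP; apply: contraR v0; rewrite negb_exists => /forallP v0.
  by apply/eqP/matrixP => a i; rewrite ord1 mxE; apply/eqP; rewrite -[_ == _]negbK v0.
apply/eqP/matrixP => a b; rewrite [RHS]mxE.
have := fu (delta_mx b i) => /(congr1 (fun M => (M *m v^T) a 0)).
rewrite -mulmxA vu mulmx0 mxE -mulmxA => /esym.
have -> : delta_mx b i *m v^T = v 0 i *: delta_mx b 0.
  by apply/matrixP => c d; rewrite delta_mulmxE !mxE ord1 eqxx andbT mulrC.
rewrite -scalemxAr mxE mulmx_deltaE eqxx mulr1 => /eqP.
by rewrite mulf_eq0 (negPf vi0) => /eqP.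
Qed.

(* Skolem-Noether: u has the columns f (E_(i i0)) w, for a w not killed by    *)
(* f (E_(i0 i0)).                                                             *)
Lemma mx_endo_inner n (f : {linear 'M[k]_n -> 'M[k]_n}) (i0 : 'I_n) :
  f 1%:M = 1%:M -> (forall M N, f (M *m N) = f M *m f N) ->
  exists2 u, u \in unitmx & forall N, f N *m u = u *m N.
Proof.
move=> f1 fM.
have f00 : f (delta_mx i0 i0) != 0.
  apply/eqP => f0; have f0' i : f (delta_mx i i) = 0.
    by rewrite -(mul_delta_mx i0) -(mul_delta_mx i0 i0) !fM f0 mul0mx mulmx0.
  have := congr1 f (matrix_sum_delta 1%:M); rewrite f1 linear_sum big1.
    by move/matrixP/(_ i0 i0)/eqP; rewrite !mxE eqxx oner_eq0.
  move=> i _; rewrite linear_sum big1 // => j _; rewrite linearZ !mxE /=.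
  by have [->|_] := eqVneq; rewrite ?f0' ?scaler0 ?scale0r.
have [a [b ab0]] : exists a b, f (delta_mx i0 i0) a b != 0.
  have [/existsP[a /existsP[b ab]]|] :=
    boolP [exists a, exists b, f (delta_mx i0 i0) a b != 0].
    by exists a, b.
  rewrite negb_exists => /forallP h; case/eqP: f00.
  apply/matrixP => a b; have := h a; rewrite negb_exists => /forallP/(_ b).
  by rewrite negbK mxE => /eqP.
pose u := \matrix_(c, i) f (delta_mx i i0) c b.
have fu N : f N *m u = u *m N.
  apply/matrixP => c i; rewrite !mxE.
  under eq_bigr => j _ do rewrite mxE.
  transitivity ((f (N *m delta_mx i i0)) c b); first by rewrite fM mxE.
  have -> : N *m delta_mx i i0 = \sum_j N j i *: delta_mx j i0.
    apply/matrixP => d e; rewrite mulmx_deltaE summxE (bigD1 d) //= big1.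
      by rewrite !mxE eqxx addr0.
    by move=> l ld; rewrite !mxE eq_sym (negPf ld) mulr0.
  rewrite linear_sum summxE; apply: eq_bigr => j _.
  by rewrite linearZ !mxE mulrC.
exists u => //; apply: intertwiner_unitmx fu _.
by apply: contraNneq ab0 => /matrixP/(_ a i0); rewrite !mxE => ->.
Qed.

Lemma mxtrace_tens m n (M : 'M[k]_m) (N : 'M[k]_n) : \tr (M *t N) = \tr M * \tr N.
Proof.
rewrite /mxtrace big_distrlr pair_bigA.
rewrite (reindex (@mxtens_index m n)) /=; last first.
  by exists (@mxtens_unindex m n) => i _; rewrite ?mxtens_indexK ?mxtens_unindexK.
by apply: eq_bigr => -[i j] _; rewrite tensmxE.
Qed.

Lemma tensmx11 m n : (1%:M : 'M[k]_m) *t (1%:M : 'M[k]_n) = 1%:M.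
Proof.
apply/matrixP=> i j; case: (mxtens_indexP i) => i1 i2.
case: (mxtens_indexP j) => j1 j2; rewrite tensmxE !mxE.
by rewrite (can_eq (@mxtens_indexK _ _)) xpair_eqE -natrM mulnb.
Qed.

Lemma mxtrace_delta n (i j : 'I_n) : \tr (delta_mx i j : 'M[k]_n) = (i == j)%:R.
Proof.
rewrite /mxtrace (bigD1 i) //= big1 => [|l li]; last by rewrite mxE (negPf li).
by rewrite mxE eqxx addr0.
Qed.

Lemma invmx_mul n (u v : 'M[k]_n) : u \in unitmx -> v \in unitmx ->
  invmx (u *m v) = invmx v *m invmx u.
Proof.
move=> uu uv; have uuv : u *m v \in unitmx by rewrite unitmx_mul uu.
rewrite -[RHS]mulmx1 -(mulmxV uuv) !mulmxA -(mulmxA _ (invmx u) u) mulVmx //.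
by rewrite mulmx1 mulVmx // mul1mx.
Qed.

Lemma unitmxX n (u : 'M[k]_n) m : u \in unitmx -> u ^+ m \in unitmx.
Proof.
move=> uu; elim: m => [|m IHm]; first by rewrite expr0 unitmx1.
by rewrite exprS unitmx_mul uu IHm.
Qed.

(** In a full-rank factorisation Q = C D, the outer C and D can be cancelled from C D C D = C D. *)
Lemma idem_row_col n (Q : 'M[k]_n) : Q *m Q = Q -> row_base Q *m col_base Q = 1%:M.
Proof.
move: (mulmx_base Q) (row_base_free Q) (col_base_full Q).
move: (col_base Q) (row_base Q); move: (\rank Q) => m C D CD fD.
rewrite /row_full -mxrank_tr => fC QQ.
apply: (row_free_inj fD); rewrite mul1mx; apply: trmx_inj.
apply: (@row_free_inj _ _ _ _ C^T fC) => /=.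
by rewrite -!trmx_mul !mulmxA CD -mulmxA CD QQ.
Qed.

(* The proof restricts the relation to the image of Q and takes determinants. *)
Lemma qcommute_rank n (Q L L' R R' : 'M[k]_n) (c : k) :
  Q *m Q = Q -> L *m Q = Q *m L -> R *m Q = Q *m R ->
  L *m L' *m Q = Q -> R *m R' *m Q = Q -> L' *m Q = Q *m L' -> R' *m Q = Q *m R' ->
  L *m R = c *: (R *m L) -> c ^+ \rank Q = 1 /\ \tr Q = (\rank Q)%:R.
Proof.
move=> QQ LQ RQ LL RR LQ' RQ' LR.
move: (mulmx_base Q) (idem_row_col QQ).
move: (col_base Q) (row_base Q); move: (\rank Q) => m C D CD DC.
have CDC : Q *m C = C by rewrite -CD -mulmxA DC mulmx1.
have DCD : D *m Q = D by rewrite -CD mulmxA DC mul1mx.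
have red X Y : Y *m Q = Q *m Y -> (D *m X *m C) *m (D *m Y *m C) = D *m (X *m Y) *m C.
  move=> YQ; rewrite !mulmxA -[_ *m C *m D]mulmxA CD -[_ *m Q *m Y]mulmxA -YQ.
  by rewrite !mulmxA -[_ *m Q *m C]mulmxA CDC.
have inv X Y : Y *m Q = Q *m Y -> X *m Y *m Q = Q -> \det (D *m X *m C) != 0.
  move=> YQ XY; apply/eqP => d0; have := congr1 determinant (red X Y YQ).
  rewrite det_mulmx d0 mul0r -CDC -mulmxA [in X in _ *m X]mulmxA XY CDC DC det1.
  by move/eqP; rewrite eq_sym oner_eq0.
split.
  have := congr1 determinant (red L R RQ).
  rewrite LR -scalemxAr -scalemxAl detZ -(red R L LQ) !det_mulmx.
  rewrite [X in _ = _ * X]mulrC -{1}[_ * _]mul1r => /esym.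
  by apply: mulIf; rewrite mulf_neq0 ?(inv _ _ LQ' LL) ?(inv _ _ RQ' RR).
by rewrite -CD mxtrace_mulC DC mxtrace1.
Qed.

End Matrices.

(** * Coproducts written as finite sums of pure tensors *)

Section Coproducts.
Variables (k : fieldType) (A : hopfAlgType k).
Implicit Types a b : A.

Lemma linear_mull (b : A) : linear (fun x : A => b * x).
Proof. by move=> c x y; rewrite mulrDr scalerAr. Qed.
Lemma linear_mulr (b : A) : linear (fun x : A => x * b).
Proof. by move=> c x y; rewrite mulrDl scalerAl. Qed.

Lemma tsum_sum_tens (U V : vectType k) (W : lmodType k) (F : U -> V -> W)
    (I : finType) (u : I -> U) (v : I -> V) : bilin F ->
  tsum F (\sum_l tens (u l) (v l)) = \sum_l F (u l) (v l).
Proof.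
by move=> bF; rewrite linear_sum; apply: eq_bigr => l _; exact: tsum_tens.
Qed.

Lemma tsum_sum (U V : vectType k) (W : lmodType k) (I : finType)
    (F : I -> U -> V -> W) t :
  tsum (fun x y => \sum_l F l x y) t = \sum_l tsum (F l) t.
Proof.
rewrite /tsum [RHS]exchange_big; apply: eq_bigr => i _; rewrite [RHS]exchange_big.
by apply: eq_bigr => j _; rewrite scaler_sumr.
Qed.

Variables (I J : finType).
Variables (a : A) (a1 a2 : I -> A).
Hypothesis comul_a : comul a = \sum_l tens (a1 l) (a2 l).

Lemma comul_prod b (b1 b2 : J -> A) :
  comul b = \sum_m tens (b1 m) (b2 m) ->
  comul (a * b) = \sum_l \sum_m tens (a1 l * b1 m) (a2 l * b2 m).
Proof.
move=> comul_b; have tb x y : bilin (fun b1 b2 : A => tens (x * b1) (y * b2)).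
  have [tl tr] := tens_bilin A A.
  split=> [v|u] c z t; rewrite linear_mull; [exact: tl | exact: tr].
have tb' x y : bilin (fun a1 a2 : A => tens (a1 * x) (a2 * y)).
  have [tl tr] := tens_bilin A A.
  split=> [v|u] c z t; rewrite linear_mulr; [exact: tl | exact: tr].
rewrite comulM comul_a comul_b; under eq_tsum => x y do rewrite (tsum_sum_tens _ _ (tb x y)).
by rewrite tsum_sum [RHS]exchange_big; apply: eq_bigr => m _; rewrite tsum_sum_tens.
Qed.

Lemma antipodel_sum : \sum_l antipode (a1 l) * a2 l = (counit a : k) *: (1 : A).
Proof.
rewrite -antipodel comul_a tsum_sum_tens //; split=> [v|u] c x y.
  by rewrite linearP linear_mulr.
by rewrite linear_mull.
Qed.

Lemma antipoder_sum : \sum_l a1 l * antipode (a2 l) = (counit a : k) *: (1 : A).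
Proof.
rewrite -antipoder comul_a tsum_sum_tens //; split=> [v|u] c x y.
  by rewrite linear_mulr.
by rewrite linearP linear_mull.
Qed.

Lemma tensmx_bilin m n : bilin (fun (x : 'M[k]_m) (y : 'M[k]_n) => x *t y).
Proof.
split=> [v|u] c x y; apply/matrixP=> i j; rewrite !mxE.
  by rewrite mulrDl mulrA.
by rewrite mulrDr mulrCA.
Qed.

Lemma tens_act_bilin (V W : rep A) : bilin (fun x y => V x *t W y).
Proof.
have [l r] := tensmx_bilin (deg V) (deg W).
by split=> [v|u] c x y; rewrite linearP ?(l (W v)) ?(r (V u)).
Qed.

Lemma tensor_rep_sum (V W : rep A) :
  tensor_rep V W a = \sum_l V (a1 l) *t W (a2 l).
Proof.
rewrite -[LHS]/(tsum (fun x y => V x *t W y) (comul a)) comul_a.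
by rewrite tsum_sum_tens //; apply: tens_act_bilin.
Qed.

End Coproducts.

Section DualCoproducts.
Variables (k : fieldType) (H : hopfAlgType k).
Implicit Types f g : hdual H.

Lemma dual_counitE f : (counit f : k) = f 1. Proof. by []. Qed.

Lemma contract2_sum (I : finType) (f1 f2 : I -> hdual H) a b :
  contract2 a b (\sum_l tens (f1 l) (f2 l)) = \sum_l f1 l a * f2 l b :> k.
Proof.
have lc : linear (contract2 a b : tensor (hdual H) (hdual H) -> k^o).
  exact: contract2_linear.
pose G : {linear tensor (hdual H) (hdual H) -> k^o} :=
  HB.pack (contract2 a b : tensor (hdual H) (hdual H) -> k^o)
    (GRing.isLinear.Build _ _ _ _ _ lc).
rewrite -[LHS]/(G _) linear_sum; apply: eq_bigr => l _.
exact: contract2_tens.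
Qed.

Lemma comul_dualP f (I : finType) (f1 f2 : I -> hdual H) :
  comul f = \sum_l tens (f1 l) (f2 l) <->
  forall a b, f (a * b) = \sum_l f1 l a * f2 l b.
Proof.
have E a b : contract2 a b (comul f) = f (a * b).
  by rewrite contract2E -[RHS]sweedler_dual.
split=> [e a b|e]; first by rewrite -E e contract2_sum.
by apply: contract2_inj => a b; rewrite E e contract2_sum.
Qed.

Lemma comul_dual_tensP f g h : comul f = tens g h <-> forall a b, f (a * b) = g a * h b.
Proof.
have := comul_dualP f (fun _ : 'I_1 => g) (fun _ => h).
rewrite big_ord1 => -[e1 e2].
split=> e; first by move=> a b; rewrite e1 // big_ord1.
by apply: e2 => a b; rewrite e big_ord1.
Qed.

Lemma hdualD f g a : (f + g) a = f a + g a.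
Proof. exact: add_lfunE. Qed.
Lemma hdualZ (c : k) f a : (c *: f) a = c * f a.
Proof. exact: scale_lfunE. Qed.
Lemma hdual0 a : (0 : hdual H) a = 0.
Proof. exact: zero_lfunE. Qed.
Lemma hdual_sum (I : Type) (r : seq I) (P : pred I) (F : I -> hdual H) a :
  (\sum_(i <- r | P i) F i) a = \sum_(i <- r | P i) (F i) a.
Proof.
elim/big_rec2: _ => [|i y x _ <-]; first exact: hdual0.
by rewrite hdualD.
Qed.

Lemma hdual_lin f a b c : f (c *: a + b) = c * f a + f b.
Proof. exact: linearP. Qed.

Lemma hdual_suml f (I : Type) (r : seq I) (P : pred I) (F : I -> H) :
  f (\sum_(i <- r | P i) F i) = \sum_(i <- r | P i) f (F i).
Proof. exact: linear_sum. Qed.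
Lemma hdual_scale f (c : k) a : f (c *: a) = c * f a.
Proof. exact: linearZ. Qed.

End DualCoproducts.

(** * The characters and matrix coefficients of H *)

(** An algebra isomorphism of H with k^p x M_p(k), with inverse [el]. Keeping it as data allows a
    change of basis of the simple module ([splitting_conj]) and a renumbering of the characters
    ([splitting_perm]). *)
Record splitting (k : fieldType) (p : nat) (H : hopfAlgType k) := Splitting {
  rho : {linear H -> 'M[k]_p};
  chr : 'I_p -> hdual H;
  el : {ffun 'I_p -> k} -> 'M[k]_p -> H;
  rho1 : rho 1 = 1%:M;
  rhoM : forall a b, rho (a * b) = rho a *m rho b;
  chr1 : forall i, chr i 1 = 1;
  chrM : forall i a b, chr i (a * b) = chr i a * chr i b;
  rho_el : forall c N, rho (el c N) = N;
  chr_el : forall c N i, chr i (el c N) = c i;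
  el_eta : forall a, el [ffun i => chr i a] (rho a) = a
}.

Section Splitting.
Variables (k : fieldType) (p : nat) (H : hopfAlgType k).

Lemma type_splitting : type_1p_p1 p H -> exists W : splitting p H, True.
Proof.
move=> [phi [[psi phiK psiK] phi1 phiM]].
have lr : linear (fun h => (phi h).2) by move=> c x y; rewrite linearP.
have lc i : linear (fun h => (phi h).1 i : k^o).
  by move=> c x y; rewrite linearP !ffunE.
pose r : {linear H -> 'M[k]_p} :=
  HB.pack (fun h => (phi h).2) (GRing.isLinear.Build _ _ _ _ _ lr).
pose ch i : hdual H := hdual_of (fun h => (phi h).1 i : k^o).
have chE i h : ch i h = (phi h).1 i by rewrite hdual_ofE.
suff W : splitting p H by exists W.
apply: (@Splitting _ _ _ r ch (fun c N => psi ([ffun i => c i], N))).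
- by rewrite /= phi1.
- by move=> a b; rewrite /= phiM.
- by move=> i; rewrite chE phi1 ffunE.
- by move=> i a b; rewrite !chE phiM ffunE.
- by move=> c N; rewrite /= psiK.
- by move=> c N i; rewrite chE psiK ffunE.
- move=> a; rewrite -[RHS]phiK; congr psi.
  have -> : phi a = ((phi a).1, (phi a).2) by case: (phi a).
  by congr pair; apply/ffunP => i; rewrite !ffunE chE.
Qed.

Variable W : splitting p H.

Definition xm i j : hdual H := hdual_of (fun h => rho W h i j : k^o).

Lemma xmE i j h : xm i j h = rho W h i j.
Proof. by apply: hdual_ofE => c x y; rewrite linearP !mxE. Qed.

Lemma comul_xm i j : comul (xm i j) = \sum_l tens (xm i l) (xm l j).
Proof.
apply/comul_dualP => a b; rewrite xmE rhoM mxE.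
by apply: eq_bigr => l _; rewrite !xmE.
Qed.

Lemma counit_xm i j : counit (xm i j) = (i == j)%:R.
Proof. by rewrite dual_counitE xmE rho1 mxE. Qed.

Lemma chr_grouplike i : grouplike (chr W i).
Proof.
split; last by rewrite dual_counitE chr1.
by apply/comul_dual_tensP => a b; rewrite chrM.
Qed.

Lemma splitting_inj a b :
  (forall i, chr W i a = chr W i b) -> rho W a = rho W b -> a = b.
Proof.
move=> ec er; rewrite -(el_eta W a) -(el_eta W b) er; congr el.
by apply/ffunP => i; rewrite !ffunE.
Qed.

Definition bidx : finType := ('I_p + 'I_p * 'I_p)%type.

Definition Hbasis (t : bidx) : H :=
  match t with
  | inl n => el W [ffun i => (i == n)%:R] 0
  | inr ij => el W 0 (delta_mx ij.1 ij.2)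
  end.

Definition Abasis (t : bidx) : hdual H :=
  match t with inl n => chr W n | inr ij => xm ij.1 ij.2 end.

Lemma Abasis_dual s t : Abasis s (Hbasis t) = (s == t)%:R.
Proof.
case: s t => [n|[i j]] [m|[i' j']] /=.
- by rewrite chr_el ffunE.
- by rewrite chr_el ffunE.
- by rewrite xmE rho_el mxE.
- by rewrite xmE rho_el mxE.
Qed.

Lemma Hbasis_dec h : h = \sum_t (Abasis t h : k) *: Hbasis t.
Proof.
have E s : Abasis s h = Abasis s (\sum_t (Abasis t h : k) *: Hbasis t).
  rewrite hdual_suml (bigD1 s) //= big1 ?addr0 => [|t ts].
    by rewrite hdual_scale Abasis_dual eqxx mulr1.
  by rewrite hdual_scale Abasis_dual eq_sym (negPf ts) mulr0.
apply: splitting_inj => [i|]; first exact: (E (inl i)).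
by apply/matrixP => i j; rewrite -!xmE; apply: (E (inr (i, j))).
Qed.

Lemma Abasis_ext (f g : hdual H) :
  (forall t, f (Hbasis t) = g (Hbasis t)) -> f = g.
Proof.
move=> e; apply: hdualP => a; rewrite (Hbasis_dec a) !hdual_suml.
by apply: eq_bigr => t _; rewrite !hdual_scale e.
Qed.

Lemma Abasis_dec (f : hdual H) : f = \sum_t (f (Hbasis t) : k) *: Abasis t.
Proof.
apply: Abasis_ext => t; rewrite hdual_sum (bigD1 t) //= big1 ?addr0 => [|s st].
  by rewrite hdualZ Abasis_dual eqxx mulr1.
by rewrite hdualZ Abasis_dual (negPf st) mulr0.
Qed.

Lemma Abasis_split (f : hdual H) :
  f = \sum_n (f (Hbasis (inl n)) : k) *: chr W n
    + \sum_i \sum_j (f (Hbasis (inr (i, j))) : k) *: xm i j.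
Proof.
rewrite {1}[f]Abasis_dec big_sumType /=; congr (_ + _).
by rewrite pair_bigA; apply: eq_bigr => -[].
Qed.

(* M_p(k) has no character when p > 1. *)
Lemma character_chr (f : hdual H) : (1 < p)%N -> grouplike f ->
  exists i, f = chr W i.
Proof.
move=> p1 [/comul_dual_tensP fM]; rewrite dual_counitE => f1.
(* For l <> i the matrix unit E_il squares to zero, so f kills it, and E_ij = E_il E_lj. *)
have fx i j : f (Hbasis (inr (i, j))) = 0.
  have mulE a b c d : Hbasis (inr (a, b)) * Hbasis (inr (c, d)) =
      el W 0 (delta_mx a b *m delta_mx c d).
    apply: splitting_inj => [l|]; first by rewrite chrM !chr_el !ffunE mul0r.
    by rewrite rhoM !rho_el.
  have [l li] : exists l, l != i.
    case: (altP (i =P Ordinal (ltnW p1))) => [->|h].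
      by exists (Ordinal p1).
    by exists (Ordinal (ltnW p1)); rewrite eq_sym.
  have fil : f (Hbasis (inr (i, l))) = 0.
    have := fM (Hbasis (inr (i, l))) (Hbasis (inr (i, l))).
    rewrite mulE mul_delta_mx_0 // => e; apply/eqP.
    have := e; have -> : el W 0 0 = 0.
      apply: splitting_inj => [m|]; last by rewrite rho_el linear0.
      by rewrite chr_el ffunE linear0.
    by rewrite linear0 => /esym/eqP; rewrite mulf_eq0 orbb.
  have := fM (Hbasis (inr (i, l))) (Hbasis (inr (l, j))).
  by rewrite mulE mul_delta_mx fil mul0r.
have DD m n : f (Hbasis (inl m)) * f (Hbasis (inl n)) =
    (m == n)%:R * f (Hbasis (inl m)).
  rewrite -fM; have -> : Hbasis (inl m) * Hbasis (inl n) =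
      (m == n)%:R *: Hbasis (inl m); last by rewrite hdual_scale.
    apply: splitting_inj => [l|]; last by rewrite rhoM linearZ /= !rho_el mul0mx scaler0.
    rewrite chrM hdual_scale !chr_el !ffunE -!natrM !mulnb.
    by have [->|_] := eqVneq l m; rewrite ?andbT ?andbF.
have S : \sum_n f (Hbasis (inl n)) = 1.
  have := f1; rewrite {1}[f]Abasis_split hdualD !hdual_sum [X in _ + X]big1.
    rewrite addr0 => <-; apply: eq_bigr => n _.
    by rewrite hdualZ chr1 mulr1.
  move=> i _; rewrite hdual_sum big1 // => j _.
  by rewrite fx scale0r hdual0.
have [m fm] : exists m, f (Hbasis (inl m)) != 0.
  apply/existsP; apply: contraT; rewrite negb_exists => /forallP f0.
  move: S; rewrite big1 => [/eqP|n _]; first by rewrite eq_sym oner_eq0.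
  by apply/eqP; rewrite -[_ == _]negbK f0.
exists m; apply: Abasis_ext => -[n|[i j]]; last by rewrite fx chr_el ffunE.
rewrite chr_el ffunE; have := DD m n; rewrite mulrC.
have [_|mn] := eqVneq m n; last first.
  by rewrite mul0r => /eqP; rewrite mulf_eq0 (negPf fm) orbF => /eqP.
by rewrite mul1r -{2}[f (Hbasis (inl m))]mul1r => /(mulIf fm).
Qed.

(** Closed by [Defined], like [splitting_conj], because [grouplike_weights] relies on the
    projections of the result computing. *)
Definition splitting_perm (s : {perm 'I_p}) : splitting p H.
Proof.
apply: (@Splitting _ _ _ (rho W) (fun i => chr W (s i))
  (fun c N => el W [ffun i => c (s^-1%g i)] N)).
- exact: rho1.
- exact: rhoM.
- by move=> i; apply: chr1.
- by move=> i; apply: chrM.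
- by move=> c N; apply: rho_el.
- by move=> c N i; rewrite chr_el ffunE permK.
- move=> a; rewrite -[RHS](el_eta W); congr el.
  by apply/ffunP => i; rewrite !ffunE permKV.
Defined.

Section Conj.
Variables (T : 'M[k]_p) (uT : T \in unitmx).

Let cj h := T *m rho W h *m invmx T.
Let cj_lin : linear cj.
Proof.
by move=> c x y; rewrite /cj linearP mulmxDr mulmxDl -scalemxAr -scalemxAl.
Qed.

Definition splitting_conj : splitting p H.
Proof.
apply: (@Splitting _ _ _ (HB.pack cj (GRing.isLinear.Build _ _ _ _ _ cj_lin))
  (chr W) (fun c N => el W c (invmx T *m N *m T))).
- by rewrite /= /cj rho1 mulmx1 mulmxV.
- move=> a b; rewrite /= /cj rhoM !mulmxA.
  by rewrite -(mulmxA (T *m rho W a) (invmx T)) mulVmx // mulmx1.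
- exact: chr1.
- exact: chrM.
- move=> c N; rewrite /= /cj rho_el !mulmxA mulmxV // mul1mx.
  by rewrite -mulmxA mulmxV // mulmx1.
- by move=> c N i; rewrite chr_el.
- move=> a; rewrite -[RHS](el_eta W); congr el.
  rewrite /= /cj !mulmxA mulVmx // mul1mx.
  by rewrite -mulmxA mulVmx // mulmx1.
Defined.

End Conj.

End Splitting.

(** * Grouplike elements and the group of characters *)

Section Grouplikes.
Variables (k : fieldType) (A : hopfAlgType k).
Implicit Types f g : A.

Lemma grouplike1 : grouplike (1 : A).
Proof. by split; [exact: comul1 | exact: counit1]. Qed.

Lemma grouplikeM f g : grouplike f -> grouplike g -> grouplike (f * g).
Proof.
move=> [df ef] [dg eg]; split; last by rewrite counitM ef eg mulr1.
have e1 (a : A) : tens a a = \sum_(l < 1) tens a a by rewrite big_ord1.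
by rewrite e1 in df; rewrite e1 in dg; rewrite (comul_prod df dg) !big_ord1.
Qed.

Lemma grouplikeX f n : grouplike f -> grouplike (f ^+ n).
Proof.
move=> gf; elim: n => [|n IHn]; first exact: grouplike1.
by rewrite exprS; apply: grouplikeM.
Qed.

Lemma grouplikeVl f : grouplike f -> antipode f * f = 1.
Proof.
move=> [df ef]; have e1 (a : A) : tens a a = \sum_(l < 1) tens a a by rewrite big_ord1.
by rewrite e1 in df; have := antipodel_sum df; rewrite big_ord1 ef scale1r.
Qed.

Lemma grouplikeVr f : grouplike f -> f * antipode f = 1.
Proof.
move=> [df ef]; have e1 (a : A) : tens a a = \sum_(l < 1) tens a a by rewrite big_ord1.
by rewrite e1 in df; have := antipoder_sum df; rewrite big_ord1 ef scale1r.
Qed.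

Lemma grouplike_mulI f : grouplike f -> injective (fun a : A => f * a).
Proof.
by move=> gf a b /(congr1 (fun x => antipode f * x)); rewrite !mulrA grouplikeVl // !mul1r.
Qed.

Lemma grouplike_mulr f : grouplike f -> injective (fun a : A => a * f).
Proof.
by move=> gf a b /(congr1 (fun x => x * antipode f)); rewrite -!mulrA grouplikeVr // !mulr1.
Qed.

End Grouplikes.

Section Characters.
Variables (k : fieldType) (p : nat) (H : hopfAlgType k) (W : splitting p H).
Hypothesis p_prime : prime p.
Local Notation chr := (chr W).

Lemma chr_inj : injective chr.
Proof.
move=> i j /(congr1 (fun f : hdual H => f (Hbasis W (inl i)))).
rewrite (Abasis_dual W (inl i)) (Abasis_dual W (inl j)) eqxx.
case: (altP (inl j =P inl i)) => [[->]|_ /eqP] //.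
by rewrite oner_eq0.
Qed.

(** The index is found by a search in ['I_p], so it is available as data: [translation_perm] builds
    a permutation from it. *)
Lemma grouplike_chr (f : hdual H) : grouplike f -> {i | f = chr i}.
Proof.
move=> gf; have [i|h] := pickP (fun i => f == chr i); first by move/eqP; exists i.
exfalso; have [i fi] := character_chr W (prime_gt1 p_prime) gf.
by have := h i; rewrite fi eqxx.
Qed.

Lemma translation_perm (f : hdual H) : grouplike f ->
  {s : {perm 'I_p} | forall i, chr (s i) = f * chr i}.
Proof.
move=> gf; pose t i := sval (grouplike_chr (grouplikeM gf (chr_grouplike W i))).
have tE i : chr (t i) = f * chr i by rewrite /t; case: grouplike_chr => j /= ->.
have t_inj : injective t.
  move=> i j e; apply: chr_inj; apply: (grouplike_mulI gf) => /=.
  by rewrite -!tE e.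
by exists (perm t_inj) => i; rewrite permE.
Qed.

Lemma translation_permX (f : hdual H) (s : {perm 'I_p}) n i :
  (forall i, chr (s i) = f * chr i) -> chr ((s ^+ n)%g i) = f ^+ n * chr i.
Proof.
move=> sE; elim: n => [|n IHn]; first by rewrite expg0 perm1 mul1r.
by rewrite expgSr permM sE IHn mulrA -exprS.
Qed.

(* Translations make the p characters a subgroup of order p of 'S_p. *)
Lemma translation_order (g : hdual H) (s : {perm 'I_p}) :
  grouplike g -> g != 1 -> (forall i, chr (s i) = g * chr i) -> #[s]%g = p.
Proof.
move=> gg g1 sE.
have [i0 i0E] := grouplike_chr (grouplike1 (hdual H)).
pose t i := sval (translation_perm (chr_grouplike W i)).
have tE i j : chr (t i j) = chr i * chr j.
  by rewrite /t; case: translation_perm => u /= ->.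
have uniq_perm (u v : {perm 'I_p}) (f : hdual H) :
    (forall i, chr (u i) = f * chr i) -> (forall i, chr (v i) = f * chr i) -> u = v.
  by move=> hu hv; apply/permP => i; apply: chr_inj; rewrite hu hv.
have t_inj : injective t.
  move=> i j e; apply: chr_inj; rewrite -[chr i]mulr1 -[chr j]mulr1 i0E.
  by rewrite -!tE e.
pose G := [set t i | i in 'I_p].
have inG (u : {perm 'I_p}) (f : hdual H) :
    grouplike f -> (forall i, chr (u i) = f * chr i) -> u \in G.
  move=> gf uE; have [j fj] := grouplike_chr gf.
  apply/imsetP; exists j => //; apply: (uniq_perm _ _ f) => // i.
  by rewrite tE fj.
have gG : group_set G.
  apply/group_setP; split.
    apply: (inG _ 1) => [|i]; first exact: grouplike1.
    by rewrite perm1 mul1r.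
  move=> _ _ /imsetP[i _ ->] /imsetP[j _ ->].
  apply: (inG _ (chr j * chr i)) => [|l].
    by apply: grouplikeM; apply: chr_grouplike.
  by rewrite permM !tE mulrA.
have cG : #|Group gG| = p by rewrite card_imset // card_ord.
have : (#[s]%g %| #|Group gG|)%N by apply: order_dvdG; apply: (inG s g).
rewrite cG.
case/primeP: p_prime => _ h /h /orP[|/eqP] //.
rewrite order_eq1 => /eqP s1; case/eqP: g1.
have := sE i0; rewrite s1 perm1 => e.
by apply: (grouplike_mulr (chr_grouplike W i0)) => /=; rewrite -e mul1r.
Qed.

(** The orbit of the trivial character under multiplication by g has p elements, so it exhausts the
    characters. *)
Lemma grouplike_cyclic (g : hdual H) : grouplike g -> g != 1 ->
  g ^+ p = 1 /\ exists s : {perm 'I_p}, forall i, chr (s i) = g ^+ i.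
Proof.
move=> gg g1; have [s sE] := translation_perm gg.
have os := translation_order gg g1 sE.
have [i0 i0E] := grouplike_chr (grouplike1 (hdual H)).
have E n : chr ((s ^+ n)%g i0) = g ^+ n.
  by rewrite (translation_permX n i0 sE) -i0E mulr1.
split; first by have := E #[s]%g; rewrite expg_order perm1 -i0E os => <-.
have t_inj : injective (fun i : 'I_p => (s ^+ i)%g i0).
  move=> i j e; have {}e : g ^+ i = g ^+ j by rewrite -!E e.
  have : (s ^+ i == s ^+ j)%g.
    by apply/eqP/permP => l; apply: chr_inj; rewrite !(translation_permX _ _ sE) e.
  by rewrite eq_expg_mod_order os !modn_small // => /eqP/val_inj.
by exists (perm t_inj) => i; rewrite permE E.
Qed.

End Characters.

(** * Translations by a character *)

Section Translations.
Variables (k : fieldType) (H : hopfAlgType k).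
Implicit Types (f : hdual H) (h : H).

(** [ltrans] and [rtrans] are the transposes of left and right multiplication by f on A. *)
Definition ltrans f h : H := tsum (fun a b => (f a : k) *: b) (comul h).
Definition rtrans f h : H := tsum (fun a b => (f b : k) *: a) (comul h).

Lemma ltransE f (y : hdual H) h : y (ltrans f h) = (f * y) h.
Proof.
rewrite hdualME (linear_tsum _ _ (hdual_linear y)); apply: eq_tsum => a b.
exact: hdual_scale.
Qed.

Lemma rtransE f (y : hdual H) h : y (rtrans f h) = (y * f) h.
Proof.
rewrite hdualME (linear_tsum _ _ (hdual_linear y)); apply: eq_tsum => a b.
by rewrite mulrC; exact: hdual_scale.
Qed.

(** By coassociativity a left translation touches only the first leg of the coproduct, and likewise
    a right translation only the last. *)
Lemma tens_rep_ltrans (V V' : rep H) f h :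
  tensor_rep V V' (ltrans f h) =
  tsum (fun a b => V (ltrans f a) *t V' b) (comul h).
Proof.
have [tl tr] := tens_act_bilin V V'.
have lT : linear (tensor_rep V V') by move=> c x y; exact: linearP.
rewrite /ltrans (linear_tsum _ _ lT).
pose T a b c : 'M[k]_(deg V * deg V') := (f a : k) *: (V b *t V' c).
transitivity (tsum (fun a b => tsum (T a) (comul b)) (comul h)).
  apply: eq_tsum => a b; rewrite (linear_scale _ _ lT).
  rewrite -[tensor_rep V V' b]/(tsum (fun x y => V x *t V' y) (comul b)).
  rewrite (linear_tsum (G := fun x : 'M[k]_(deg V * deg V') => (f a : k) *: x)) //.
  by move=> c x y; rewrite scalerDr !scalerA mulrC.
rewrite -sweedler_assoc.
- apply: eq_tsum => a c.
  rewrite (linear_tsum (G := fun x : H => V x *t V' c)); last exact: tl.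
  by apply: eq_tsum => x y; rewrite /T -(linear_scale (f x) y (tl c)).
- by move=> y z c u v; rewrite /T hdual_lin scalerDl scalerA.
- by move=> y z c u v; rewrite /T tl scalerDr !scalerA mulrC.
- by move=> y z c u v; rewrite /T tr scalerDr !scalerA mulrC.
Qed.

Lemma tens_rep_rtrans (V V' : rep H) f h :
  tensor_rep V V' (rtrans f h) =
  tsum (fun a b => V a *t V' (rtrans f b)) (comul h).
Proof.
have [tl tr] := tens_act_bilin V V'.
have lT : linear (tensor_rep V V') by move=> c x y; exact: linearP.
rewrite /rtrans (linear_tsum _ _ lT).
pose T a b c : 'M[k]_(deg V * deg V') := (f c : k) *: (V a *t V' b).
transitivity (tsum (fun b c => tsum (fun a b' => T a b' c) (comul b)) (comul h)).
  apply: eq_tsum => b c; rewrite (linear_scale _ _ lT).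
  rewrite -[tensor_rep V V' b]/(tsum (fun x y => V x *t V' y) (comul b)).
  rewrite (linear_tsum (G := fun x : 'M[k]_(deg V * deg V') => (f c : k) *: x)) //.
  by move=> d x y; rewrite scalerDr !scalerA mulrC.
rewrite sweedler_assoc.
- apply: eq_tsum => a b.
  rewrite (linear_tsum (G := fun x : H => V a *t V' x)); last exact: tr.
  by apply: eq_tsum => x y; rewrite /T -(linear_scale (f y) x (tr a)).
- by move=> y z c u v; rewrite /T tl scalerDr !scalerA mulrC.
- by move=> y z c u v; rewrite /T tr scalerDr !scalerA mulrC.
- by move=> y z c u v; rewrite /T hdual_lin scalerDl scalerA.
Qed.

End Translations.

(** * Translations by a grouplike act on the matrix factor by conjugation *)

Section Inner.
Variables (k : fieldType) (p : nat) (H : hopfAlgType k) (W : splitting p H).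
Hypothesis p_prime : prime p.
Local Notation rho := (rho W).
Local Notation chr := (chr W).
Local Notation el := (el W).
Local Notation xm := (xm W).

Let i0 : 'I_p := Ordinal (prime_gt0 p_prime).

Lemma el0_lin : linear (el 0).
Proof.
move=> c M N; apply: (splitting_inj (W := W)) => [i|].
  by rewrite hdual_lin !chr_el !ffunE mulr0 addr0.
by rewrite linearP /= !rho_el.
Qed.

Lemma el0M M N : el 0 M * el 0 N = el 0 (M *m N).
Proof.
apply: (splitting_inj (W := W)) => [i|]; last by rewrite rhoM !rho_el.
by rewrite chrM !chr_el !ffunE mul0r.
Qed.

Lemma el_dec h : h = \sum_n (chr n h : k) *: Hbasis W (inl n) + el 0 (rho h).
Proof.
apply: (splitting_inj (W := W)) => [i|].
  rewrite linearD /= chr_el ffunE addr0 hdual_suml (bigD1 i) //= big1.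
    by rewrite hdual_scale chr_el ffunE eqxx mulr1 addr0.
  by move=> n ni; rewrite hdual_scale chr_el ffunE eq_sym (negPf ni) mulr0.
rewrite linearD linear_sum /= rho_el big1 ?add0r // => n _.
by rewrite linearZ /= rho_el scaler0.
Qed.

(** The Y i j are the entries of an algebra map t from H onto M_p(k). It kills the one-dimensional
    factors of H, hence restricts to an endomorphism of the matrix factor, which is inner. *)
Lemma comatrix_conj (Y : 'I_p -> 'I_p -> hdual H) :
  (forall i j, comul (Y i j) = \sum_l tens (Y i l) (Y l j)) ->
  (forall i j, counit (Y i j) = (i == j)%:R) ->
  (forall N : 'M_p, exists h, forall i j, Y i j h = N i j) ->
  exists2 u, u \in unitmx
    & forall h i j, Y i j h = (u *m rho h *m invmx u) i j.
Proof.
move=> dY eY sY; pose t h := \matrix_(i, j) Y i j h.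
have t_lin : linear t.
  by move=> c x y; apply/matrixP => i j; rewrite !mxE hdual_lin.
have tM a b : t (a * b) = t a *m t b.
  apply/matrixP => i j; rewrite !mxE.
  have /comul_dualP -> := dY i j.
  by apply: eq_bigr => l _; rewrite !mxE.
have t1 : t 1 = 1%:M by apply/matrixP => i j; rewrite !mxE -dual_counitE eY.
have tD n : t (Hbasis W (inl n)) = 0.
  set D := Hbasis W (inl n).
  (* D spans a one-dimensional ideal and t is onto, so t D times any matrix stays on the line of t
     D. As p > 1, a matrix unit that moves one column of t D elsewhere shows that this column is
     zero. *)
  have tDN N : exists c, t D *m N = c *: t D.
    have [h hN] := sY N; exists (chr n h).
    have -> : N = t h by apply/matrixP => i j; rewrite mxE hN.
    rewrite -tM; have -> : D * h = (chr n h : k) *: D.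
      apply: (splitting_inj (W := W)) => [i|].
        rewrite chrM hdual_scale !chr_el ffunE.
        by have [->|] := eqVneq i n; rewrite ?mul1r ?mulr1 ?mul0r ?mulr0.
      by rewrite rhoM linearZ /= !rho_el mul0mx scaler0.
    exact: (linear_scale _ _ t_lin).
  apply/matrixP => a b; rewrite [RHS]mxE.
  have [b' b'b] : exists b', b' != b.
    have p1 := prime_gt1 p_prime.
    case: (altP (b =P Ordinal (ltnW p1))) => [->|h].
      by exists (Ordinal p1).
    by exists (Ordinal (ltnW p1)); rewrite eq_sym.
  have [c cE] := tDN (delta_mx b b').
  have := congr1 (fun M : 'M_p => M a b') cE; have := congr1 (fun M : 'M_p => M a b) cE.
  rewrite !mulmx_deltaE eq_sym (negPf b'b) eqxx mulr0 mulr1 mxE => /esym/eqP.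
  rewrite mulf_eq0 => /orP[/eqP -> ->|/eqP -> //].
  by rewrite mxE mul0r.
have tel h : t h = t (el 0 (rho h)).
  rewrite {1}(el_dec h); pose tl : {linear H -> 'M[k]_p} :=
    HB.pack t (GRing.isLinear.Build _ _ _ _ t t_lin).
  rewrite -[t]/(tl : H -> _) linearD linear_sum big1 ?add0r // => n _.
  by rewrite linearZ /= tD scaler0.
have b_lin : linear (fun N => t (el 0 N)).
  by move=> c M N; rewrite el0_lin t_lin.
pose b : {linear 'M[k]_p -> 'M[k]_p} :=
  HB.pack (fun N => t (el 0 N)) (GRing.isLinear.Build _ _ _ _ _ b_lin).
have b1 : b 1%:M = 1%:M by rewrite /b /= -(rho1 W) -tel t1 rho1.
have bM M N : b (M *m N) = b M *m b N by rewrite /b /= -el0M tM.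
have [u uu uE] := mx_endo_inner i0 b1 bM; exists u => // h i j.
by rewrite -uE mulmxK // /b /= -tel mxE.
Qed.

Definition lconj (f : hdual H) (u : 'M[k]_p) :=
  forall h, rho (ltrans f h) = u *m rho h *m invmx u.
Definition rconj (f : hdual H) (u : 'M[k]_p) :=
  forall h, rho (rtrans f h) = u *m rho h *m invmx u.

Lemma lconj_exists f : grouplike f -> exists2 u, u \in unitmx & lconj f u.
Proof.
move=> gf; have [|||u uu uE] := @comatrix_conj (fun i j => f * xm i j).
- move=> i j; have [df _] := gf.
  have e1 : comul f = \sum_(l < 1) tens f f by rewrite big_ord1.
  by rewrite (comul_prod e1 (comul_xm W i j)) big_ord1.
- by move=> i j; rewrite counitM counit_xm; have [_ ->] := gf; rewrite mul1r.
- move=> N; exists (ltrans (antipode f) (el 0 N)) => i j.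
  by rewrite ltransE mulrA grouplikeVl // mul1r xmE rho_el.
by exists u => // h; apply/matrixP => i j; rewrite -xmE ltransE.
Qed.

Lemma rconj_exists f : grouplike f -> exists2 u, u \in unitmx & rconj f u.
Proof.
move=> gf; have [|||u uu uE] := @comatrix_conj (fun i j => xm i j * f).
- move=> i j; have [df _] := gf.
  have e1 : comul f = \sum_(l < 1) tens f f by rewrite big_ord1.
  rewrite (comul_prod (comul_xm W i j) e1).
  by apply: eq_bigr => l _; rewrite big_ord1.
- by move=> i j; rewrite counitM counit_xm; have [_ ->] := gf; rewrite mulr1.
- move=> N; exists (rtrans (antipode f) (el 0 N)) => i j.
  by rewrite rtransE -mulrA grouplikeVr // mulr1 xmE rho_el.
by exists u => // h; apply/matrixP => i j; rewrite -xmE rtransE.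
Qed.

Lemma lconjX f u n : u \in unitmx -> lconj f u -> lconj (f ^+ n) (u ^+ n).
Proof.
move=> uu fu; elim: n => [|n IHn] h.
  rewrite !expr0 (_ : invmx 1 = 1%:M) ?invmx1 // mulmx1 mul1mx.
  by apply/matrixP => i j; rewrite -!xmE ltransE mul1r.
have E : rho (ltrans (f ^+ n.+1) h) = rho (ltrans f (ltrans (f ^+ n) h)).
  by apply/matrixP => i j; rewrite -!xmE !ltransE mulrA -exprSr.
rewrite E fu IHn exprS; rewrite -[u * _]/(u *m _).
by rewrite invmx_mul ?unitmxX // !mulmxA.
Qed.

Lemma rconjX f u n : u \in unitmx -> rconj f u -> rconj (f ^+ n) (u ^+ n).
Proof.
move=> uu fu; elim: n => [|n IHn] h.
  rewrite !expr0 (_ : invmx 1 = 1%:M) ?invmx1 // mulmx1 mul1mx.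
  by apply/matrixP => i j; rewrite -!xmE rtransE mulr1.
have E : rho (rtrans (f ^+ n.+1) h) = rho (rtrans f (rtrans (f ^+ n) h)).
  by apply/matrixP => i j; rewrite -!xmE !rtransE -mulrA -exprS.
rewrite E fu IHn exprS; rewrite -[u * _]/(u *m _).
by rewrite invmx_mul ?unitmxX // !mulmxA.
Qed.

(** Translation by f conjugates rho, which leaves its trace unchanged. *)
Lemma chr_xtr f : grouplike f -> f * (\sum_i xm i i) = \sum_i xm i i.
Proof.
move=> gf; have [u uu fu] := lconj_exists gf.
apply: hdualP => h; rewrite -ltransE !hdual_sum.
transitivity (\tr (rho (ltrans f h))); first by apply: eq_bigr => i _; rewrite xmE.
rewrite fu mxtrace_mulC mulmxA mulVmx // mul1mx.
by apply: eq_bigr => i _; rewrite xmE.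
Qed.

(** The two translations commute by associativity of A, so (v u)^-1 u v commutes with all matrices
    and is a scalar c; determinants give c^p = 1. *)
Lemma lr_commute f u v : rconj f v -> lconj f u ->
  u \in unitmx -> v \in unitmx ->
  exists2 c, c ^+ p = 1 & u *m v = c *: (v *m u).
Proof.
move=> fv fu uu vu.
have E h : u *m (v *m rho h *m invmx v) *m invmx u
         = v *m (u *m rho h *m invmx u) *m invmx v.
  rewrite -[in LHS]fv -[in RHS]fu -fu -fv.
  by apply/matrixP => i j; rewrite -!xmE !(ltransE, rtransE) mulrA.
pose w := invmx (v *m u) *m (u *m v).
have vuu : v *m u \in unitmx by rewrite unitmx_mul vu.
have wC N : N *m w = w *m N.
  have {E} E : u *m v *m N = v *m u *m N *m w.
    have := E (el 0 N); rewrite rho_el => /(congr1 (fun M => M *m (u *m v))).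
    rewrite !mulmxA mulmxKV // mulmxKV // => ->.
    by rewrite /w invmx_mul // !mulmxA.
  by rewrite -[LHS](mulKmx vuu) (mulmxA (v *m u)) -E mulmxA.
have := mx_commutant i0 wC; set c := w i0 i0 => wc.
have uvE : u *m v = c *: (v *m u).
  by rewrite -mul_mx_scalar -wc /w mulKVmx.
exists c => //; have := congr1 determinant uvE.
rewrite detZ !det_mulmx [X in _ = _ * X]mulrC -{1}[_ * _]mul1r => /esym.
by apply: mulIf; rewrite mulf_neq0 // -unitfE -unitmxE.
Qed.

End Inner.

(** * The regular character of H and the commutation of the two conjugating matrices *)

Section RegularCharacter.
Variables (k : fieldType) (p : nat) (H : hopfAlgType k) (W : splitting p H).
Local Notation Δ := (@comul k H).
Local Notation ε := (@counit k H).
Local Notation S := (@antipode k H).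
Local Notation rho := (rho W).
Local Notation chr := (chr W).
Local Notation xm := (xm W).

Definition htrace := basis_trace (Hbasis W) (fun t h => Abasis W t h : k^o).

Lemma htraceC (F G : H -> H) : linear F -> linear G ->
  htrace (fun v => F (G v)) = htrace (fun v => G (F v)).
Proof.
apply: basis_traceC => [t|v]; last exact: Hbasis_dec.
exact: hdual_linear.
Qed.

Lemma htrace_sum (I : finType) (F : I -> H -> H) :
  htrace (fun v => \sum_i F i v) = \sum_i htrace (F i).
Proof.
rewrite /htrace /basis_trace exchange_big; apply: eq_bigr => t _.
exact: hdual_suml.
Qed.

Lemma htrace_scale c (F : H -> H) : htrace (fun v => c *: F v) = c * htrace F.
Proof.
rewrite /htrace /basis_trace mulr_sumr; apply: eq_bigr => t _.
exact: hdual_scale.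
Qed.

Lemma eq_htrace (F G : H -> H) : F =1 G -> htrace F = htrace G.
Proof. by move=> e; apply: eq_bigr => t _; rewrite e. Qed.

Let xtr := \sum_i xm i i.

Lemma xtrE h : xtr h = \tr (rho h).
Proof. by rewrite hdual_sum; apply: eq_bigr => i _; rewrite xmE. Qed.

Lemma htrace_mull h : htrace (fun b => h * b) = \sum_n chr n h + p%:R * xtr h.
Proof.
rewrite /htrace /basis_trace big_sumType; congr (_ + _).
  by apply: eq_bigr => n _; rewrite /= chrM chr_el ffunE eqxx mulr1.
transitivity (\sum_i \sum_(j < p) rho h i i).
  rewrite pair_bigA; apply: eq_bigr => -[i j] _ /=.
  by rewrite xmE rhoM rho_el mulmx_deltaE eqxx mulr1.
under eq_bigr => i _ do rewrite sumr_const card_ord -mulr_natl.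
by rewrite -mulr_sumr xtrE.
Qed.

Section Tensor.
Let phi a c b : H := tsum (fun x y => (rho y a c : k) *: x) (Δ b).
Let psi a c b : H := tsum (fun x y => (rho (S y) a c : k) *: x) (Δ b).

Let phi_lin a c : linear (phi a c).
Proof. by apply: tsum_linear_arg => d x y; rewrite linearP. Qed.
Let psi_lin a c : linear (psi a c).
Proof. by apply: tsum_linear_arg => d x y; rewrite linearP. Qed.

Let rho_lin : linear rho. Proof. by move=> c x y; exact: linearP. Qed.

Let scale_lin (V : lmodType k) (c : k) : linear (fun x : V => c *: x).
Proof. by move=> d x y; rewrite scalerDr !scalerA mulrC. Qed.

Let tr_lin (F : H -> H) (x : H) : linear F ->
  linear (fun y => (\tr (rho (F y)) : k) *: x).
Proof. by move=> lF c y z; rewrite lF !linearP /= scalerDl scalerA. Qed.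

(** For V the module of rho, H (x) V with the diagonal action is isomorphic to p copies of H. The
    functions [phi a c] and [psi a c] are the entries of b -> b_1 (x) rho(b_2) and of its inverse b
    -> b_1 (x) rho(S b_2). Only their partial traces over V are computed ([c1], [c2]), and cyclicity
    of the trace does the rest. *)
Lemma tensor_trace h :
  htrace (fun b => tsum (fun x y => (\tr (rho y) : k) *: (x * b)) (Δ h)) =
  p%:R * htrace (fun b => h * b).
Proof.
have c1 b : \sum_a \sum_c phi a c (h * psi c a b) =
    tsum (fun x y => (\tr (rho y) : k) *: (x * b)) (Δ h).
  transitivity (tsum (fun h1 h2 => tsum (fun x y => tsum (fun x1 x2 =>
      (\tr (rho (h2 * (x2 * S y))) : k) *: (h1 * x1)) (Δ x)) (Δ b)) (Δ h)).
    rewrite exchange_tsum.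
    transitivity (tsum (fun x y => \sum_a \sum_c (rho (S y) c a : k) *: phi a c (h * x)) (Δ b)).
      rewrite tsum_sum; apply: eq_bigr => a _; rewrite tsum_sum.
      apply: eq_bigr => c _.
      have l1 : linear (fun z => phi a c (h * z)).
        by move=> d x y; rewrite linear_mull phi_lin.
      rewrite (linear_tsum _ _ l1); apply: eq_tsum => x y.
      exact: (linear_scale _ _ l1).
    apply: eq_tsum => x y.
    transitivity (tsum (fun h1 h2 => tsum (fun x1 x2 =>
        \sum_a \sum_c (rho (S y) c a : k) *: ((rho (h2 * x2) a c : k) *: (h1 * x1)))
        (Δ x)) (Δ h)).
      under [RHS]eq_tsum => h1 h2 do rewrite tsum_sum.
      rewrite [RHS]tsum_sum.
      apply: eq_bigr => a _.
      under [RHS]eq_tsum => h1 h2 do rewrite tsum_sum.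
      rewrite [RHS]tsum_sum.
      apply: eq_bigr => c _.
      rewrite /phi comulM.
      rewrite (linear_tsum (G := tsum (fun x y => (rho y a c : k) *: x))); last exact: linearP.
      rewrite (linear_tsum _ _ (scale_lin _)); apply: eq_tsum => h1 h2.
      rewrite (linear_tsum (G := tsum (fun x y => (rho y a c : k) *: x))); last exact: linearP.
      rewrite (linear_tsum _ _ (scale_lin _)); apply: eq_tsum => x1 x2.
      congr (_ *: _); apply: tsum_tens; split=> [v|u] d s t; first exact: scale_lin.
      by rewrite rho_lin !mxE scalerDl scalerA.
    apply: eq_tsum => h1 h2; apply: eq_tsum => x1 x2.
    rewrite /mxtrace mulrA [in RHS]rhoM [RHS]scaler_suml; apply: eq_bigr => a _.
    rewrite [in RHS]mxE [RHS]scaler_suml; apply: eq_bigr => c _.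
    by rewrite scalerA mulrC.
  apply: eq_tsum => h1 h2.
  rewrite (@sweedler_assoc _ _ _ (fun x1 x2 y => (\tr (rho (h2 * (x2 * S y))) : k) *: (h1 * x1))).
  - transitivity (tsum (fun x y => (ε y : k) *: ((\tr (rho h2) : k) *: (h1 * x))) (Δ b)).
      apply: eq_tsum => x y.
      have l1 := @tr_lin (fun z => h2 * z) (h1 * x) (linear_mull _).
      rewrite -(linear_tsum _ _ l1) antipoder (linear_scale _ _ l1) mulr1 //.
    have l2 : linear (fun z => (\tr (rho h2) : k) *: (h1 * z)).
      by move=> d x y; rewrite linear_mull scale_lin.
    rewrite -{2}(counitr b) (linear_tsum _ _ l2); apply: eq_tsum => x y.
    by rewrite (linear_scale _ _ l2).
  - by move=> y z d u v; rewrite linear_mull scale_lin.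
  - move=> y z; apply: tr_lin => d u v.
    by rewrite linear_mulr linear_mull.
  - move=> y z; apply: tr_lin => d u v.
    by rewrite linearP linear_mull linear_mull.
have c2 b : \sum_a \sum_c psi c a (phi a c b) = p%:R *: b.
  transitivity (tsum (fun x y => tsum (fun x1 x2 =>
      (\tr (rho (S x2 * y)) : k) *: x1) (Δ x)) (Δ b)).
    transitivity (tsum (fun x y => \sum_a \sum_c (rho y a c : k) *: psi c a x) (Δ b)).
      rewrite tsum_sum; apply: eq_bigr => a _; rewrite tsum_sum.
      apply: eq_bigr => c _.
      rewrite (linear_tsum _ _ (psi_lin c a)); apply: eq_tsum => x y.
      exact: (linear_scale _ _ (psi_lin c a)).
    apply: eq_tsum => x y.
    transitivity (tsum (fun x1 x2 => \sum_a \sum_c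
        (rho y a c : k) *: ((rho (S x2) c a : k) *: x1)) (Δ x)).
      rewrite tsum_sum; apply: eq_bigr => a _; rewrite tsum_sum.
      by apply: eq_bigr => c _; rewrite (linear_tsum _ _ (scale_lin _)).
    apply: eq_tsum => x1 x2.
    rewrite rhoM mxtrace_mulC /mxtrace scaler_suml; apply: eq_bigr => a _.
    by rewrite mxE scaler_suml; apply: eq_bigr => c _; rewrite scalerA.
  rewrite (@sweedler_assoc _ _ _ (fun x1 x2 y => (\tr (rho (S x2 * y)) : k) *: x1)).
  - rewrite -{2}(counitr b) (linear_tsum _ _ (scale_lin _)).
    apply: eq_tsum => x y.
    have l1 := @tr_lin id x (fun _ _ _ => erefl).
    rewrite -(linear_tsum _ _ l1) antipodel (linear_scale _ _ l1) /=.
    by rewrite rho1 mxtrace1 scalerA mulrC scalerA.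
  - by move=> y z; apply: scale_lin.
  - by move=> y z; apply: tr_lin => d u v; rewrite linearP linear_mulr.
  - by move=> y z; apply: tr_lin => d u v; rewrite linear_mull.
rewrite -(eq_htrace c1) htrace_sum.
under eq_bigr => a _ do rewrite htrace_sum.
transitivity (\sum_a \sum_c htrace (fun b => h * psi c a (phi a c b))).
  apply: eq_bigr => a _; apply: eq_bigr => c _.
  rewrite (@htraceC (phi a c)) // => d x y.
  by rewrite psi_lin linear_mull.
transitivity (htrace (fun b => \sum_a \sum_c h * psi c a (phi a c b))).
  by rewrite htrace_sum; apply: eq_bigr => a _; rewrite htrace_sum.
rewrite -htrace_scale; apply: eq_htrace => b.
under eq_bigr => a _ do rewrite -mulr_sumr.
by rewrite -mulr_sumr c2 scalerAr.
Qed.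

End Tensor.

Hypothesis p_prime : prime p.
Hypothesis char0 : [pchar k] =i pred0.

(** Let I be the regular character and chi = [xtr]. Then I chi = p I by [tensor_trace], and each of
    the p characters fixes chi by [chr_xtr]. Expanding I as the sum of the characters plus p chi and
    dividing by p isolates chi^2. *)
Lemma xtr_sqr : xtr * xtr = \sum_n chr n + (p%:R - 1) *: xtr.
Proof.
pose I := \sum_n chr n + p%:R *: xtr.
have IE h : I h = htrace (fun b => h * b).
  by rewrite htrace_mull hdualD hdual_sum hdualZ.
have Ix : I * xtr = p%:R *: I.
  apply: hdualP => h; rewrite hdualZ IE -tensor_trace hdualME.
  rewrite /htrace /basis_trace.
  transitivity (\sum_t tsum (fun x y => (Abasis W t (x * Hbasis W t) * xtr y : k^o)) (Δ h)).
    rewrite -tsum_sum; apply: eq_tsum => x y.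
    by rewrite IE mulr_suml.
  apply: eq_bigr => t _.
  rewrite (linear_tsum _ _ (hdual_linear (Abasis W t))); apply: eq_tsum => x y.
  by rewrite hdual_scale xtrE mulrC.
have gx : (\sum_n chr n) * xtr = p%:R *: xtr.
  rewrite mulr_suml (eq_bigr (fun=> xtr)) => [|n _].
    by rewrite sumr_const card_ord scaler_nat.
  by apply: chr_xtr => //; apply: chr_grouplike.
have p0 : p%:R != 0 :> k.
  have /pcharf0P -> := char0.
  by rewrite -lt0n prime_gt0.
move: Ix; rewrite /I mulrDl gx -scalerAl -scalerDr => /(congr1 (fun x => p%:R^-1 *: x)).
rewrite !scalerA mulVf // !scale1r => /(congr1 (fun x => x - xtr)).
rewrite addrC addKr => ->.
by rewrite scalerBl scale1r addrA.
Qed.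

(** On rho (x) rho, u (x) 1 and 1 (x) v implement the left and right translations. Corrected by the
    action of H they become operators [L] and [R] on the multiplicity space of rho, which has
    dimension p-1 and is realised as the image of [Q]. There L R = c^-1 R L, so c^(p-1) = 1, besides
    c^p = 1. *)
Lemma lr_commute1 (f : hdual H) (u v : 'M[k]_p) : grouplike f -> rconj W f v -> lconj W f u ->
  u \in unitmx -> v \in unitmx -> u *m v = v *m u.
Proof.
move=> gf fv fu uu uv; have [c cp uvE] := lr_commute p_prime fv fu uu uv.
pose i0 : 'I_p := Ordinal (prime_gt0 p_prime).
pose V := @Rep k H p rho (rho1 W) (rhoM W).
pose TT := tensor_rep V V; pose B N : 'M[k]_(p * p) := TT (el W 0 N).
have BM M N : B M *m B N = B (M *m N) by rewrite /B -(Defs.actM TT) el0M.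
have chr0 f' N i : grouplike f' -> (f' * chr i) (el W 0 N) = 0 /\
    (chr i * f') (el W 0 N) = 0.
  move=> gf'; split.
    have [j ->] := grouplike_chr W p_prime (grouplikeM gf' (chr_grouplike W i)).
    by rewrite !chr_el !ffunE.
  have [j ->] := grouplike_chr W p_prime (grouplikeM (chr_grouplike W i) gf').
  by rewrite !chr_el !ffunE.
pose a : 'M[k]_(p * p) := u *t (1%:M : 'M_p).
pose a' : 'M[k]_(p * p) := invmx u *t (1%:M : 'M_p).
pose b : 'M[k]_(p * p) := (1%:M : 'M_p) *t v.
pose b' : 'M[k]_(p * p) := (1%:M : 'M_p) *t invmx v.
have mul_lin (M : 'M[k]_(p * p)) : linear (fun X : 'M[k]_(p * p) => M *m X).
  by move=> d X Y; rewrite mulmxDr scalemxAr.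
have mul_lin' (M : 'M[k]_(p * p)) : linear (fun X : 'M[k]_(p * p) => X *m M).
  by move=> d X Y; rewrite mulmxDl scalemxAl.
have aB N : a *m B N = B (u *m N *m invmx u) *m a.
  have -> : B (u *m N *m invmx u) = TT (ltrans f (el W 0 N)).
    congr (TT _); apply: (splitting_inj (W := W)) => [i|]; last by rewrite fu !rho_el.
    by rewrite ltransE chr_el ffunE (chr0 _ _ _ gf).1.
  rewrite /TT tens_rep_ltrans (linear_tsum _ _ (mul_lin' a)).
  rewrite -[B N]/(tsum (fun x y => rho x *t rho y) (Δ (el W 0 N))).
  rewrite (linear_tsum _ _ (mul_lin a)); apply: eq_tsum => x y /=.
  by rewrite /a !tensmx_mul fu mulmx1 mul1mx mulmxKV.
have bB N : b *m B N = B (v *m N *m invmx v) *m b.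
  have -> : B (v *m N *m invmx v) = TT (rtrans f (el W 0 N)).
    congr (TT _); apply: (splitting_inj (W := W)) => [i|]; last by rewrite fv !rho_el.
    by rewrite rtransE chr_el ffunE (chr0 _ _ _ gf).2.
  rewrite /TT tens_rep_rtrans (linear_tsum _ _ (mul_lin' b)).
  rewrite -[B N]/(tsum (fun x y => rho x *t rho y) (Δ (el W 0 N))).
  rewrite (linear_tsum _ _ (mul_lin b)); apply: eq_tsum => x y /=.
  by rewrite /b !tensmx_mul fv mulmx1 mul1mx mulmxKV.
have tens11 : (1%:M : 'M[k]_p) *t (1%:M : 'M[k]_p) = 1%:M.
  exact: tensmx11.
have aa : a *m a' = 1%:M by rewrite tensmx_mul mulmxV // mulmx1.
have aa' : a' *m a = 1%:M by rewrite tensmx_mul mulVmx // mulmx1.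
have bb : b *m b' = 1%:M by rewrite tensmx_mul mulmxV // mulmx1.
have bb' : b' *m b = 1%:M by rewrite tensmx_mul mulVmx // mulmx1.
have a'B N : a' *m B N = B (invmx u *m N *m u) *m a'.
  rewrite -[LHS]mulmx1 -aa mulmxA -[a' *m B N *m a]mulmxA.
  have -> : B N *m a = a *m B (invmx u *m N *m u).
    by rewrite aB !mulmxA mulmxV // mul1mx mulmxK.
  by rewrite !mulmxA aa' mul1mx.
have b'B N : b' *m B N = B (invmx v *m N *m v) *m b'.
  rewrite -[LHS]mulmx1 -bb mulmxA -[b' *m B N *m b]mulmxA.
  have -> : B N *m b = b *m B (invmx v *m N *m v).
    by rewrite bB !mulmxA mulmxV // mul1mx mulmxK.
  by rewrite !mulmxA bb' mul1mx.
have ab : a *m b = b *m a by rewrite !tensmx_mul !mulmx1 !mul1mx.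
(* The factors [B (invmx u)] and [B (invmx v)] undo the conjugations, so [L] and [R] commute with
   every [B N]. Since [a] and [b] commute, L R and R L differ only through v u versus u v. *)
pose L := B (invmx u) *m a; pose R := B (invmx v) *m b.
pose L' := a' *m B u; pose R' := b' *m B v.
have LB N : L *m B N = B N *m L.
  by rewrite /L -mulmxA aB !mulmxA !BM !mulmxA mulVmx // mul1mx.
have RB N : R *m B N = B N *m R.
  by rewrite /R -mulmxA bB !mulmxA !BM !mulmxA mulVmx // mul1mx.
have LB' N : L' *m B N = B N *m L'.
  rewrite /L' -mulmxA BM a'B mulKmx //.
  have -> : a' *m B u = B u *m a' by rewrite a'B mulVmx // mul1mx.
  by rewrite mulmxA BM.
have RB' N : R' *m B N = B N *m R'.
  rewrite /R' -mulmxA BM b'B mulKmx //.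
  have -> : b' *m B v = B v *m b' by rewrite b'B mulVmx // mul1mx.
  by rewrite mulmxA BM.
pose Q := B (delta_mx i0 i0).
have QQ : Q *m Q = Q by rewrite BM mul_delta_mx.
have LLQ : L *m L' *m Q = Q.
  rewrite /L /L' mulmxA -[_ *m a *m a']mulmxA aa mulmx1 !BM mulVmx //.
  by rewrite mul1mx.
have RRQ : R *m R' *m Q = Q.
  rewrite /R /R' mulmxA -[_ *m b *m b']mulmxA bb mulmx1 !BM mulVmx //.
  by rewrite mul1mx.
have c0 : c != 0.
  apply: contraTneq (prime_gt0 p_prime) => c0; move/eqP: cp.
  by rewrite c0 expr0n; case: (p) => //= n; rewrite eq_sym oner_eq0.
have BZ d N : B (d *: N) = d *: B N.
  rewrite /B; have l0 := @el0_lin k p H W.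
  by rewrite (linear_scale _ _ l0) linearZ.
have LR : L *m R = c^-1 *: (R *m L).
  have -> : L *m R = B (invmx v *m invmx u) *m (a *m b).
    by rewrite /R mulmxA LB /L !mulmxA BM.
  have -> : R *m L = B (invmx u *m invmx v) *m (a *m b).
    by rewrite /L mulmxA RB /R !mulmxA BM -!mulmxA ab.
  have vuu : v *m u \in unitmx by rewrite unitmx_mul uv.
  have uvu : u *m v \in unitmx by rewrite unitmx_mul uu.
  rewrite -invmx_mul // uvE invmxZ -?uvE // invmx_mul //.
  by rewrite BZ scalemxAl.
have [cr trQ] := qcommute_rank QQ (LB _) (RB _) LLQ RRQ (LB' _) (RB' _) LR.
(* The trace of [Q] is the value of chi^2 at E_(i0 i0), where all characters vanish and chi is 1. *)
have trQ1 : \tr Q = (p.-1)%:R.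
  transitivity ((xtr * xtr) (el W 0 (delta_mx i0 i0))).
    rewrite -[Q]/(tsum (fun x y => rho x *t rho y) (Δ (el W 0 (delta_mx i0 i0)))).
    have lt : linear (fun X : 'M[k]_(p * p) => \tr X : k^o).
      by move=> d x y; rewrite linearP.
    rewrite (linear_tsum _ _ lt) hdualME.
    by apply: (@eq_tsum k H H k^o) => x y; rewrite mxtrace_tens !xtrE.
  rewrite xtr_sqr hdualD hdual_sum big1 => [|n _]; last by rewrite chr_el ffunE.
  rewrite add0r hdualZ xtrE rho_el mxtrace_delta mulr1.
  by rewrite -[in LHS](prednK (prime_gt0 p_prime)) -natr1 addrK.
have rk : \rank Q = p.-1.
  by apply: (pcharf0_natr_inj char0); rewrite -trQ trQ1.
rewrite uvE; have -> : c = 1; last by rewrite scale1r.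
have {}cr : c ^+ p.-1 = 1.
  by apply: (can_inj (@invrK _)); rewrite invr1 -exprVn -rk.
by rewrite -cp -(prednK (prime_gt0 p_prime)) exprS cr mulr1.
Qed.

End RegularCharacter.

(** * Roots of unity and weights *)

Section RootIdempotents.
Variables (k : fieldType) (A : algType k) (p : nat).
Hypotheses (p_gt0 : (0 < p)%N) (p0 : p%:R != 0 :> k).

Lemma mean_powers (x : k) : x ^+ p = 1 ->
  p%:R^-1 * (\sum_(n < p) x ^+ n) = (x == 1)%:R.
Proof.
move=> xp; have [->|x1] := eqVneq x 1.
  under eq_bigr => n _ do rewrite expr1n.
  by rewrite sumr_const card_ord mulVf.
have := subrX1 x p; rewrite xp subrr => /esym/eqP.
by rewrite mulf_eq0 subr_eq0 (negPf x1) => /eqP ->; rewrite mulr0.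
Qed.

Lemma unity_root_neq0 (x : k) : x ^+ p = 1 -> x != 0.
Proof.
by move=> xp; apply: contra_eq_neq xp => ->; rewrite expr0n eqn0Ngt p_gt0 eq_sym oner_eq0.
Qed.

Lemma unity_rootM (x y : k) : x ^+ p = 1 -> y ^+ p = 1 -> (x / y) ^+ p = 1.
Proof. by move=> xp yp; rewrite exprMn exprVn xp yp invr1 mulr1. Qed.
Local Notation root0 := unity_root_neq0.
Local Notation rootM := unity_rootM.

Variable g : A.

(* The idempotent of k[g] on which g acts by the p-th root of unity a. *)
Definition gidem (a : k) : A := p%:R^-1 *: \sum_(n < p) (a ^- n) *: g ^+ n.

Lemma gX_eig (x : A) (b : k) n : g * x = b *: x -> g ^+ n * x = b ^+ n *: x.
Proof.
move=> gx; elim: n => [|n IHn]; first by rewrite !expr0 mul1r scale1r.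
by rewrite exprSr -mulrA gx -scalerAr IHn scalerA exprS.
Qed.

Lemma eig_gX (x : A) (b : k) n : x * g = b *: x -> x * g ^+ n = b ^+ n *: x.
Proof.
move=> gx; elim: n => [|n IHn]; first by rewrite !expr0 mulr1 scale1r.
by rewrite exprS mulrA gx -scalerAl IHn scalerA exprS.
Qed.

Lemma gidem_eigl a (x : A) b : a ^+ p = 1 -> b ^+ p = 1 ->
  g * x = b *: x -> gidem a * x = (b == a)%:R *: x.
Proof.
move=> ap bp gx; rewrite /gidem -scalerAl mulr_suml.
under eq_bigr => n _ do rewrite -scalerAl (gX_eig n gx) scalerA -exprVn -exprMn.
rewrite -scaler_suml scalerA mulrC -mulrC mean_powers //; last first.
  by rewrite mulrC rootM.
rewrite mulrC -subr_eq0 -[1](divff (root0 ap)) -mulrBl mulf_eq0 invr_eq0.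
by rewrite (negPf (root0 ap)) orbF subr_eq0.
Qed.

Lemma gidem_eigr a (x : A) b : a ^+ p = 1 -> b ^+ p = 1 ->
  x * g = b *: x -> x * gidem a = (b == a)%:R *: x.
Proof.
move=> ap bp gx; rewrite /gidem -scalerAr mulr_sumr.
under eq_bigr => n _ do rewrite -scalerAr (eig_gX n gx) scalerA -exprVn -exprMn.
rewrite -scaler_suml scalerA mulrC -mulrC mean_powers //; last first.
  by rewrite mulrC rootM.
rewrite mulrC -subr_eq0 -[1](divff (root0 ap)) -mulrBl mulf_eq0 invr_eq0.
by rewrite (negPf (root0 ap)) orbF subr_eq0.
Qed.

Lemma g_gidem a : g ^+ p = 1 -> a ^+ p = 1 -> g * gidem a = a *: gidem a.
Proof.
move=> gp ap; rewrite /gidem -scalerAr scalerA [a * _]mulrC -scalerA; congr (_ *: _).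
rewrite mulr_sumr scaler_sumr.
have [q pq] : exists q, p = q.+1 by exists p.-1; rewrite prednK.
move: ap gp; rewrite pq => ap gq.
have a0 : a != 0 by apply: contra_eq_neq ap => ->; rewrite expr0n eq_sym oner_eq0.
rewrite big_ord_recr /= [RHS]big_ord_recl /= addrC; congr (_ + _).
  rewrite !expr0 invr1 scale1r -scalerAr -exprS gq; congr (_ *: _).
  by apply: (mulIf (expf_neq0 q a0)); rewrite -exprS ap mulVf ?expf_neq0.
apply: eq_bigr => n _; rewrite -scalerAr -exprS scalerA /bump /= add1n.
by congr (_ *: _); rewrite exprS invfM mulVKf.
Qed.

Lemma gidem_g a : gidem a * g = g * gidem a.
Proof.
rewrite /gidem -scalerAr -scalerAl mulr_sumr mulr_suml; congr (_ *: _).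
by apply: eq_bigr => n _; rewrite -scalerAr -scalerAl -exprS -exprSr.
Qed.

Lemma gidemM a b : g ^+ p = 1 -> a ^+ p = 1 -> b ^+ p = 1 ->
  gidem a * gidem b = (b == a)%:R *: gidem b.
Proof. by move=> gp ap bp; apply: gidem_eigl => //; apply: g_gidem. Qed.

Lemma gidem_comm a (x : A) : GRing.comm g x -> GRing.comm (gidem a) x.
Proof.
move=> gx; apply/commr_sym; rewrite /gidem.
apply: commr_sym; rewrite /GRing.comm -scalerAl -scalerAr mulr_suml mulr_sumr.
congr (_ *: _); apply: eq_bigr => n _; rewrite -scalerAl -scalerAr.
by congr (_ *: _); apply/commr_sym/commrX/commr_sym.
Qed.

Lemma gidem_sum (z : k) : p.-primitive_root z -> \sum_(i < p) gidem (z ^+ i) = 1.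
Proof.
move=> zp; rewrite -scaler_sumr exchange_big scaler_sumr.
have zn (n : 'I_p) : z ^- n ^+ p = 1.
  by rewrite exprVn -exprM mulnC exprM (prim_expr_order zp) expr1n invr1.
transitivity (\sum_(n < p) ((z ^- n == 1)%:R : k) *: g ^+ n).
  apply: eq_bigr => n _; rewrite -scaler_suml scalerA -mean_powers //.
  congr (_ * _ *: _); apply: eq_bigr => i _.
  by rewrite -!exprVn -!exprM mulnC.
rewrite (bigD1 (Ordinal p_gt0)) //= expr0 invr1 eqxx scale1r big1 ?addr0 // => n n0.
rewrite -invr1 (inj_eq invr_inj) -(expr0 z) (eq_prim_root_expr zp) !modn_small //.
by rewrite -[_ == 0%N]/(n == Ordinal p_gt0) (negPf n0) scale0r.
Qed.

End RootIdempotents.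

Section Roots.
Variables (k : closedFieldType) (p : nat).
Hypotheses (p_gt0 : (0 < p)%N) (p0 : p%:R != 0 :> k).

Lemma closed_root_exists (d : k) : exists e : k, e ^+ p = d.
Proof.
have /closed_rootP[e] : size ('X^p - d%:P : {poly k}) != 1.
  by rewrite size_XnsubC // eqSS -lt0n.
by rewrite rootE !hornerE => /eqP; exists e; apply/eqP; rewrite -subr_eq0; apply/eqP.
Qed.

Lemma Xn_sub_1_roots : exists2 rs : seq k, uniq rs & 'X^p - 1 = \prod_(r <- rs) ('X - r%:P).
Proof.
have [rs rsE] := closed_field_poly_normal ('X^p - 1 : {poly k}).
move: rsE; rewrite -[1]/(1%:P) lead_coefXnsubC // scale1r => rsE.
exists rs => //; rewrite -separable_prod_XsubC -rsE.
exact: separable_Xn_sub_1.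
Qed.

Lemma prim_root_closed : exists z : k, p.-primitive_root z.
Proof.
have [rs urs rsE] := Xn_sub_1_roots.
suff /hasP[z _ pz] : has p.-primitive_root rs by exists z.
apply: has_prim_root => //.
  by apply/allP => z zrs; rewrite /root_of_unity rsE root_prod_XsubC.
have := congr1 (fun q : {poly k} => size q) rsE.
by rewrite -[1]/(1%:P) size_XnsubC // size_prod_XsubC => -[->].
Qed.

Lemma diagonalizable_pow n (u : 'M[k]_n) : u ^+ p = 1 -> diagonalizable u.
Proof.
case: n u => [|n] u up; first by rewrite [u]flatmx0; apply: diagonalizable0.
have [rs urs rsE] := Xn_sub_1_roots.
apply/diagonalizableP; exists rs => //; rewrite -rsE.
apply: mxminpoly_min; rewrite rmorphB rmorph1 rmorphXn /= horner_mx_X up.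
by rewrite subrr.
Qed.

Lemma codiagonalize n (u v : 'M[k]_n) : u ^+ p = 1 -> v ^+ p = 1 ->
  u *m v = v *m u ->
  exists2 T, T \in unitmx & exists l m : 'rV[k]_n,
    T *m u *m invmx T = diag_mx l /\ T *m v *m invmx T = diag_mx m.
Proof.
move=> up vp uv.
have /codiagonalizableP[T uT /andP[hu /andP[hv _]]] :
    {in [:: u; v] &, forall A B, comm_mx A B} /\
    {in [:: u; v], forall A, diagonalizable A}.
  split=> [A B|A]; rewrite !inE.
    by move=> /orP[]/eqP -> /orP[]/eqP ->; rewrite /comm_mx.
  by case/orP=> /eqP ->; apply: diagonalizable_pow.
exists T => //; case/diagonalizable_forPex: hu => l /(simmxRL uT) hl.
case/diagonalizable_forPex: hv => m /(simmxRL uT) hm.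
by exists l, m; rewrite hl hm.
Qed.

End Roots.

(** * A common eigenbasis for the two translations *)

Section Diagonal.
Variables (k : closedFieldType) (p : nat) (H : hopfAlgType k).
Hypotheses (p_prime : prime p) (char0 : [pchar k] =i pred0).

Let p_gt0 : (0 < p)%N := prime_gt0 p_prime.
Let p0 : p%:R != 0 :> k.
Proof. by have /pcharf0P -> := char0; rewrite -lt0n. Qed.

Lemma conjX n (T u : 'M[k]_n) m : T \in unitmx ->
  (T *m u *m invmx T) ^+ m = T *m (u ^+ m) *m invmx T.
Proof.
move=> uT; elim: m => [|m IHm]; first by rewrite !expr0 mulmx1 mulmxV.
rewrite !exprS IHm -[u * _]/(u *m _) -[_ * (_ *m _)]/(_ *m _) !mulmxA.
by rewrite mulmxKV.
Qed.

Lemma scalemxX n (e : k) (u : 'M[k]_n) m : (e *: u) ^+ m = e ^+ m *: u ^+ m.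
Proof.
elim: m => [|m IHm]; first by rewrite !expr0 scale1r.
transitivity ((e *: u) *m (e *: u) ^+ m); first by rewrite exprS.
by rewrite IHm -scalemxAl -scalemxAr scalerA !exprS.
Qed.

Lemma diag_mxX n (l : 'rV[k]_n) m : (diag_mx l) ^+ m = diag_mx (\row_i l 0 i ^+ m).
Proof.
elim: m => [|m IHm].
  by transitivity (1%:M : 'M[k]_n) => //; apply/matrixP => i j; rewrite !mxE expr0.
rewrite exprS IHm -[_ * _]/(_ *m _) mul_diag_mx; apply/matrixP => i j.
by rewrite !mxE mulrnAr exprS.
Qed.

(* The conjugating matrices are determined up to a scalar, so they can be     *)
(* taken of order p.                                                          *)
Lemma conj_normalize (W : splitting p H) (f : hdual H) :
  f ^+ p = 1 -> grouplike f ->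
  (exists u, [/\ u \in unitmx, lconj W f u & u ^+ p = 1]) /\
  (exists v, [/\ v \in unitmx, rconj W f v & v ^+ p = 1]).
Proof.
move=> fp gf; pose i0 : 'I_p := Ordinal p_gt0.
have nz (u : 'M[k]_p) : u \in unitmx -> (forall N, N *m u ^+ p = u ^+ p *m N) ->
    exists2 e : k, e != 0 & (e *: u) ^+ p = 1.
  move=> uu uC; have := mx_commutant i0 uC; set d := (u ^+ p) i0 i0 => ud.
  have d0 : d != 0.
    apply/eqP => d0; have := unitmxX p uu; rewrite ud d0 unitmxE det_scalar expr0n.
    by rewrite eqn0Ngt p_gt0 unitr0.
  have [e eE] := closed_root_exists p_gt0 d^-1.
  exists e; first by apply: contraNneq d0 => e0; rewrite -invr_eq0 -eE e0 expr0n eqn0Ngt p_gt0.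
  by rewrite scalemxX eE ud scale_scalar_mx mulVf.
have Zu (e : k) (u : 'M_p) N : e != 0 -> u \in unitmx ->
    (e *: u) *m N *m invmx (e *: u) = u *m N *m invmx u.
  move=> e0 uu; rewrite invmxZ ?unitmxZ ?unitfE //.
  by rewrite -scalemxAr -!scalemxAl scalerA mulVf ?scale1r.
split.
  have [u uu fu] := lconj_exists W p_prime gf.
  have [|e e0 eu] := nz u uu.
    move=> N; have := lconjX p uu fu (el W 0 N).
    have -> : rho W (ltrans (f ^+ p) (el W 0 N)) = N.
      by apply/matrixP => i j; rewrite -xmE ltransE fp mul1r xmE rho_el.
    by rewrite rho_el => {1}->; rewrite mulmxKV ?unitmxX.
  exists (e *: u); split=> //; first by rewrite unitmxZ ?unitfE.
  by move=> h; rewrite Zu.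
have [v uv fv] := rconj_exists W p_prime gf.
have [|e e0 ev] := nz v uv.
  move=> N; have := rconjX p uv fv (el W 0 N).
  have -> : rho W (rtrans (f ^+ p) (el W 0 N)) = N.
    by apply/matrixP => i j; rewrite -xmE rtransE fp mulr1 xmE rho_el.
  by rewrite rho_el => {1}->; rewrite mulmxKV ?unitmxX.
exists (e *: v); split=> //; first by rewrite unitmxZ ?unitfE.
by move=> h; rewrite Zu.
Qed.

(** The two conjugating matrices commute and have p-th power 1, so they are diagonal in a common
    basis; conjugation by a diagonal matrix scales the entry (i, j) by a ratio of eigenvalues. *)
Lemma grouplike_weights (W0 : splitting p H) (g : hdual H) :
  grouplike g -> g != 1 ->
  exists (W : splitting p H) (lam mu : 'I_p -> k),
    [/\ forall i, chr W i = g ^+ i,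
        forall i, lam i ^+ p = 1 /\ mu i ^+ p = 1,
        forall i j, g * xm W i j = (lam i / lam j) *: xm W i j
      & forall i j, xm W i j * g = (mu i / mu j) *: xm W i j].
Proof.
move=> gg g1; have [gp [s sE]] := grouplike_cyclic W0 p_prime gg g1.
have [[u [uu gu up]] [v [uv gv vp]]] := conj_normalize W0 gp gg.
have uvC := lr_commute1 p_prime char0 gg gv gu uu uv.
have [T uT [l [m [lE mE]]]] := codiagonalize p_gt0 p0 up vp uvC.
have root (w : 'M_p) (d : 'rV_p) i : w ^+ p = 1 -> T *m w *m invmx T = diag_mx d ->
    d 0 i ^+ p = 1.
  move=> wp wd; have := conjX w p uT; rewrite wd diag_mxX wp mulmx1 mulmxV //.
  by move/matrixP/(_ i i); rewrite !mxE eqxx !mulr1n.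
have root0 (x : k) : x ^+ p = 1 -> x != 0.
  by move=> xp; apply: contra_eq_neq xp => ->; rewrite expr0n eqn0Ngt p_gt0 eq_sym oner_eq0.
have conjE (w : 'M_p) (d : 'rV_p) (M M' : 'M_p) i j : w ^+ p = 1 -> w \in unitmx ->
    T *m w *m invmx T = diag_mx d ->
    M' = w *m M *m invmx w ->
    (T *m M' *m invmx T) i j = (d 0 i / d 0 j) * (T *m M *m invmx T) i j.
  move=> wp uw wd ->.
  have d0 := root0 _ (root _ _ j wp wd).
  apply: (mulIf d0); rewrite [RHS]mulrAC divfK //.
  have : T *m (w *m M *m invmx w) *m invmx T *m diag_mx d =
         diag_mx d *m (T *m M *m invmx T).
    by rewrite -wd !mulmxA !mulmxKV.
  rewrite mul_mx_diag mul_diag_mx => /matrixP/(_ i j).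
  by rewrite !mxE.
(* The simple module is rewritten in the eigenbasis given by T, and the characters are renumbered as
   powers of g. *)
exists (splitting_perm (splitting_conj W0 uT) s), (fun i => l 0 i), (fun i => m 0 i).
split=> [i|i|i j|i j].
- exact: sE.
- by split; [apply: root lE | apply: root mE].
- apply: hdualP => h; rewrite hdualZ -ltransE !xmE /=.
  exact: conjE up uu lE (gu h).
- apply: hdualP => h; rewrite hdualZ -rtransE !xmE /=.
  exact: conjE vp uv mE (gv h).
Qed.

End Diagonal.

(** * Left and right weights agree, so g is central *)

Section Weights.
Variables (k : closedFieldType) (p : nat) (H : hopfAlgType k).
Hypotheses (p_prime : prime p) (char0 : [pchar k] =i pred0).
Variables (W : splitting p H) (g : hdual H) (lam mu : 'I_p -> k).
Local Notation A := (hdual H).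
Local Notation xm := (xm W).
Hypotheses (g_gl : grouplike g) (gp : g ^+ p = 1).
Hypothesis chrE : forall i, chr W i = g ^+ i.
Hypotheses (lamp : forall i, lam i ^+ p = 1) (mup : forall i, mu i ^+ p = 1).
Hypothesis g_xm : forall i j, g * xm i j = (lam i / lam j) *: xm i j.
Hypothesis xm_g : forall i j, xm i j * g = (mu i / mu j) *: xm i j.

Let p_gt0 : (0 < p)%N := prime_gt0 p_prime.
Let p0 : p%:R != 0 :> k.
Proof. by have /pcharf0P -> := char0; rewrite -lt0n. Qed.

Let root0 (x : k) : x ^+ p = 1 -> x != 0 := @unity_root_neq0 k p p_gt0 x.
Let rootM (x y : k) : x ^+ p = 1 -> y ^+ p = 1 -> (x / y) ^+ p = 1 := @unity_rootM k p x y.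
Local Notation gidem := (gidem p g).

Lemma chr_gidem n a : gidem a (Hbasis W (inl n)) = p%:R^-1 * a ^- n.
Proof.
rewrite hdualZ hdual_sum (bigD1 n) //= big1 ?addr0 => [|m mn].
  by rewrite hdualZ -chrE chr_el ffunE eqxx mulr1.
by rewrite hdualZ -chrE chr_el ffunE (negPf mn) mulr0.
Qed.

Lemma gidem_neq0 a : gidem a != 0.
Proof.
apply/eqP => /(congr1 (fun f : A => f (Hbasis W (inl (Ordinal p_gt0))))).
rewrite chr_gidem hdual0 expr0 invr1 mulr1 => /eqP.
by rewrite invr_eq0 (negPf p0).
Qed.

Lemma gidem_xm a i j : a ^+ p = 1 ->
  gidem a * xm i j = (lam i / lam j == a)%:R *: xm i j.
Proof. by move=> ap; apply: (gidem_eigl p_gt0 p0) (g_xm i j) => //; apply: rootM. Qed.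

Lemma xm_gidem a i j : a ^+ p = 1 ->
  xm i j * gidem a = (mu i / mu j == a)%:R *: xm i j.
Proof. by move=> ap; apply: (gidem_eigr p_gt0 p0) (xm_g i j) => //; apply: rootM. Qed.

(** Multiplying the antipode equation sum_l x_il S(x_li) = 1 by the idempotent keeps the terms of
    left weight a. *)
Lemma gidem_suml a i : a ^+ p = 1 ->
  gidem a = \sum_(l | lam i / lam l == a) xm i l * antipode (xm l i).
Proof.
move=> ap; have := antipoder_sum (comul_xm W i i).
rewrite counit_xm eqxx scale1r => /(congr1 (fun x => gidem a * x)).
rewrite mulr1 mulr_sumr => <-; rewrite [RHS]big_mkcond.
apply: eq_bigr => l _; rewrite mulrA gidem_xm //.
by case: ifP; rewrite ?scale1r // scale0r mul0r.
Qed.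

Lemma gidem_sumr a i : a ^+ p = 1 ->
  gidem a = \sum_(l | mu l / mu i == a) antipode (xm i l) * xm l i.
Proof.
move=> ap; have := antipodel_sum (comul_xm W i i).
rewrite counit_xm eqxx scale1r => /(congr1 (fun x => x * gidem a)).
rewrite mul1r mulr_suml => <-; rewrite [RHS]big_mkcond.
apply: eq_bigr => l _; rewrite -mulrA xm_gidem //.
by case: ifP; rewrite ?scale1r // scale0r mulr0.
Qed.

(** Otherwise the sum in [gidem_suml] would be empty for some a, whereas the idempotents are
    nonzero. *)
Lemma lam_surj b : b ^+ p = 1 -> exists l, lam l = b.
Proof.
move=> bp; pose i := Ordinal p_gt0.
have [l /eqP e|h] := pickP (fun l => lam i / lam l == lam i / b).
  exists l; apply: invr_inj; apply: (mulfI (root0 (lamp i))); exact: e.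
have := gidem_neq0 (lam i / b); rewrite (@gidem_suml _ i); last exact: rootM.
by rewrite big_pred0 ?eqxx.
Qed.

Lemma mu_surj b : b ^+ p = 1 -> exists l, mu l = b.
Proof.
move=> bp; pose i := Ordinal p_gt0.
have [l /eqP e|h] := pickP (fun l => mu l / mu i == b / mu i).
  exists l; apply: (mulIf (invr_neq0 (root0 (mup i)))); exact: e.
have := gidem_neq0 (b / mu i); rewrite (@gidem_sumr _ i); last exact: rootM.
by rewrite big_pred0 ?eqxx.
Qed.

(** There are p roots to reach and p indices to reach them from. *)
Lemma roots_inj (f : 'I_p -> k) :
  (forall b, b ^+ p = 1 -> exists l, f l = b) -> injective f.
Proof.
move=> fs; have [z zp] := prim_root_closed p_gt0 p0.
have zX (n : 'I_p) : (z ^+ n) ^+ p = 1.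
  by rewrite -exprM mulnC exprM (prim_expr_order zp) expr1n.
have fsb (n : 'I_p) : exists l, f l == z ^+ n.
  by have [l <-] := fs _ (zX n); exists l.
pose h n := xchoose (fsb n).
have hE n : f (h n) = z ^+ n by apply/eqP; exact: (xchooseP (fsb n)).
have h_inj : injective h.
  move=> m n e; have : z ^+ m == z ^+ n by rewrite -!hE e.
  by rewrite (eq_prim_root_expr zp) !modn_small // => /eqP/val_inj.
have [h' hK h'K] := injF_bij h_inj.
move=> i j; rewrite -[i]h'K -[j]h'K !hE => /eqP.
by rewrite (eq_prim_root_expr zp) !modn_small // => /eqP/val_inj ->.
Qed.

Lemma lam_inj : injective lam. Proof. exact: roots_inj lam_surj. Qed.
Lemma mu_inj : injective mu. Proof. exact: roots_inj mu_surj. Qed.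

Lemma xm_antipode i l : xm i l * antipode (xm l i) = gidem (lam i / lam l).
Proof.
rewrite (@gidem_suml _ i); last exact: rootM.
rewrite (big_pred1 l) // => m /=; apply/eqP/eqP => [|->] // e.
by apply/lam_inj/invr_inj; apply: (mulfI (root0 (lamp i))).
Qed.

Lemma antipode_xm i l : antipode (xm l i) * xm i l = gidem (mu i / mu l).
Proof.
rewrite (@gidem_sumr _ l); last exact: rootM.
rewrite (big_pred1 i) // => m /=; apply/eqP/eqP => [|->] // e.
by apply: mu_inj; apply: (mulIf (invr_neq0 (root0 (mup l)))).
Qed.

Definition atrace := basis_trace (Abasis W) (fun t (f : A) => f (Hbasis W t) : k^o).

(** The dimension of e_a A e_c for e_a = [gidem a]: the term [a == c] comes from the line of e_a,
    the rest from the coefficients [xm]. *)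
Definition wcount (a c : k) : nat :=
  ((a == c) + #|[pred t : 'I_p * 'I_p | (lam t.1 / lam t.2 == a) && (mu t.1 / mu t.2 == c)]|)%N.

Lemma atrace_sandwich a c : a ^+ p = 1 -> c ^+ p = 1 ->
  atrace (fun f => gidem a * f * gidem c) = (wcount a c)%:R.
Proof.
move=> ap cp; rewrite /atrace /basis_trace big_sumType natrD; congr (_ + _).
  transitivity (\sum_(n < p) ((a == c)%:R * p%:R^-1 : k)).
    apply: eq_bigr => n _ /=; rewrite chrE.
    have ag : gidem a * g = a *: gidem a by rewrite gidem_g (g_gidem p_gt0 gp ap).
    rewrite (eig_gX n ag) -scalerAl (gidemM p_gt0 p0) //.
    rewrite scalerA hdualZ chr_gidem eq_sym.
    have [->|_] := eqVneq a c; last by rewrite mulr0 !mul0r.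
    by rewrite mulr1 mul1r mulrCA divff ?mulr1 // expf_neq0 // root0.
  by rewrite sumr_const card_ord -[LHS]mulr_natr divfK.
rewrite -sum1_card natr_sum [RHS]big_mkcond; apply: eq_bigr => -[i l] _ /=.
rewrite gidem_xm // -scalerAl xm_gidem // scalerA hdualZ.
rewrite (Abasis_dual W (inr (i, l)) (inr (i, l))) eqxx mulr1 inE /= -natrM mulnb.
by case: ifP.
Qed.

(** With x = [xm i l] and y = [antipode (xm l i)] the two idempotents are x y and y x, and cyclicity
    of the trace moves the multiplication by x from one end to the other. *)
Lemma wcount_eq i l c : c ^+ p = 1 ->
  wcount (lam i / lam l) c = wcount (mu i / mu l) c.
Proof.
move=> cp; apply: (pcharf0_natr_inj char0) => /=.
rewrite -(atrace_sandwich (rootM (lamp i) (lamp l)) cp).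
rewrite -(atrace_sandwich (rootM (mup i) (mup l)) cp) -(xm_antipode i l) -(antipode_xm i l).
rewrite /atrace; transitivity (basis_trace (Abasis W) (fun t (f : A) => f (Hbasis W t) : k^o)
    (fun f => xm i l * (antipode (xm l i) * f * gidem c))).
  by apply: eq_bigr => t _; rewrite !mulrA.
have lF (x : A) : linear (fun f : A => x * f) := linear_mull x.
rewrite (@basis_traceC _ _ _ _ _ _ _ (fun f => xm i l * f)
   (fun f => antipode (xm l i) * f * gidem c)).
- by apply: eq_bigr => t _; rewrite !mulrA.
- by move=> t d x y; rewrite hdualD hdualZ.
- exact: Abasis_dec.
- exact: lF.
- by move=> d x y; rewrite lF linear_mulr.
Qed.

(** A list with multiplicities, so that its product is the determinant of right multiplication by g
    on e_a A. *)
Definition weights (a : k) : seq k :=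
  a :: [seq mu t.1 / mu t.2 | t <- enum [pred t : 'I_p * 'I_p | lam t.1 / lam t.2 == a]].

Lemma count_weights a c : count_mem c (weights a) = wcount a c.
Proof.
rewrite /= count_map /wcount; congr (_ + _)%N.
rewrite -size_filter cardE; congr size.
rewrite /enum_mem -filter_predI; apply: eq_filter => t.
by rewrite !inE /= andbC.
Qed.

(** For each i a single l satisfies lam i / lam l = a, and i -> l is a permutation; so the ratios mu
    i / mu l cancel and the head a of the list is left. *)
Lemma prod_weights a : a ^+ p = 1 -> \prod_(b <- weights a) b = a.
Proof.
move=> ap; rewrite big_cons big_map -[RHS]mulr1; congr (_ * _).
have ts i : exists l, lam l == lam i / a.
  by have [l <-] := lam_surj (rootM (lamp i) ap); exists l.
pose t i := xchoose (ts i).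
have tE i : lam (t i) = lam i / a by apply/eqP; exact: (xchooseP (ts i)).
have t_inj : injective t.
  move=> i j e; apply: lam_inj; apply: (mulIf (invr_neq0 (root0 ap))).
  by rewrite -!tE e.
rewrite big_enum /= -(pair_big_dep xpredT (fun i l => lam i / lam l == a)
  (fun i l => mu i / mu l)) /=.
transitivity (\prod_i (mu i / mu (t i))).
  apply: eq_bigr => i _; rewrite (big_pred1 (t i)) // => l /=.
  apply/eqP/eqP => [e|->].
    by apply: lam_inj; rewrite tE -e invfM invrK mulrA divff ?mul1r // root0.
  by rewrite tE invfM invrK mulrA divff ?mul1r // root0.
rewrite big_split /= prodfV {1}(reindex_inj t_inj) /= divff //.
by apply/prodf_neq0 => i _; rewrite root0.
Qed.

(* The idempotents of lam i / lam l and mu i / mu l are equivalent, so they    *)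
(* carry the same right weights, and the product of those weights returns the *)
(* left weight.                                                               *)
Lemma weights_agree i l : mu i / mu l = lam i / lam l.
Proof.
set b := mu i / mu l; set a := lam i / lam l.
have bp : b ^+ p = 1 by exact: rootM.
have ap : a ^+ p = 1 by exact: rootM.
have wp x c : x ^+ p = 1 -> c \in weights x -> c ^+ p = 1.
  move=> xp; rewrite inE => /orP[/eqP -> //|/mapP[t _ ->]]; exact: rootM.
rewrite -(prod_weights bp) -(prod_weights ap); apply: perm_big.
rewrite perm_sym; apply/allP => c; rewrite mem_cat => cw.
have cp : c ^+ p = 1 by case/orP: cw; apply: wp.
by apply/eqP; rewrite -[LHS]/(count_mem c _) -[RHS]/(count_mem c _) !count_weights wcount_eq.
Qed.

Lemma weight_central : g \in 'Z({: A})%VS.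
Proof.
rewrite /center memv_cap memvf /=; apply/centvP => f _.
have C x : x = \sum_n ((x : A) (Hbasis W (inl n)) : k) *: chr W n
    + \sum_i \sum_j ((x : A) (Hbasis W (inr (i, j))) : k) *: xm i j.
  exact: Abasis_split.
rewrite (C f) mulrDl mulrDr; congr (_ + _).
  rewrite mulr_suml mulr_sumr; apply: eq_bigr => n _.
  by rewrite -scalerAl -scalerAr chrE -exprS -exprSr.
rewrite mulr_suml mulr_sumr; apply: eq_bigr => i _.
rewrite mulr_suml mulr_sumr; apply: eq_bigr => j _.
by rewrite -scalerAl -scalerAr xm_g g_xm weights_agree.
Qed.

End Weights.

(** * The quotient by g - 1 *)

(** The outcome of [grouplike_weights] after [weights_agree]: the same ratios occur on both
    sides. *)
Record weighted (k : closedFieldType) (p : nat) (H : hopfAlgType k)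
    (W : splitting p H) (g : hdual H) (lam : 'I_p -> k) : Prop := Weighted {
  weighted_grouplike : grouplike g;
  weighted_order : g ^+ p = 1;
  weighted_chr : forall i, chr W i = g ^+ i;
  weighted_root : forall i, lam i ^+ p = 1;
  weighted_l : forall i j, g * xm W i j = (lam i / lam j) *: xm W i j;
  weighted_r : forall i j, xm W i j * g = (lam i / lam j) *: xm W i j
}.

Section Core.
Variables (k : closedFieldType) (p : nat) (H : hopfAlgType k).
Hypotheses (p_prime : prime p) (char0 : [pchar k] =i pred0).

Lemma grouplike_weighted (W0 : splitting p H) (g : hdual H) :
  grouplike g -> g != 1 ->
  exists (W : splitting p H) (lam : 'I_p -> k), weighted W g lam.
Proof.
move=> gg g1; have [gp _] := grouplike_cyclic W0 p_prime gg g1.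
have [W [lam [mu [chrE roots gx xg]]]] := grouplike_weights p_prime char0 W0 gg g1.
exists W, lam; split=> // [i|i j]; first by have [] := roots i.
have lamp i' : lam i' ^+ p = 1 by have [] := roots i'.
have mup i' : mu i' ^+ p = 1 by have [] := roots i'.
by rewrite xg (weights_agree p_prime char0 gp chrE lamp mup gx xg).
Qed.

Variables (W : splitting p H) (g : hdual H) (lam : 'I_p -> k).
Hypothesis Wg : weighted W g lam.
Local Notation A := (hdual H).
Local Notation xm := (xm W).
Local Notation el := (el W).
Local Notation S := (@antipode k A).

Let p_gt0 : (0 < p)%N := prime_gt0 p_prime.
Let p0 : p%:R != 0 :> k.
Proof. by have /pcharf0P -> := char0; rewrite -lt0n. Qed.
Let gl := weighted_grouplike Wg.
Let gp := weighted_order Wg.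
Let chrE := weighted_chr Wg.
Let lamp := weighted_root Wg.
Let gx := weighted_l Wg.
Let xg := weighted_r Wg.

Let root0 (x : k) : x ^+ p = 1 -> x != 0 := @unity_root_neq0 k p p_gt0 x.
Let rootM (x y : k) : x ^+ p = 1 -> y ^+ p = 1 -> (x / y) ^+ p = 1 := @unity_rootM k p x y.

Local Notation ge := (gidem p g).
Local Notation e := (gidem p g 1).
Let one_p : (1 : k) ^+ p = 1 := expr1n _ _.

Lemma lam_injective : injective lam.
Proof. exact: (lam_inj p_prime char0 chrE lamp gx). Qed.

Lemma xm_S i l : xm i l * S (xm l i) = ge (lam i / lam l).
Proof. exact: (xm_antipode p_prime char0 chrE lamp gx). Qed.

Lemma S_xm i l : S (xm l i) * xm i l = ge (lam i / lam l).
Proof. exact: (antipode_xm p_prime char0 chrE lamp xg). Qed.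

Lemma central_g f : g * f = f * g.
Proof.
have := weight_central p_prime char0 gp chrE lamp lamp gx xg.
by rewrite memv_cap => /andP[_ /centvP/(_ f (memvf f))].
Qed.

Lemma gidem_central a f : ge a * f = f * ge a.
Proof.
rewrite /gidem -scalerAl -scalerAr mulr_suml mulr_sumr; congr (_ *: _).
apply: eq_bigr => n _; rewrite -scalerAl -scalerAr; congr (_ *: _).
elim: (nat_of_ord n) => [|m IHm]; first by rewrite mul1r mulr1.
by rewrite exprS -mulrA IHm !mulrA central_g.
Qed.

Lemma ge_xm a i j : a ^+ p = 1 -> ge a * xm i j = (lam i / lam j == a)%:R *: xm i j.
Proof. by move=> ap; apply: (gidem_xm p_prime char0 lamp gx). Qed.

Lemma e_xm i j : e * xm i j = (i == j)%:R *: xm i j.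
Proof.
rewrite ge_xm //; congr (_%:R *: _); congr nat_of_bool.
apply/eqP/eqP => [ij|->]; last by rewrite divff // root0.
apply: lam_injective; apply: (mulIf (invr_neq0 (root0 (lamp j)))).
by rewrite ij divff // root0.
Qed.

Lemma ge_gX a n : a ^+ p = 1 -> ge a * g ^+ n = a ^+ n *: ge a.
Proof.
by move=> ap; apply: eig_gX; rewrite gidem_g (g_gidem p_gt0).
Qed.

Lemma S_grouplike (f : A) : grouplike f -> S (S f) = f.
Proof.
move=> gf; have := congr1 S (grouplikeVl gf).
rewrite antipodeM antipode1 => /(congr1 (fun x => f * x)).
by rewrite mulrA grouplikeVr // mul1r mulr1.
Qed.

Lemma S_linear : linear S. Proof. by move=> c x y; rewrite linearP. Qed.

(** S^2(x_li) has the left weight of x_li, so it is fixed by the idempotent x_li S(x_il).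
    Regrouping, it equals x_li S(e_a) with a = lam i / lam l, and S(e_a) fixes x_li since S inverts
    g. The gradings need this to identify V with its double dual. *)
Lemma S_invol (f : A) : S (S f) = f.
Proof.
have Sx l i : S (S (xm l i)) = xm l i.
  set X := S _; pose a := lam i / lam l.
  have ap : a ^+ p = 1 by exact: rootM.
  have aV : a^-1 = lam l / lam i by rewrite invf_div.
  have eX : ge (lam l / lam i) * X = X.
    have gX : g * X = (lam l / lam i) *: X.
      rewrite -{1}(S_grouplike gl) -!antipodeM.
      by rewrite gx (linear_scale _ _ S_linear) (linear_scale _ _ S_linear).
    by rewrite (gidem_eigl p_gt0 p0 _ _ gX) ?rootM // eqxx scale1r.
  rewrite -eX -xm_S -mulrA /X -antipodeM S_xm -/a.
  rewrite /gidem (linear_scale _ _ S_linear) linear_sum /=.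
  rewrite -scalerAr mulr_sumr.
  have xSg n : xm l i * S (g ^+ n) = a ^+ n *: xm l i.
    have := eig_gX n (xg l i); rewrite -aV => /(congr1 (fun x => x * S (g ^+ n))).
    rewrite -mulrA grouplikeVr ?mulr1; last exact: grouplikeX.
    rewrite -scalerAl => {2}->; rewrite scalerA -exprMn divff ?expr1n ?scale1r //.
    exact: root0.
  under eq_bigr => n _ do rewrite (linear_scale _ _ S_linear) -scalerAr xSg scalerA
     mulVf ?expf_neq0 ?root0 // scale1r.
  by rewrite sumr_const card_ord -scaler_nat scalerA mulVf // scale1r.
have lSS : linear (fun f => S (S f)) by move=> c x y; rewrite !linearP.
rewrite [f](Abasis_dec W) (linear_bigsum lSS); apply: eq_bigr => -[n|[i j]] _ /=.
  by rewrite S_grouplike //; apply: chr_grouplike.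
by rewrite Sx.
Qed.

(* The quotient of A by g - 1 is eA, with grouplike basis e, x_11, ..., x_pp; *)
(* bK is the dual basis of idempotents in H.                                  *)
Definition GA (t : option 'I_p) : A := if t is Some i then xm i i else e.
Definition bK (t : option 'I_p) : H :=
  if t is Some i then el 0 (delta_mx i i) else el [ffun _ => 1] 0.

Lemma chr_bK n t : chr W n (bK t) = (t == None)%:R.
Proof. by case: t => [i|]; rewrite /= chr_el ffunE. Qed.

Lemma eE_bK t : e (bK t) = (t == None)%:R.
Proof.
rewrite hdualZ hdual_sum.
under eq_bigr => n _ do rewrite hdualZ -chrE chr_bK expr1n invr1 mul1r.
by rewrite sumr_const card_ord -[(_ == _)%:R *+ p]mulr_natl mulKf.
Qed.

Lemma GA_bK s t : GA s (bK t) = (s == t)%:R.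
Proof.
case: s => [i|] /=; last by rewrite eE_bK // eq_sym.
rewrite xmE; case: t => [j|] /=; rewrite rho_el; last by rewrite mxE.
by rewrite mxE andbb.
Qed.

Lemma bKM s t : bK s * bK t = (s == t)%:R *: bK s.
Proof.
apply: (splitting_inj (W := W)) => [n|].
  rewrite chrM hdual_scale !chr_bK.
  by case: s t => [i|] [j|] /=; rewrite ?mulr0 ?mul0r ?mulr1.
rewrite rhoM linearZ; case: s t => [i|] [j|] /=; rewrite !rho_el ?mul0mx ?mulmx0 ?scaler0 ?scale0r //.
- have [->|ij] := eqVneq i j; first by rewrite mul_delta_mx eqxx scale1r.
  rewrite mul_delta_mx_0 // -[Some i == Some j]/(i == j) (negPf ij).
  by rewrite scale0r.
Qed.

Lemma sum_bK : \sum_t bK t = 1.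
Proof.
apply: (splitting_inj (W := W)) => [n|].
  rewrite hdual_suml chr1 (bigD1 None) //= big1 ?addr0 => [|t tn].
    by rewrite (chr_bK n None).
  by rewrite chr_bK (negPf tn).
rewrite linear_sum /= rho1 (bigD1 None) //= rho_el add0r.
have -> : \sum_(t | t != None) rho W (bK t) = \sum_i delta_mx i i.
  rewrite (reindex_omap Some id) /=; last by case.
  by apply: eq_big => [i|i _]; rewrite ?eqxx //= rho_el.
apply/matrixP => i j; rewrite summxE mxE (bigD1 i) //= big1 => [|l li].
  by rewrite mxE eqxx addr0 eq_sym.
by rewrite mxE eq_sym (negPf li).
Qed.

(** Multiplication by e sends each power of g to e and kills the off-diagonal coefficients. *)
Lemma e_dec (f : A) : e * f = \sum_t (f (bK t) : k) *: GA t.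
Proof.
rewrite {1}(Abasis_split W f) mulrDr (bigD1 None) //=; congr (_ + _).
  have -> : el [ffun=> 1] 0 = \sum_n Hbasis W (inl n).
    apply: (splitting_inj (W := W)) => [n|].
      rewrite chr_el ffunE hdual_suml (bigD1 n) //= big1 ?addr0 => [|m mn].
        by rewrite chr_el ffunE eqxx.
      by rewrite chr_el ffunE eq_sym (negPf mn).
    by rewrite linear_sum /= rho_el big1 // => n _; rewrite rho_el.
  rewrite hdual_suml scaler_suml mulr_sumr; apply: eq_bigr => n _.
  by rewrite -scalerAr chrE ge_gX // expr1n scale1r.
rewrite (reindex_omap Some id) /=; last by case.
rewrite mulr_sumr; apply: eq_big => [i|i _]; first by rewrite eqxx.
rewrite mulr_sumr (bigD1 i) //= big1 ?addr0 => [|j ji].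
  by rewrite -scalerAr e_xm eqxx scale1r.
by rewrite -scalerAr e_xm eq_sym (negPf ji) scale0r scaler0.
Qed.

Lemma e_bK (f : A) t : (e * f) (bK t) = f (bK t).
Proof.
rewrite e_dec hdual_sum (bigD1 t) //= big1 ?addr0 => [|s st].
  by rewrite hdualZ GA_bK eqxx mulr1.
by rewrite hdualZ GA_bK (negPf st) mulr0.
Qed.

Lemma e_GA t : e * GA t = GA t.
Proof.
case: t => [i|] /=; first by rewrite e_xm eqxx scale1r.
by rewrite (gidemM p_gt0 p0 gp) // eqxx scale1r.
Qed.

Lemma GA_inj : injective GA.
Proof.
move=> s t /(congr1 (fun f : A => f (bK s))); rewrite !GA_bK eqxx.
by case: (altP (t =P s)) => // _ /eqP; rewrite oner_eq0.
Qed.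

(** Values on [bK t] do not distinguish f from e f, and the central e can be absorbed in either
    factor, where it kills off-diagonal coefficients. *)
Lemma xmxm_bK i l j m t :
  (xm i l * xm j m) (bK t) = ((l == i) && (m == j))%:R * (xm i i * xm j j) (bK t).
Proof.
rewrite -e_bK mulrA e_xm -scalerAl hdualZ eq_sym.
have [->|_] := eqVneq l i; last by rewrite !mul0r.
rewrite !mul1r -e_bK mulrA gidem_central -mulrA e_xm -scalerAr hdualZ eq_sym.
by have [->|_] := eqVneq m j; rewrite ?mul1r ?mul0r.
Qed.

Lemma xmxm_comul i j l m (a b : H) :
  (xm i j * xm l m) (a * b) =
  \sum_n \sum_q (xm i n * xm l q) a * (xm n j * xm q m) b.
Proof.
have := comul_prod (comul_xm W i j) (comul_xm W l m).
rewrite pair_bigA => /comul_dualP ->.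
by rewrite pair_bigA.
Qed.

(** The product [xm i j * xm l m] is homogeneous of degree [xm i i * xm l l] for the left coaction
    of eA; [xmxm_bKr] is the counterpart on the right. *)
Lemma xmxm_bKl i j l m t (b : H) :
  (xm i j * xm l m) (bK t * b) =
  (xm i i * xm l l) (bK t) * (xm i j * xm l m) b.
Proof.
rewrite xmxm_comul (bigD1 i) //= [X in _ + X]big1 ?addr0 => [|n ni]; last first.
  by rewrite big1 // => q _; rewrite xmxm_bK (negPf ni) !mul0r.
rewrite (bigD1 l) //= [X in _ + X]big1 ?addr0 // => q ql.
by rewrite xmxm_bK (negPf ql) andbF !mul0r.
Qed.

Lemma xmxm_bKr i j l m t (a : H) :
  (xm i j * xm l m) (a * bK t) =
  (xm i j * xm l m) a * (xm j j * xm m m) (bK t).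
Proof.
have xK n q : (xm n j * xm q m) (bK t) =
    ((n == j) && (q == m))%:R * (xm j j * xm m m) (bK t).
  rewrite xmxm_bK eq_sym [m == q]eq_sym.
  have [->|_] := eqVneq n j; last by rewrite !mul0r.
  by have [->|_] := eqVneq q m; rewrite ?mul0r.
rewrite xmxm_comul (bigD1 j) //= [X in _ + X]big1 ?addr0 => [|n nj]; last first.
  by rewrite big1 // => q _; rewrite xK (negPf nj) mul0r mulr0.
rewrite (bigD1 m) //= [X in _ + X]big1 ?addr0 // => q qm.
by rewrite xK (negPf qm) andbF mul0r mulr0.
Qed.

(** The values of the product on the orthogonal idempotents [bK t] are multiplicative and sum to 1,
    so exactly one of them is 1. *)
Lemma GA_mul_xm i j : exists t, xm i i * xm j j = GA t.
Proof.
set y := _ * _; pose c t := y (bK t).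
have cM s t : c s * c t = (s == t)%:R * c s.
  by rewrite /c -[RHS]hdual_scale -bKM xmxm_bKl.
have c1 : \sum_t c t = 1.
  rewrite -hdual_suml sum_bK -dual_counitE counitM !counit_xm !eqxx.
  exact: mulr1.
have [t ct] := orthogonal_idem_delta cM c1.
exists t; have -> : y = e * y by rewrite /y mulrA e_xm eqxx scale1r.
rewrite e_dec (bigD1 t) //= big1 ?addr0 => [|s st].
  by rewrite -/(c t) ct eqxx scale1r.
by rewrite -/(c s) ct (negPf st) scale0r.
Qed.

Lemma GA_mul s t : exists u, GA s * GA t = GA u.
Proof.
case: s => [i|]; last by exists t; rewrite e_GA.
case: t => [j|]; first exact: GA_mul_xm.
by exists (Some i); rewrite /= -gidem_central e_xm eqxx scale1r.
Qed.

Lemma S_xm_e i : S (xm i i) * xm i i = e.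
Proof. by rewrite S_xm divff // root0. Qed.

Lemma GA_mulI i : injective (fun t => xm i i * GA t).
Proof.
move=> s t /= /(congr1 (fun x => S (xm i i) * x)).
by rewrite !mulrA S_xm_e !e_GA => /GA_inj.
Qed.

(* eA coacts on both sides of A; y = x_il ^ 2 has the left degree x_ii ^ 2 and *)
(* the right degree x_ll ^ 2.  If the former is e then y is a multiple of     *)
(* e_a, whose right degree is e.                                              *)
Lemma xm_involution_transfer i l : xm i i * xm i i = e -> xm l l * xm l l = e.
Proof.
move=> xi; pose y := xm i l * xm i l; pose a := lam i / lam l.
have ap : a ^+ p = 1 by exact: rootM.
have yE j m : y (el 0 (delta_mx j m)) = 0.
  have -> : el 0 (delta_mx j m) = bK (Some j) * el 0 (delta_mx j m).
    by rewrite /= el0M mul_delta_mx.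
  by rewrite xmxm_bKl xi eE_bK mul0r.
have ey : ge a * y = y by rewrite /y mulrA ge_xm // eqxx scale1r.
have [c yc] : exists c : k, y = c *: ge a.
  exists (\sum_n (y (Hbasis W (inl n)) * a ^+ n)).
  rewrite -[LHS]ey {1}(Abasis_split W y) [X in _ + X]big1 ?addr0 => [|j _]; last first.
    by rewrite big1 // => m _; rewrite yE scale0r.
  rewrite mulr_sumr scaler_suml; apply: eq_bigr => n _.
  by rewrite -scalerAr chrE ge_gX // scalerA.
have c0 : c != 0.
  apply: contraNneq (gidem_neq0 p_prime char0 chrE a) => c0.
  have y0 : y = 0 by rewrite yc c0 scale0r.
  have : S (xm l i) * (S (xm l i) * y) = ge a.
    rewrite /y (mulrA (S (xm l i)) (xm i l)) S_xm -/a ge_xm // eqxx scale1r.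
    by rewrite S_xm.
  by rewrite y0 !mulr0 => <-.
have gab h t : ge a (h * bK t) = ge a h * (t == None)%:R.
  rewrite !hdualZ -mulrA !hdual_sum mulr_suml; congr (_ * _).
  apply: eq_bigr => n _; rewrite !hdualZ -mulrA; congr (_ * _).
  by rewrite -chrE chrM chr_bK.
have xl t : (xm l l * xm l l) (bK t) = (t == None)%:R.
  pose h := Hbasis W (inl (Ordinal p_gt0)).
  have := xmxm_bKr i l i l t h; rewrite -/y yc !(hdualZ c (ge a)) gab mulrA => /esym.
  apply: mulfI; rewrite mulf_neq0 // chr_gidem //= expr0 invr1 mulr1.
  by rewrite invr_eq0.
have -> : xm l l * xm l l = e * (xm l l * xm l l) by rewrite mulrA e_xm eqxx scale1r.
rewrite e_dec (bigD1 None) //= big1 ?addr0 => [|t tn].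
  by rewrite (xl None) scale1r.
by rewrite xl (negPf tn) scale0r.
Qed.

(** Left multiplication by [xm i i] permutes the finite set of the [GA t], hence reaches e. *)
Lemma xm_inverse i : exists j, xm i i * xm j j = e /\ xm j j * xm i i = e.
Proof.
have ex t : exists u, xm i i * GA t == GA u.
  by have [u /eqP] := GA_mul (Some i) t; exists u.
pose f t := xchoose (ex t).
have fE t : xm i i * GA t = GA (f t) by apply/eqP; exact: (xchooseP (ex t)).
have f_inj : injective f.
  by move=> s t fst; apply: (@GA_mulI i); rewrite /= !fE fst.
have [f' _ f'K] := injF_bij f_inj.
have := fE (f' None); rewrite f'K; case: (f' None) => [j|] /= h; last first.
  have : GA (Some i) = GA None by rewrite /= -h -gidem_central e_xm eqxx scale1r.
  by move/GA_inj.
exists j; split=> //; have xj : xm j j = S (xm i i) * e.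
  by rewrite -h mulrA S_xm_e (e_GA (Some j)).
by rewrite xj -mulrA e_xm eqxx scale1r S_xm_e.
Qed.

(** Inversion is an involution of the p elements other than e, so for odd p it fixes one of them. *)
Lemma odd_involution : odd p -> exists i, xm i i * xm i i = e.
Proof.
move=> p_odd; have ex i : exists j, xm i i * xm j j == e.
  by have [j [/eqP ij _]] := xm_inverse i; exists j.
pose f i := xchoose (ex i).
have fE i : xm i i * xm (f i) (f i) = e by apply/eqP; exact: (xchooseP (ex i)).
have fK : involutive f.
  move=> i; have [j [ij ji]] := xm_inverse i.
  have fi : f i = j.
    have : Some (f i) = Some j by apply: (@GA_mulI i); rewrite /= fE.
    by case.
  have : Some (f (f i)) = Some i by apply: (@GA_mulI (f i)); rewrite /= fE fi.
  by case.
have [i /eqP fi|nf] := pickP (fun i => f i == i).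
  by exists i; have := fE i; rewrite fi.
have := involution_even fK (fun i => negbT (nf i)).
by rewrite p_odd.
Qed.

(** For odd p there is an element of order 2, and [xm_involution_transfer] spreads this to all the
    [xm i i]; exponent 2 forces commutativity. For p = 2 the group has order 3. *)
Lemma xm_group : exists2 r, prime r &
  (forall i j, xm i i * xm j j = xm j j * xm i i) /\ (forall i, xm i i ^+ r = e).
Proof.
have [p_odd|p_even] := boolP (odd p).
  exists 2%N => //; have [i0 x0] := odd_involution p_odd.
  have sq i : xm i i * xm i i = e := xm_involution_transfer i x0.
  have sqG t : GA t * GA t = e by case: t => [i|] //=; apply: (e_GA None).
  split=> [i j|i]; last by rewrite expr2 sq.
  have [t tE] := GA_mul_xm i j; have := sqG t; rewrite -tE => h.
  transitivity (xm i i * (xm i i * xm j j * (xm i i * xm j j)) * xm j j).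
    by rewrite h -gidem_central e_xm eqxx scale1r.
  rewrite !mulrA sq -mulrA sq -gidem_central !mulrA.
  by rewrite (gidemM p_gt0 p0 gp) // eqxx scale1r e_xm eqxx scale1r.
have {p_even} p2 : p = 2 by case: (even_prime p_prime) => // h; rewrite h in p_even.
exists 3%N => //.
have two (i j l : 'I_p) : i != j -> l != i -> l = j.
  rewrite -!val_eqE /= => ij li; apply: val_inj => /=; move: ij li.
  have := ltn_ord i; have := ltn_ord j; have := ltn_ord l; rewrite {2 4 6}p2.
  by case: (val i) (val j) (val l) => [|[|//]] [|[|//]] [|[|//]].
have Ge t : GA t * e = GA t by rewrite -gidem_central e_GA.
have prodE i j : i != j -> xm i i * xm j j = e /\ xm i i ^+ 3 = e.
  move=> ij.
  (* If x_ii^2 were e, so would x_jj^2, and no value would be left for x_ii x_jj; and x_ii^2 = x_ii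
     would make x_ii trivial. *)
  have xi : xm i i * xm i i = xm j j.
    have [[l|] lE] := GA_mul_xm i i; last first.
      have sqi : xm i i * xm i i = e by exact: lE.
      have sqj := xm_involution_transfer j sqi.
      have [[l|] /= lE'] := GA_mul_xm i j.
        have [li|li] := eqVneq l i.
          have := @GA_mulI i (Some j) None; rewrite /= lE' li (Ge (Some i)).
          by move/(_ erefl).
        have lj := two i j l ij li; move: lE'; rewrite lj => h.
        have /(congr1 (fun x => x * xm j j)) := h; rewrite -mulrA sqj (Ge (Some i)).
        by move=> /(@GA_inj (Some i) None).
      have := @GA_mulI i (Some j) (Some i); rewrite /= lE' sqi => /(_ erefl) [ji].
      by rewrite ji eqxx in ij.
    have [li|li] := eqVneq l i; last by rewrite lE (two i j l ij li).
    have := @GA_mulI i (Some i) None; rewrite /= lE li (Ge (Some i)).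
    by move/(_ erefl).
  have [j' [ij' _]] := xm_inverse i.
  have j'j : j' = j.
    apply: (two i j) => //; apply/eqP => j'i; move: ij'; rewrite j'i xi.
    by move/(@GA_inj (Some j) None).
  rewrite j'j in ij'; split=> //.
  by rewrite exprSr expr2 xi -[in RHS]ij' -xi mulrA.
have other (i : 'I_p) : exists j, i != j.
  have [j ij|h] := pickP (fun j => i != j); first by exists j.
  have : (1 < #|'I_p|)%N by rewrite card_ord prime_gt1.
  by case/card_gt1P => x [y [_ _]]; rewrite -(eqP (negbFE (h x))) -(eqP (negbFE (h y))) eqxx.
split=> [i j|i]; last by have [j /prodE[]] := other i.
have [->|ij] := eqVneq i j; first by [].
by rewrite (prodE _ _ ij).1 (prodE j i _).1 // eq_sym.
Qed.

(** The sum of the [GA t] is permuted within itself by each x_ii and fixed by e, hence by g; its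
    counit is p + 1. *)
Lemma integral_GA : exists2 L : A, (forall f, f * L = (counit f : k) *: L)
    & (counit L : k) != 0.
Proof.
pose L := \sum_t GA t; exists L; last first.
  rewrite dual_counitE hdual_sum.
  have -> : \sum_t (GA t) 1 = \sum_(t : option 'I_p) (1 : k).
    apply: eq_bigr => -[i|] _; first by rewrite xmE rho1 mxE eqxx.
    rewrite -sum_bK hdual_suml (bigD1 None) //= big1 ?addr0 => [|t tn].
      by rewrite (eE_bK None).
    by rewrite eE_bK (negPf tn).
  rewrite sumr_const card_option card_ord.
  by have /pcharf0P -> := char0.
have eL : e * L = L by rewrite mulr_sumr; apply: eq_bigr => t _; rewrite e_GA.
have gL n : g ^+ n * L = L.
  by rewrite -eL mulrA -gidem_central ge_gX // expr1n scale1r.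
have xL i j : xm i j * L = (i == j)%:R *: L.
  rewrite -{1}eL mulrA -gidem_central e_xm -scalerAl.
  have [->|_] := eqVneq i j; last by rewrite !scale0r.
  congr (_ *: _).
  have ex t : exists u, xm j j * GA t == GA u.
    by have [u /eqP] := GA_mul (Some j) t; exists u.
  pose f t := xchoose (ex t).
  have fE t : xm j j * GA t = GA (f t) by apply/eqP; exact: (xchooseP (ex t)).
  have f_inj : injective f.
    by move=> s t fst; apply: (@GA_mulI j); rewrite /= !fE fst.
  rewrite /L mulr_sumr [RHS](reindex_inj f_inj).
  by apply: eq_bigr => t _; rewrite fE.
move=> f; rewrite dual_counitE {1}(Abasis_dec W f) mulr_suml.
rewrite {2}(Abasis_dec W f) hdual_sum scaler_suml.
apply: eq_bigr => -[n|[i j]] _ /=; rewrite -scalerAl hdualZ.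
  by rewrite chr1 mulr1 chrE gL.
by rewrite xL xmE rho1 mxE scalerA.
Qed.

End Core.

(** * Semisimplicity and gradings *)

Section Maschke.
Variables (k : fieldType) (A : hopfAlgType k).
Local Notation Δ := (@comul k A).
Local Notation ε := (@counit k A).
Local Notation S := (@antipode k A).
Variable (P : 'End(A)) (L : A).
Hypothesis Lint : forall a : A, a * L = (ε a : k) *: L.

Let avg z : A := tsum (fun x y => x * P (S y * z)) (Δ L).

Let F z (x y : A) : A := x * P (S y * z).

Let F_bilin z : bilin (F z).
Proof.
split=> [y|x] c u v; rewrite /F; first by rewrite linear_mulr.
by rewrite !linearP mulrDl -scalerAl linearP linear_mull.
Qed.

Let F_lin x y : linear (fun z => F z x y).
Proof. by move=> c u v; rewrite /F linear_mull linearP linear_mull. Qed.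

Let avg_lin : linear avg.
Proof. exact: tsum_linear_param. Qed.

(* a L_1 (x) S(L_2) = L_1 (x) S(L_2) a, for an integral L. *)
Let avgM a z : a * avg z = avg (a * z).
Proof.
have E c b w : tsum (F w) (comul (c * b)) =
    tsum (fun c1 c2 => tsum (fun b1 b2 => F w (c1 * b1) (c2 * b2)) (Δ b)) (Δ c).
  rewrite comulM (linear_tsum (G := tsum (F w))); last exact: linearP.
  apply: eq_tsum => c1 c2; rewrite (linear_tsum (G := tsum (F w))); last exact: linearP.
  by apply: eq_tsum => b1 b2; rewrite tsum_tens.
pose T a1 a2 a3 : A := tsum (fun x y => F (a3 * z) (a1 * x) (a2 * y)) (Δ L).
have t1 : tsum (fun a' a3 => tsum (fun a1 a2 => T a1 a2 a3) (Δ a')) (Δ a) = avg (a * z).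
  transitivity (tsum (fun a' a3 => (ε a' : k) *: avg (a3 * z)) (Δ a)).
    apply: eq_tsum => a' a3; rewrite /T -E Lint.
    by rewrite !linearZ.
  have lz : linear (fun x => avg (x * z)).
    by move=> c x y; rewrite linear_mulr avg_lin.
  rewrite -[in RHS](counitl a) (linear_tsum _ _ lz); apply: eq_tsum => a' a3.
  by rewrite (linear_scale _ _ lz).
rewrite -t1 sweedler_assoc.
- rewrite -{1}(counitr a) (linear_tsum _ _ (linear_mulr _)).
  apply: eq_tsum => a1 a'.
  transitivity (tsum (fun x y => tsum (fun a2 a3 =>
      a1 * x * P (S y * (S a2 * a3 * z))) (Δ a')) (Δ L)).
    rewrite -scalerAl /avg mulr_sumr scaler_sumr; apply: eq_bigr => i _.
    rewrite mulr_sumr scaler_sumr; apply: eq_bigr => j _.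
    set x := cvec i; set y := cvec j.
    have lG : linear (fun w : A => a1 * x * P (S y * (w * z))).
      by move=> c u v; rewrite linear_mulr linear_mull linearP linear_mull.
    rewrite -(linear_tsum _ _ lG) antipodel (linear_scale _ _ lG) mul1r.
    by rewrite -scalerAr scalerA mulrC -scalerA mulrA.
  rewrite exchange_tsum; apply: eq_tsum => a2 a3; apply: eq_tsum => x y.
  by rewrite /F antipodeM !mulrA.
- move=> y w; apply: tsum_linear_param => u v c s t.
  by rewrite /F linear_mulr linear_mulr.
- move=> x w; apply: tsum_linear_param => u v c s t.
  by rewrite /F linear_mulr linearP linear_mulr linearP linear_mull.
- move=> x y; apply: tsum_linear_param => u v c s t.
  by rewrite linear_mulr F_lin.
Qed.

(** Averaging P against the integral gives an A-linear map with values in U that is the nonzero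
    scalar counit of L on U; its kernel is the complement. *)
Lemma averaged_projection (U : {vspace A}) :
  left_ideal U -> (ε L : k) != 0 ->
  (forall a, P a \in U) -> (forall a, a \in U -> P a = a) ->
  exists W : {vspace A},
    [/\ left_ideal W, (U + W)%VS = fullv & (U :&: W)%VS = 0%VS].
Proof.
move=> /prodvP lU eL PU PE.
have lU' a u : u \in U -> a * u \in U by move=> uU; apply: lU => //; apply: memvf.
have avgU z : avg z \in U.
  rewrite /avg /tsum; apply: memv_suml => i _; apply: memv_suml => j _.
  by apply/memvZ/lU'/PU.
have avgE z : z \in U -> avg z = (ε L : k) *: z.
  move=> zU; transitivity (tsum (fun x y => x * S y * z) (Δ L)).
    by apply: eq_tsum => x y; rewrite PE ?mulrA // lU'.
  by rewrite -(linear_tsum _ _ (linear_mulr z)) antipoder -scalerAl mul1r.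
pose Q : {linear A -> A} := HB.pack avg (GRing.isLinear.Build _ _ _ _ _ avg_lin).
have kerE y : (y \in lker (linfun Q)) = (avg y == 0) by rewrite memv_ker (lfunE Q).
exists (lker (linfun Q)); split.
- apply/prodvP => a w _; rewrite !kerE => /eqP w0.
  by rewrite -avgM w0 mulr0.
- apply/eqP; rewrite eqEsubv subvf /=; apply/subvP => x _.
  pose u := (ε L : k)^-1 *: avg x; have uU : u \in U by exact/memvZ/avgU.
  rewrite -[x](subrK u) addrC memv_add //.
  rewrite kerE -scaleN1r addrC avg_lin.
  by rewrite avgE // /u (scalerA _ _^-1) divff // scale1r scaleN1r addNr.
- apply/eqP; rewrite -subv0; apply/subvP => x; rewrite memv_cap => /andP[xU].
  rewrite kerE avgE // scaler_eq0 (negPf eL) /= => /eqP ->.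
  exact: mem0v.
Qed.

End Maschke.

Lemma maschke (k : fieldType) (A : hopfAlgType k) (L : A) :
  (forall a : A, a * L = (counit a : k) *: L) -> (counit L : k) != 0 -> semisimple A.
Proof.
move=> Lint eL U lU; apply: (averaged_projection (P := projv U) Lint lU eL).
  by move=> a; apply: memv_proj.
by move=> a; apply: projv_id.
Qed.

(** * Gradings by the eigenvalues of an element acting centrally *)

Section Grading.
Variables (k : fieldType) (A : hopfAlgType k).
Hypothesis S_invol : forall a : A, antipode (antipode a) = a.
Implicit Types V W : rep A.

Lemma dsum_unit V W : rep_iso V W -> is_dsum V (fun _ : unit => W).
Proof.
move=> [f [g [hf hg gf fg]]]; exists (fun _ => g), (fun _ => f).
split=> [_|_|[] []|]; rewrite ?eqxx //.
by rewrite (big_pred1 tt) // => -[].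
Qed.

Section SubRep.
Variables (V : rep A) (m : nat) (C : 'M[k]_(deg V, m)) (R : 'M[k]_(m, deg V)).
Hypotheses (RC : R *m C = 1%:M).
Hypothesis CRV : forall a, C *m R *m V a = V a *m (C *m R).

Definition im_act a := R *m V a *m C.
Let im_act_lin : linear im_act.
Proof. by move=> c x y; rewrite /im_act linearP mulmxDr mulmxDl -scalemxAr -scalemxAl. Qed.
HB.instance Definition _ :=
  GRing.isLinear.Build k A 'M[k]_m _ im_act im_act_lin.

Lemma im_act1 : im_act 1 = 1%:M.
Proof. by rewrite /im_act Defs.act1 mulmx1 RC. Qed.

Lemma im_actM a b : im_act (a * b) = im_act a *m im_act b.
Proof.
rewrite /im_act Defs.actM -!mulmxA (mulmxA C) (mulmxA (C *m R)) CRV.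
by rewrite !mulmxA -(mulmxA _ R C) RC mulmx1.
Qed.
Definition im_rep : rep A := Rep im_act1 im_actM.

Lemma im_rep_homl : rep_hom (V := im_rep) (W := V) C.
Proof.
by move=> a; rewrite /= /im_act !mulmxA CRV -!mulmxA RC mulmx1.
Qed.

Lemma im_rep_homr : rep_hom (V := V) (W := im_rep) R.
Proof.
by move=> a; rewrite /= /im_act -!mulmxA -CRV !mulmxA RC mul1mx.
Qed.

(** Full abelian subcategories are closed under kernels, and this brings a summand into them: the
    image of the idempotent C R is the kernel of the complementary one. *)
Lemma im_rep_kernel : is_kernel (V := V) (W := V) (1%:M - C *m R) (K := im_rep) C.
Proof.
split; first exact: im_rep_homl.
  by rewrite mulmxBl mul1mx -mulmxA RC mulmx1 subrr.
move=> U u hu; rewrite mulmxBl mul1mx => /eqP; rewrite subr_eq0 => /eqP uE.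
exists (R *m u); split.
  split; last by rewrite mulmxA -uE.
  by move=> a; rewrite -mulmxA hu mulmxA im_rep_homr mulmxA.
by move=> v [_ <-]; rewrite mulmxA RC mul1mx.
Qed.

End SubRep.

Variables (s : nat) (zeta : k).
Hypotheses (s0 : s.+1%:R != 0 :> k) (zeta_prim : s.+1.-primitive_root zeta).
Variables (D : subcat A) (z : A).
Hypothesis D_fusion : fusion_subcat D.
Hypothesis z_central : forall V, D V -> forall a, V z *m V a = V a *m V z.
Hypothesis z_tensor : forall V W, D V -> D W -> tensor_rep V W z = V z *t W z.
Hypothesis z_dual : forall V, D V -> V (antipode z) *m V z = 1%:M.
Hypothesis z_order : forall V, D V -> V z ^+ s.+1 = 1%:M.
Hypothesis z_unit : counit z = 1.

Definition eig_subcat (c : k) : subcat A := fun V => D V /\ V z = c%:M.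

(** Since z acts centrally, its action on an object of D is an endomorphism; on a kernel or cokernel
    it equals the scalar c by uniqueness in the universal property. *)
Lemma eig_full_abelian c : full_abelian (eig_subcat c).
Proof.
have [[Dsum Dker Dcok] _ _ _] := D_fusion; split.
- move=> I V W [i [p [hip pi pi0 ip]]] DW; split.
    by apply: (Dsum I V W) => [|x]; [exists i, p | have [] := DW x].
  rewrite -[V z]mulmx1 -ip mulmx_sumr -[RHS]mulmx1 -ip mulmx_sumr.
  apply: eq_bigr => x _; have [hi _] := hip x; have [_ Wz] := DW x.
  by rewrite mulmxA -hi Wz mul_mx_scalar mul_scalar_mx -scalemxAl.
- move=> V W f K i [DV Vz] [DW Wz] hf hk.
  have DK := Dker V W f K i DV DW hf hk; split=> //.
  have [hi fi uniq_i] := hk.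
  have hz : rep_hom (V := K) (W := V) (i *m K z).
    by move=> a; rewrite -mulmxA z_central // mulmxA hi mulmxA.
  have [|v [_ v_uniq]] := uniq_i K (i *m K z) hz.
    by rewrite mulmxA fi mul0mx.
  rewrite -(v_uniq (K z)); last by split=> // a; rewrite z_central.
  apply: v_uniq; split; first by move=> a; rewrite scalar_mxC.
  by rewrite hi Vz scalar_mxC.
- move=> V W f Q p [DV Vz] [DW Wz] hf hc.
  have DQ := Dcok V W f Q p DV DW hf hc; split=> //.
  have [hp pf uniq_p] := hc.
  have hz : rep_hom (V := W) (W := Q) (Q z *m p).
    by move=> a; rewrite -mulmxA hp mulmxA z_central // mulmxA.
  have [|v [_ v_uniq]] := uniq_p Q (Q z *m p) hz.
    by rewrite -mulmxA pf mulmx0.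
  rewrite -(v_uniq (Q z)); last by split=> // a; rewrite z_central.
  apply: v_uniq; split; first by move=> a; rewrite scalar_mxC.
  by rewrite -hp Wz scalar_mxC.
Qed.

Lemma eig_tensor c d V W : eig_subcat c V -> eig_subcat d W ->
  eig_subcat (c * d) (tensor_rep V W).
Proof.
move=> [DV Vz] [DW Wz]; have [_ _ Dt _] := D_fusion.
split; first exact: Dt.
rewrite z_tensor // Vz Wz -[c%:M]mulmx1 -[d%:M]mulmx1 !mul_scalar_mx.
have [tl tr] := tensmx_bilin k (deg V) (deg W).
rewrite (linear_scale _ _ (tl _)) (linear_scale _ _ (tr _)) tensmx11.
by rewrite scalerA scalemx1.
Qed.

Lemma eig_dual c V : c != 0 -> eig_subcat c V -> eig_subcat c^-1 (dual_rep V).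
Proof.
move=> c0 [DV Vz]; have [_ _ _ Dd] := D_fusion; split; first exact: Dd.
have := z_dual DV; rewrite Vz mul_mx_scalar => h.
rewrite -[dual_rep V z]/((V (antipode z))^T).
have -> : V (antipode z) = c^-1%:M.
  by rewrite -[LHS]scale1r -(mulVf c0) -scalerA h scalemx1.
by rewrite tr_scalar_mx.
Qed.

Lemma eig_unit : eig_subcat 1 (unit_rep A).
Proof.
have [_ D1 _ _] := D_fusion; split=> //.
by rewrite -[LHS]/(counit z)%:M z_unit.
Qed.

Lemma eig_fusion : fusion_subcat (eig_subcat 1).
Proof.
split; first exact: eig_full_abelian.
- exact: eig_unit.
- by move=> V W hV hW; rewrite -[1]mulr1; apply: eig_tensor.
- by move=> V hV; rewrite -[1]invr1; apply: eig_dual => //; apply: oner_neq0.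
Qed.

Lemma eig_projectors n (X : 'M[k]_n) : X ^+ s.+1 = 1%:M ->
  exists P : 'I_s.+1 -> 'M[k]_n,
    [/\ forall i j, P i *m P j = (i == j)%:R *: P j,
        \sum_i P i = 1%:M,
        forall i, X *m P i = zeta ^+ i *: P i
      & forall M, X *m M = M *m X -> forall i, P i *m M = M *m P i].
Proof.
case: n X => [|n] X Xs.
  by exists (fun _ => 0); split=> *; rewrite [LHS]flatmx0 [RHS]flatmx0.
have zp (i : 'I_s.+1) : (zeta ^+ i) ^+ s.+1 = 1.
  by rewrite -exprM mulnC exprM (prim_expr_order zeta_prim) expr1n.
exists (fun i => gidem s.+1 X (zeta ^+ i)); split=> [i j||i|M XM i].
- rewrite -[LHS]/(_ * _) (gidemM _ s0 Xs) // (eq_prim_root_expr zeta_prim).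
  by rewrite !modn_small // eq_sym.
- exact: (gidem_sum _ s0).
- by rewrite -[LHS]/(_ * _) (g_gidem _ Xs).
- exact: gidem_comm.
Qed.

Lemma eig_dsum V : D V -> exists W : 'I_s.+1 -> rep A,
  (forall i : 'I_s.+1, eig_subcat (zeta ^+ i) (W i)) /\ is_dsum V W.
Proof.
move=> DV.
have [P [PP P1 XP PC]] := eig_projectors (z_order DV).
have Pid i : P i *m P i = P i by rewrite PP eqxx scale1r.
have PV i a : P i *m V a = V a *m P i by apply: PC; apply: z_central.
pose d i := \rank (P i).
pose c i : 'M_(deg V, d i) := col_base (P i).
pose r i : 'M_(d i, deg V) := row_base (P i).
have cr i : c i *m r i = P i := mulmx_base (P i).
have rc i : r i *m c i = 1%:M := idem_row_col (Pid i).
have crV i a : c i *m r i *m V a = V a *m (c i *m r i) by rewrite cr PV.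
clearbody c r; clearbody d.
have rc0 i j : i != j -> r i *m c j = 0.
  move=> ij; rewrite -[r i]mul1mx -(rc i) -[c j]mulmx1 -(rc j).
  rewrite !mulmxA -(mulmxA _ (c i)) cr -(mulmxA _ (c j)) cr -(mulmxA _ (P i)).
  by rewrite PP (negPf ij) scale0r mulmx0 mul0mx.
exists (fun i => im_rep (rc i) (crV i)); split.
  move=> i; split.
    have [[_ Dker _] _ _ _] := D_fusion.
    apply: (Dker V V _ _ _ DV DV _ (im_rep_kernel (rc i) (crV i))).
    by move=> a; rewrite mulmxBl mulmxBr mul1mx mulmx1 crV.
  have Pc : P i *m c i = c i by rewrite -cr -mulmxA rc mulmx1.
  have h : r i *m V z *m c i = (zeta ^+ i)%:M.
    by rewrite -[in LHS]Pc -mulmxA (mulmxA (V z)) XP -scalemxAl Pc -scalemxAr rc scalemx1.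
  exact: h.
exists c, r; split=> //; last by rewrite -P1; apply: eq_bigr => i _; exact: cr.
by move=> i; split; [apply: im_rep_homl | apply: im_rep_homr].
Qed.

Hypothesis eig_nonzero : forall i : 'I_s.+1,
  exists2 V, eig_subcat (zeta ^+ i) V & (0 < deg V)%N.

(** The index i of the additive group ['I_s.+1] stands for the eigenvalue zeta^i. Distinct
    eigenvalues admit no nonzero morphism, and the duality axiom uses that V is its own double
    dual. *)
Lemma eig_grading :
  faithful_grading D (fun i : 'I_s.+1 => eig_subcat (zeta ^+ i)).
Proof.
have zeta0 i : zeta ^+ i != 0.
  by rewrite expf_neq0 // (@unity_root_neq0 _ s.+1) // (prim_expr_order zeta_prim).
have zetaV (i : 'I_s.+1) : zeta ^+ (i^-1%g : 'I_s.+1) = (zeta ^+ i)^-1.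
  apply: (mulIf (zeta0 i)); rewrite mulVf // -exprD -[in LHS]/(Zp_opp i).
  rewrite /= -(prim_expr_mod zeta_prim) modnDml subnK; last exact: ltnW.
  by rewrite modnn expr0.
split.
- move=> g; split; first exact: eig_full_abelian.
  by split=> [V []|].
- split=> [V DV|g h V W f gh [_ Vz] [_ Wz] hf]; first exact: eig_dsum.
  have := hf z; rewrite Vz Wz mul_mx_scalar mul_scalar_mx => /eqP.
  rewrite -subr_eq0 -scalerBl scaler_eq0 subr_eq0 => /orP[|/eqP //].
  rewrite (eq_prim_root_expr zeta_prim) !modn_small // => /eqP/val_inj e.
  by rewrite e eqxx in gh.
- move=> g h V W hV hW; have := eig_tensor hV hW; rewrite -exprD.
  by rewrite -(prim_expr_mod zeta_prim).
- move=> g V; rewrite zetaV; split.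
    move=> hV; exists (dual_rep V).
      by rewrite -[zeta ^+ g]invrK; apply: eig_dual => //; rewrite invr_eq0.
    exists 1%:M, 1%:M; split; rewrite ?mulmx1 // => a; rewrite mul1mx mulmx1.
      by rewrite /= /dual_act trmxK S_invol.
    by rewrite /= /dual_act trmxK S_invol.
  move=> [W hW VW]; have [h _ _] := eig_full_abelian (zeta ^+ g)^-1.
  apply: (h unit V (fun=> dual_rep W)); first exact: dsum_unit.
  by move=> _; apply: eig_dual.
Qed.

End Grading.

Section PrimeStep.
Variables (k : closedFieldType) (A : hopfAlgType k).
Hypothesis char0 : [pchar k] =i pred0.
Hypothesis S_invol : forall a : A, antipode (antipode a) = a.
Variables (r : nat) (D : subcat A) (z : A).
Hypothesis r_prime : prime r.
Hypothesis D_fusion : fusion_subcat D.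
Hypothesis z_central : forall V, D V -> forall a, V z *m V a = V a *m V z.
Hypothesis z_tensor : forall V W, D V -> D W -> tensor_rep V W z = V z *t W z.
Hypothesis z_dual : forall V, D V -> V (antipode z) *m V z = 1%:M.
Hypothesis z_order : forall V, D V -> V z ^+ r = 1%:M.
Hypothesis z_unit : counit z = 1.

(* As r is prime, the group of eigenvalues of z on D is trivial or mu_r. *)
Lemma prime_grading : exists (gT : finGroupType) (Cg : gT -> subcat A),
  faithful_grading D Cg /\ (forall V, Cg 1%g V <-> eig_subcat D z 1 V).
Proof.
have trivial_part (s : nat) (zeta : k) V :
    eig_subcat D z (zeta ^+ (1%g : 'I_s.+1)) V <-> eig_subcat D z 1 V.
  by rewrite expr0.
case: (classic (forall V, D V -> V z = 1%:M)) => [triv|nontriv].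
  (* A grading by the trivial group: it covers the steps of the tower at which the category does not
     shrink. *)
  exists 'I_1, (fun i : 'I_1 => eig_subcat D z (1 ^+ i)); split=> //.
  apply: eig_grading => //; first exact: oner_neq0.
  - by apply/andP; split=> //; apply/forallP => i; rewrite !ord1 unity_rootE expr1n eqxx.
  - move=> i; rewrite expr1n; exists (unit_rep A) => //.
    exact: eig_unit.
have [V0 [DV0 V0z]] : exists V, D V /\ V z <> 1%:M.
  apply: NNPP => h; apply: nontriv => V DV; apply: NNPP => Vz; apply: h.
  by exists V.
have rE : r = r.-1.+1 by rewrite prednK // prime_gt0.
have r0 : r.-1.+1%:R != 0 :> k.
  by rewrite -rE; have /pcharf0P -> := char0; rewrite -lt0n prime_gt0.
have [zeta zp] := prim_root_closed (ltn0Sn r.-1) r0.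
have z_order' V : D V -> V z ^+ r.-1.+1 = 1%:M by rewrite -rE; apply: z_order.
exists 'I_r.-1.+1, (fun i : 'I_r.-1.+1 => eig_subcat D z (zeta ^+ i)); split=> //.
apply: (eig_grading S_invol r0 zp) => // j.
have [W [DW [i [q [hiq _ _ iq]]]]] := eig_dsum r0 zp D_fusion z_central z_order' DV0.
have [n /andP[n0 Wn]|h] := pickP (fun n : 'I_r.-1.+1 => (n != 0 :> nat) && (0 < deg (W n))%N);
  last first.
  case: V0z; rewrite -[V0 z]mulmx1 -iq mulmx_sumr; apply: eq_bigr => n _.
  have [hi _] := hiq n; have [_ Wz] := DW n; rewrite mulmxA -hi Wz.
  have := h n; case: eqP => [->|_] /=; first by rewrite expr0 mulmx1.
  case: (deg (W n)) (i n) (q n) => // i' q' _.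
  by rewrite [i']thinmx0 !mul0mx.
(* As r is prime, the nontrivial eigenvalue zeta^n of the nonzero summand [W n] generates all r-th
   roots of unity, and tensor powers of [W n] realise them. *)
have zn : r.-1.+1.-primitive_root (zeta ^+ n).
  have rP : prime r.-1.+1 by rewrite -rE.
  by rewrite (prim_root_exp_coprime _ zp) coprime_sym prime_coprime // gtnNdvd ?lt0n.
have zj : (zeta ^+ j) ^+ r.-1.+1 = 1.
  by rewrite -exprM mulnC exprM (prim_expr_order zp) expr1n.
have [m ->] := prim_rootP zn zj.
elim: (nat_of_ord m) => [|l [V hV V_gt0]].
  by exists (unit_rep A) => //; rewrite expr0; apply: eig_unit.
exists (tensor_rep (W n) V); last by rewrite /= muln_gt0 Wn.
by rewrite exprS; apply: eig_tensor.
Qed.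

End PrimeStep.

Lemma rep_powX (k : fieldType) (A : hopfAlgType k) (V : rep A) (a : A) n :
  V (a ^+ n) = V a ^+ n.
Proof.
elim: n => [|n IHn]; first by rewrite !expr0 Defs.act1.
by rewrite !exprS Defs.actM IHn.
Qed.

(** * The central series of the representation category of A *)

Section Chain.
Variables (k : closedFieldType) (p : nat) (H : hopfAlgType k).
Hypotheses (p_prime : prime p) (char0 : [pchar k] =i pred0).
Variables (W : splitting p H) (g : hdual H) (lam : 'I_p -> k).
Hypothesis Wg : weighted W g lam.
Local Notation A := (hdual H).
Local Notation xm := (xm W).
Local Notation e := (gidem p g 1).
Implicit Types V U : rep A.

Lemma rep_e V : V g = 1%:M -> V e = 1%:M.
Proof.
move=> Vg; rewrite /gidem linearZ linear_sum /=.
under eq_bigr => n _.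
  rewrite expr1n invr1 scale1r rep_powX Vg.
  have -> : (1%:M : 'M[k]_(deg V)) ^+ n = 1%:M by apply: expr1n.
over.
rewrite sumr_const card_ord -scaler_nat scalerA mulVf ?scale1r //.
by have /pcharf0P -> := char0; rewrite -lt0n prime_gt0.
Qed.

Lemma rep_eM V a : V g = 1%:M -> V a = V (e * a).
Proof. by move=> Vg; rewrite Defs.actM rep_e // mul1mx. Qed.

(** The order matters: the [xm i i] are shown to act as central grouplikes only where g acts
    trivially. *)
Definition steps : seq A := g :: [seq xm i i | i : 'I_p].

Lemma steps_xm l : (l < p)%N -> exists i, nth 1 steps l.+1 = xm i i.
Proof.
move=> lp.
have /imageP[i _ iE] : nth 1 [seq xm i i | i : 'I_p] l \in [seq xm i i | i : 'I_p].
  by rewrite mem_nth // size_map -cardE card_ord.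
by exists i.
Qed.

(** It descends from all of Rep A; [weighted_nilpotent] reads it backwards. *)
Fixpoint tower (j : nat) : subcat A :=
  if j is j'.+1 then eig_subcat (tower j') (nth 1 steps j') 1 else fun _ => True.

Lemma towerP j V : tower j V <-> forall l, (l < j)%N -> V (nth 1 steps l) = 1%:M.
Proof.
elim: j => [|j IHj] /=; first by [].
split=> [[/IHj h hj] l|h]; first by rewrite ltnS leq_eqVlt => /predU1P[->|/h].
by split; [apply/IHj => l lj; apply: h; apply: ltnW | apply: h].
Qed.

(** Where g acts as 1, so does e, and the action factors through eA, which is commutative by
    [xm_group]. In the coproduct of [xm i i] the terms with l <> i act by zero there, because e
    kills off-diagonal coefficients. *)
Lemma tower_step j : (j < p.+1)%N -> fusion_subcat (tower j) ->
  fusion_subcat (tower j.+1) /\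
  exists (gT : finGroupType) (Cg : gT -> subcat A),
    faithful_grading (tower j) Cg /\ (forall V, Cg 1%g V <-> tower j.+1 V).
Proof.
move=> jp fj.
suff [r [r_prime [zc zt zd zo zu]]] : exists r, prime r /\
    [/\ forall V, tower j V -> forall a, V (nth 1 steps j) *m V a = V a *m V (nth 1 steps j),
        forall V U, tower j V -> tower j U ->
          tensor_rep V U (nth 1 steps j) = V (nth 1 steps j) *t U (nth 1 steps j),
        forall V, tower j V -> V (antipode (nth 1 steps j)) *m V (nth 1 steps j) = 1%:M,
        forall V, tower j V -> V (nth 1 steps j) ^+ r = 1%:M
      & counit (nth 1 steps j) = 1].
  split; first exact: eig_fusion.
  apply: (prime_grading char0 _ r_prime) => // a.
  exact: (S_invol p_prime char0 Wg).
have gg := weighted_grouplike Wg.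
case: j jp fj => [|j] jp fj.
  exists p; split=> //=; split=> [V _ a|V U _ _|V _|V _|].
  - by rewrite -!Defs.actM (central_g p_prime char0 Wg).
  - have [dg _] := gg; have e1 : comul g = \sum_(l < 1) tens g g by rewrite big_ord1.
    by rewrite (tensor_rep_sum e1) big_ord1.
  - by rewrite -Defs.actM grouplikeVl // Defs.act1.
  - by rewrite -rep_powX (weighted_order Wg) Defs.act1.
  - by have [_ ->] := gg.
have [r r_prime [xC xr]] := xm_group p_prime char0 Wg.
have [i zE] := steps_xm jp.
have towg V : tower j.+1 V -> V g = 1%:M by move/towerP/(_ 0%N isT).
rewrite zE; exists r; split=> //; split=> [V /towg Vg a|V U /towg Vg /towg Ug|V /towg Vg|V /towg Vg|].
- rewrite (rep_eM a Vg) -!Defs.actM; congr (V _).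
  rewrite (e_dec p_prime char0 Wg) mulr_sumr mulr_suml; apply: eq_bigr => t _.
  rewrite -scalerAr -scalerAl; congr (_ *: _).
  by case: t => [l|] /=; [apply: xC | rewrite (gidem_central p_prime char0 Wg)].
- rewrite (tensor_rep_sum (comul_xm W i i)) (bigD1 i) //= big1 ?addr0 // => l li.
  rewrite (rep_eM _ Vg) (e_xm p_prime char0 Wg) eq_sym (negPf li) scale0r.
  by rewrite linear0 tens0mx.
- by rewrite -Defs.actM (S_xm_e p_prime char0 Wg) rep_e.
- by rewrite -rep_powX xr rep_e.
- by rewrite counit_xm eqxx.
Qed.

Lemma tower_fusion j : (j <= p.+1)%N -> fusion_subcat (tower j).
Proof.
elim: j => [|j IHj] jp; first by split.
by have [] := tower_step jp (IHj (ltnW jp)).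
Qed.

(** If g and all [xm i i] act trivially, [e_dec] turns the action of a into the scalar sum of the
    a(bK t), which is a(1), the counit of a. *)
Lemma tower_last V : tower p.+1 V <-> exists m, is_dsum V (fun _ : 'I_m => unit_rep A).
Proof.
split=> [/towerP h|[m [i [q [hiq _ _ iq]]]]].
  have Vg : V g = 1%:M by exact: (h 0%N).
  have Vx i : V (xm i i) = 1%:M.
    have := h i.+1; rewrite ltnS ltn_ord => /(_ isT) /=.
    by rewrite (nth_map i) ?size_enum_ord // nth_ord_enum.
  have Va a : V a = (counit a : k)%:M.
    rewrite (rep_eM _ Vg) (e_dec p_prime char0 Wg) linear_sum /=.
    rewrite dual_counitE -(sum_bK W) hdual_suml -scalemx1 scaler_suml.
    apply: eq_bigr => t _; rewrite linearZ /=; congr (_ *: _).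
    by case: t => [j|] /=; [apply: Vx | apply: rep_e].
  exists (deg V), (fun x => delta_mx x 0), (fun x => delta_mx 0 x).
  split.
  - by move=> x; split=> a; rewrite Va /= /unit_act scalar_mxC.
  - by move=> x; rewrite mul_delta_mx; apply/matrixP => a b; rewrite !ord1 !mxE eqxx.
  - by move=> x y xy; rewrite mul_delta_mx_0.
  - under eq_bigr => x _ do rewrite mul_delta_mx.
    apply/matrixP => a b; rewrite summxE mxE (bigD1 a) //= big1 => [|c ca].
      by rewrite mxE eqxx addr0 eq_sym.
    by rewrite mxE eq_sym (negPf ca).
have Va a : V a = (counit a : k)%:M.
  rewrite -[V a]mulmx1 -iq mulmx_sumr -[RHS]mulmx1 -iq mulmx_sumr.
  apply: eq_bigr => x _; have [hi _] := hiq x.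
  by rewrite mulmxA -hi /= /unit_act mul_mx_scalar mul_scalar_mx -scalemxAl.
apply/towerP => l lp; rewrite Va; congr (_%:M).
case: l lp => [|l] lp; first by have [_ ->] := weighted_grouplike Wg.
have [j ->] := steps_xm lp.
by rewrite counit_xm eqxx.
Qed.

Lemma weighted_nilpotent : nilpotent_hopf A.
Proof.
split.
  have [L Lint eL] := integral_GA p_prime char0 Wg.
  exact: maschke Lint eL.
exists p.+1, (fun i => tower (p.+1 - i)); split.
- by move=> i _; apply: tower_fusion; apply: leq_subr.
- by move=> V; rewrite subn0; apply: tower_last.
- by move=> V; rewrite subnn.
- move=> i ip; have jE : (p.+1 - i = (p.+1 - i.+1).+1)%N by rewrite -subSn.
  rewrite jE; apply: (tower_step _ _).2.
    by rewrite ltn_subrL.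
  by apply: tower_fusion; apply: leq_subr.
Qed.

End Chain.

Theorem proposition4p12 (k : closedFieldType) (char0 : [pchar k] =i pred0)
  (p : nat) (p_prime : prime p)
  (H : hopfAlgType k) (H_semisimple : semisimple H)
  (H_type : type_1p_p1 p H) :
  (forall g : hdual H, grouplike g -> g \in 'Z({: hdual H})%VS)
  /\ nilpotent_hopf (hdual H).
Proof.
have [W0 _] := type_splitting H_type; split.
  move=> g gg; have [->|g1] := eqVneq g 1.
    rewrite memv_cap memvf; apply/centvP => f _.
    by rewrite mul1r mulr1.
  have [W [lam Wg]] := grouplike_weighted p_prime char0 W0 gg g1.
  rewrite memv_cap memvf; apply/centvP => f _.
  by rewrite (central_g p_prime char0 Wg).
(* Since p > 1 there are two distinct characters, so one of them is not the unit of A. *)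
have [i chr1] : exists i, chr W0 i != 1.
  have p1 := prime_gt1 p_prime.
  pose i0 : 'I_p := Ordinal (ltnW p1); pose i1 : 'I_p := Ordinal p1.
  have [i0E|] := eqVneq (chr W0 i0) 1; last by exists i0.
  exists i1; apply/eqP => i1E; have := @chr_inj _ _ _ W0 i0 i1.
  by rewrite i0E i1E => /(_ erefl).
have [W [lam Wg]] := grouplike_weighted p_prime char0 W0 (chr_grouplike W0 i) chr1.
exact: (weighted_nilpotent p_prime char0 Wg).
Qed.
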